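(* Let $m\in\mathbb{R}$, $A:\mathbb{R}^3\to\mathbb{R}^3$, $\mathcal{H}=i^{-1}\alpha\cdot\nabla_A+m\beta$. Let $B=\operatorname{curl}A=B_1+B_2$ and assume $$C_0=\||x|^2B_1\|_{L^\infty(\mathbb{R}^3)}<\infty,\qquad\|B_2\|_{L^\infty(\mathbb{R}^3)}<\infty,$$ with $B_2\equiv0$ if $m=0$. Then, for any $f\in L^2(\mathbb{R}^3;\mathbb{C}^4)$ such that $\mathcal{H}f\in L^2$, and any $\epsilon<1$, the following inequality holds: $$m^2\int_{\mathbb{R}^3}|f|^2\,dx+\left(\frac{1-\epsilon}4-C_0\right)\int_{\mathbb{R}^3}\frac{|f|^2}{|x|^2}\,dx+\epsilon\int_{\mathbb{R}^3}|\nabla_Af|^2\,dx\le\left(1+\frac{\|B_2\|_{L^\infty}}{m^2}\right)\int_{\mathbb{R}^3}|\mathcal{H}f|^2\,dx,$$ where, when $m=0$ and $B_2\equiv0$, the right hand side is interpreted as $\int_{\mathbb{R}^3}|\mathcal{H}f|^2\,dx$.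
   Context: Dirac matrices: in $2\times2$ blocks, $\alpha_k=\begin{pmatrix}0&\sigma_k\\ \sigma_k&0\end{pmatrix}$ for $k=1,2,3$ and $\beta=\begin{pmatrix}I_2&0\\0&-I_2\end{pmatrix}$, where $\sigma_1=\begin{pmatrix}0&1\\1&0\end{pmatrix}$, $\sigma_2=\begin{pmatrix}0&-i\\i&0\end{pmatrix}$, $\sigma_3=\begin{pmatrix}1&0\\0&-1\end{pmatrix}$. Covariant derivatives: $\nabla_A=\nabla-iA$; $\mathcal{H}=i^{-1}\sum_{k=1}^3\alpha_k(\partial_k-iA^k)+m\beta$. Standing self-adjointness assumption (A): $\mathcal{H}$ is essentially selfadjoint on $C_c^\infty(\mathbb{R}^3;\mathbb{C}^4)$ and, for initial data $f\in C_c^\infty(\mathbb{R}^3;\mathbb{C}^4)$, the flow $e^{it\mathcal{H}}f$ belongs to $C(\mathbb{R},H^{3/2})$. Thus $f\in L^2$ with $\mathcal{H}f\in L^2$ means that $f$ belongs to the domain $D(\mathcal{H})$ of the selfadjoint extension. *)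

(* Defs.v *)
From HB Require Import structures.
From mathcomp Require Import all_boot all_order all_algebra.
From mathcomp Require Import all_classical all_reals all_analysis.
From mathcomp Require Import complex.

Set Implicit Arguments.
Unset Strict Implicit.
Unset Printing Implicit Defensive.

Import Order.TTheory GRing.Theory Num.Theory.
Import numFieldNormedType.Exports.

Local Open Scope classical_set_scope.
Local Open Scope ring_scope.

(* The topology and the sigma-algebra are those of the product R * R * R (the
   sup norm gives the usual topology); the Euclidean norm is [enorm] below. *)
Notation R3 R := (R * R * R)%type.
Notation spinor R := 'cV[R[i]]_4.

Definition leb3 (R : realType) :
    measure (measurableTypeR R * measurableTypeR R * measurableTypeR R)%type R :=
  (@lebesgue_measure R \x @lebesgue_measure R \x @lebesgue_measure R)%E.

Section Space.
Variable R : realType.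
Implicit Types (x y : R3 R) (k : 'I_3).

Definition crd x k : R :=
  match val k with 0%N => x.1.1 | 1%N => x.1.2 | _ => x.2 end.

Definition ebas k : R3 R :=
  ((val k == 0%N)%:R, (val k == 1%N)%:R, (val k == 2%N)%:R).

Definition edot x y : R := \sum_k crd x k * crd y k.

Definition enorm x : R := Num.sqrt (edot x x).

Definition partial k (phi : R3 R -> R) : R3 R -> R :=
  fun x => 'D_(ebas k) phi x.

(* All iterated partial derivatives exist and are Frechet differentiable, hence
   continuous. *)
Definition smooth (phi : R3 R -> R) :=
  forall (s : seq 'I_3) x, differentiable (foldr partial phi s) x.

Definition Cc_infty (phi : R3 R -> R) :=
  smooth phi /\ exists M : R, forall x, M < enorm x -> phi x = 0.

(* curl A = B in the sense of distributions. Indices are added modulo 3, so that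
   (curl A)_k = d_(k+1) A_(k+2) - d_(k+2) A_(k+1). *)
Definition weak_curl (A B : R3 R -> R3 R) :=
  forall (phi : R3 R -> R) k, Cc_infty phi ->
    \int[leb3 R]_x (crd (B x) k * phi x) =
    \int[leb3 R]_x (crd (A x) (k + 1) * partial (k + 2) phi x
                    - crd (A x) (k + 2) * partial (k + 1) phi x).

End Space.

Section Spinors.
Variable R : realType.
Implicit Types (f g h : R3 R -> spinor R).

Definition sqn (v : spinor R) : R :=
  \sum_j (complex.Re (v j 0) ^+ 2 + complex.Im (v j 0) ^+ 2).

Definition cint (F : R3 R -> R[i]) : R[i] :=
  Complex (\int[leb3 R]_x complex.Re (F x)) (\int[leb3 R]_x complex.Im (F x)).

Definition Cc_infty_spinor f :=
  forall j, Cc_infty (fun x => complex.Re (f x j 0)) /\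
            Cc_infty (fun x => complex.Im (f x j 0)).

Definition partial_spinor k f : R3 R -> spinor R := fun x =>
  \col_j Complex (partial k (fun y => complex.Re (f y j 0)) x)
                 (partial k (fun y => complex.Im (f y j 0)) x).

Definition L2_normsq f : \bar R := (\int[leb3 R]_x (sqn (f x))%:E)%E.

(* Elements of L^2 are represented by (Borel) measurable functions; equality in
   L^2 is equality almost everywhere. *)
Definition L2 f :=
  (forall j, measurable_fun setT (fun x => complex.Re (f x j 0)) /\
             measurable_fun setT (fun x => complex.Im (f x j 0))) /\
  (L2_normsq f < +oo)%E.

Definition ae_eq_spinor f g := {ae leb3 R, forall x, f x = g x}.

Definition L2_inner f g : R[i] :=
  cint (fun x => \sum_j f x j 0 * conjc (g x j 0)).

End Spinors.

(* Unbounded operators on L^2 are given by their graphs. *)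
Section Operators.
Variable R : realType.
Local Notation field := (R3 R -> spinor R).
Local Notation graph := (set (field * field)).

Definition op_closure (G : graph) : graph :=
  [set p | [/\ L2 p.1, L2 p.2 & exists q : nat -> field * field,
    [/\ forall n, G (q n),
        L2_normsq (fun x => (q n).1 x - p.1 x) @[n --> \oo] --> (0 : \bar R) &
        L2_normsq (fun x => (q n).2 x - p.2 x) @[n --> \oo] --> (0 : \bar R)]]].

Definition op_adjoint (G : graph) : graph :=
  [set p | [/\ L2 p.1, L2 p.2 &
    forall q, G q -> L2_inner q.2 p.1 = L2_inner q.1 p.2]].

Definition selfadjoint (G : graph) := op_adjoint G = G.

Definition essentially_selfadjoint (G : graph) := selfadjoint (op_closure G).

(* U t = e^(itG) for a selfadjoint G: U is the strongly continuous one-parameter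
   unitary group on L^2 whose infinitesimal generator is iG. Surjectivity of U t
   follows from the group law. *)
Definition unitary_flow (G : graph) (U : R -> field -> field) :=
  [/\ forall t f, L2 f -> L2 (U t f) /\ L2_normsq (U t f) = L2_normsq f,
      forall t f g (c : R[i]), L2 f -> L2 g ->
        ae_eq_spinor (U t (fun x => c *: f x + g x))
                     (fun x => c *: U t f x + U t g x),
      (forall f, L2 f -> ae_eq_spinor (U 0 f) f) /\
      (forall s t f, L2 f -> ae_eq_spinor (U (s + t) f) (U s (U t f))),
      forall t0 f, L2 f ->
        L2_normsq (fun x => U t f x - U t0 f x) @[t --> t0] --> (0 : \bar R) &
      forall f g, L2 f -> L2 g ->
        (G (f, g) <->
         L2_normsq (fun x => Complex h^-1 0 *: (U h f x - f x)
                             - Complex 0 1 *: g x) @[h --> 0^'] --> (0 : \bar R))].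

End Operators.

Section Sobolev.
Variable R : realType.
Implicit Types (f h : R3 R -> spinor R).

Definition fourier_const : R := (2 * pi) `^ (- (3 / 2)).

Definition fourier_test (phi : R3 R -> R) : R3 R -> R[i] := fun xi =>
  Complex fourier_const 0 *
  cint (fun x => Complex (phi x * cos (edot x xi)) (- (phi x * sin (edot x xi)))).

(* h is the Fourier transform of f in L^2, through the duality
   int h phi = int f phi^ with compactly supported smooth phi. *)
Definition is_fourier f h :=
  L2 h /\ forall (phi : R3 R -> R) j, Cc_infty phi ->
    cint (fun x => h x j 0 * Complex (phi x) 0) =
    cint (fun x => f x j 0 * fourier_test phi x).

(* The infimum is over representatives h of the Fourier transform of f, which
   agree almost everywhere. *)
Definition Hs_normsq (s : R) f : \bar R :=
  ereal_inf [set (\int[leb3 R]_xi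
                   ((1 + enorm xi ^+ 2) `^ s * sqn (h xi))%:E)%E | h in is_fourier f].

Definition Hs (s : R) f := L2 f /\ (Hs_normsq s f < +oo)%E.

Definition continuous_Hs (s : R) (u : R -> R3 R -> spinor R) :=
  (forall t, Hs s (u t)) /\
  forall t0, Hs_normsq s (fun x => u t x - u t0 x) @[t --> t0] --> (0 : \bar R).

End Sobolev.

Section Dirac.
Variable R : realType.
Local Notation I := (Complex 0 1 : R[i]).

Definition mx2 (a b c d : R[i]) : 'M[R[i]]_2 :=
  (block_mx a%:M b%:M c%:M d%:M : 'M[R[i]]_(1 + 1)).

Definition pauli (k : 'I_3) : 'M[R[i]]_2 :=
  match val k with
  | 0%N => mx2 0 1 1 0
  | 1%N => mx2 0 (- I) I 0
  | _ => mx2 1 0 0 (-1)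
  end.

Definition dirac_alpha (k : 'I_3) : 'M[R[i]]_4 :=
  (block_mx 0 (pauli k) (pauli k) 0 : 'M[R[i]]_(2 + 2)).

Definition dirac_beta : 'M[R[i]]_4 :=
  (block_mx 1%:M 0 0 (- 1%:M) : 'M[R[i]]_(2 + 2)).

Definition dirac (m : R) (A : R3 R -> R3 R) (f : R3 R -> spinor R) :
    R3 R -> spinor R := fun x =>
  I^-1 *: (\sum_k dirac_alpha k *m
             (partial_spinor k f x - (I * Complex (crd (A x) k) 0) *: f x))
  + Complex m 0 *: (dirac_beta *m f x).

(* The operator with domain C_c^oo(R^3; C^4). *)
Definition dirac_min (m : R) (A : R3 R -> R3 R) :
    set ((R3 R -> spinor R) * (R3 R -> spinor R)) :=
  [set p | Cc_infty_spinor p.1 /\ p.2 = dirac m A p.1].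

(* The first clause says that the operator is well defined from C_c^oo to L^2;
   it amounts to A in L^2_loc. *)
Definition selfadjointness_assumption (m : R) (A : R3 R -> R3 R) :=
  [/\ forall f, Cc_infty_spinor f -> L2 (dirac m A f),
      essentially_selfadjoint (dirac_min m A) &
      exists2 U : R -> (R3 R -> spinor R) -> (R3 R -> spinor R),
        unitary_flow (op_closure (dirac_min m A)) U &
        forall f, Cc_infty_spinor f -> continuous_Hs (3 / 2) (U ^~ f)].

(* f in L^2, H f = Hf in L^2, i.e. f is in the domain of the selfadjoint
   extension (the closure) and Hf is its image. *)
Definition dirac_dom (m : R) (A : R3 R -> R3 R) (f Hf : R3 R -> spinor R) :=
  op_closure (dirac_min m A) (f, Hf).

(* g = (d_k - i A^k) f in the sense of distributions, with g in L^2. *)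
Definition weak_cov_deriv (A : R3 R -> R3 R) (k : 'I_3)
    (f g : R3 R -> spinor R) :=
  L2 g /\ forall (phi : R3 R -> R) j, Cc_infty phi ->
    cint (fun x => g x j 0 * Complex (phi x) 0) =
    - cint (fun x => f x j 0 * Complex (partial k phi x) 0)
    - I * cint (fun x => f x j 0 * Complex (crd (A x) k * phi x) 0).

(* int |nabla_A f|^2: the weak gradient is unique almost everywhere, so all
   values in the set are equal; it is +oo if nabla_A f is not in L^2. Beware that
   in a sum of extended reals oo - oo is -oo, so that an inequality with such an
   indeterminate left-hand side asserts nothing. *)
Definition cov_energy (A : R3 R -> R3 R) (f : R3 R -> spinor R) : \bar R :=
  ereal_inf [set (\sum_(k < 3) L2_normsq (g k))%E |
             g in [set g : 'I_3 -> R3 R -> spinor R |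
                   forall k, weak_cov_deriv A k f (g k)]].

End Dirac.

(* Main.v *)
(* Integrating the square, for a smooth compactly supported f, gives Pauli's identity
     |Hf|^2 = m^2 |f|^2 + |grad_A f|^2 - int B.<Sigma f, f>
   in L^2 norms. The cross terms are exact derivatives and Jacobians, which
   integrate to 0, and the potential enters only through the weak equation
   curl A = B tested against products of components of f. Since |<Sigma f, f>| <= |f|^2 pointwise,
     m^2 |f|^2 + |grad_A f|^2 <= |Hf|^2 + C0 |f/|x||^2 + ||B2|| |f|^2,
   and m^2 |f|^2 <= |Hf|^2 absorbs the last term.

   The magnetic Hardy inequality |f/|x||^2 <= 4 |grad_A f|^2 follows by completing
   the square against the vector field x |x|^2 / (|x|^2 + eta)^2 and letting eta
   tend to 0.

   In the domain of the closure only f_n -> f and H f_n -> Hf are known. If f/|x| is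
   in L^2, the functions |x|^2 / (|x|^2 + eta) f_n, with eta = eta_n tending to 0
   slowly, approximate f also in the norm of f/|x|: the energy inequality then makes
   their covariant gradients Cauchy. If f/|x| is not in L^2, then C0 >= 1/4, and the
   left-hand side is -oo or, when eps = 0 and C0 = 1/4, is m^2 |f|^2. For eps < 0 one
   needs the Hardy inequality for an arbitrary weak covariant derivative of f; it
   suffices that the cut-off gradients of the f_n are bounded for each fixed eta. *)

Require Import Defs.
From HB Require Import structures.
From mathcomp Require Import all_boot all_order all_algebra.
From mathcomp Require Import all_classical all_reals all_analysis.
From mathcomp Require Import complex.
From mathcomp Require Import measurable_realfun ess_sup_inf ring lra.

Set Implicit Arguments.
Unset Strict Implicit.
Unset Printing Implicit Defensive.

Import Order.TTheory GRing.Theory Num.Theory.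
Import numFieldNormedType.Exports.

Local Open Scope classical_set_scope.
Local Open Scope ring_scope.

(** * Calculus of smooth functions *)

(** The potential is only locally square integrable, so H^2 is never formed. Every identity is
    stated for the real components of a test spinor: up to functions of integral 0 it is polynomial
    in their values, their derivatives and the potential, and [ring] checks it pointwise.

    The multiplier |x|^2 / (|x|^2 + eta) plays two roles. For fixed eta it vanishes to second order
    at the origin, so its product with 1 / |x| and its commutator with H are bounded on L^2; the
    energy inequality for the cut-off f_n then bounds their gradients whatever C0 is. As eta tends
    to 0, the commutator has the size of f / |x| times a weight that is at most 2 and tends to 0 off
    the origin, so it disappears in L^2 once f / |x| is in L^2. The Hardy vector field contains this
    multiplier as a factor because the gradients of the f_n are controlled only after multiplication
    by it.

    The energy inequality keeps the Hardy term on the right, so it can be applied to differences f_i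
    - f_j without any smallness of C0. *)

Section Smooth.
Variable R : realType.
Implicit Types (f g : R3 R -> R) (k : 'I_3).

Lemma partialD k f g x : differentiable f x -> differentiable g x ->
  partial k (fun y => f y + g y) x = partial k f x + partial k g x.
Proof.
by move=> df dg; rewrite /partial deriveD//; apply: diff_derivable.
Qed.

Lemma partialN k f x : differentiable f x ->
  partial k (fun y => - f y) x = - partial k f x.
Proof.
by move=> df; rewrite /partial deriveN//; apply: diff_derivable.
Qed.

Lemma partialB k f g x : differentiable f x -> differentiable g x ->
  partial k (fun y => f y - g y) x = partial k f x - partial k g x.
Proof.
by move=> df dg; rewrite partialD ?partialN//; exact: differentiableN.
Qed.

Lemma partialM k f g x : differentiable f x -> differentiable g x ->
  partial k (fun y => f y * g y) x = partial k f x * g x + f x * partial k g x.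
Proof.
move=> df dg; rewrite /partial deriveM; try exact: diff_derivable.
by rewrite addrC; congr (_ + _); rewrite mulrC.
Qed.

Lemma partialV k f x : differentiable f x -> f x != 0 ->
  partial k (fun y => (f y)^-1) x = - (partial k f x * ((f x)^-1 * (f x)^-1)).
Proof.
move=> df f0; rewrite /partial deriveV//; last exact: diff_derivable.
by rewrite scaleNr /GRing.scale/= expr2 invfM mulrC.
Qed.

Lemma partial_cst k (c : R) (x : R3 R) : partial k (fun=> c) x = 0.
Proof. by rewrite /partial derive_cst. Qed.

(** Named so that a linear structure can be attached to it; differentiability and the differential
    both follow from linearity. *)
Let coordinate k (x : R3 R) : R := crd x k.

Let coordinate_linear k : linear (coordinate k).
Proof. rewrite /coordinate. by case: k => -[|[|k]] /= ik a x y; rewrite /crd/=. Qed.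

HB.instance Definition _ k :=
  GRing.isLinear.Build R (R3 R) R _ (coordinate k) (@coordinate_linear k).

Lemma crd_continuous k : continuous (fun x : R3 R => crd x k).
Proof.
case: k => -[|[|k]] /= ik x; rewrite /crd/=.
- by apply: (@cvg_comp _ _ _ fst fst); [exact: cvg_fst|exact: cvg_fst].
- by apply: (@cvg_comp _ _ _ fst snd); [exact: cvg_fst|exact: cvg_snd].
- exact: cvg_snd.
Qed.

Lemma crd_differentiable k (x : R3 R) : differentiable (fun y : R3 R => crd y k) x.
Proof. exact: (@linear_differentiable _ _ _ (coordinate k) _ (@crd_continuous k)). Qed.

Lemma partial_crd k l (x : R3 R) : partial k (fun y : R3 R => crd y l) x = (k == l)%:R.
Proof.
rewrite /partial deriveE; last exact: crd_differentiable.
rewrite (@diff_lin _ _ _ (coordinate l) _ (@crd_continuous l)) /coordinate.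
by case: l => -[|[|[|//]]] /= il; case: k => -[|[|[|//]]] /= ik.
Qed.

(* Stable under [partial] by construction, hence equal to [smooth]; this gives the
   smoothness of products and inverses without a Leibniz formula of higher order. *)
Inductive smooth_alg : (R3 R -> R) -> Prop :=
| smooth_alg_smooth f of smooth f : smooth_alg f
| smooth_alg_cst c : smooth_alg (fun=> c)
| smooth_alg_crd k : smooth_alg (fun x => crd x k)
| smooth_algD f g of smooth_alg f & smooth_alg g : smooth_alg (fun x => f x + g x)
| smooth_algM f g of smooth_alg f & smooth_alg g : smooth_alg (fun x => f x * g x)
| smooth_algV f of smooth_alg f & (forall x, f x != 0) : smooth_alg (fun x => (f x)^-1).

Lemma smooth_alg_differentiable f x : smooth_alg f -> differentiable f x.
Proof.
elim=> {f}.
- by move=> f /(_ [::]).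
- by move=> c; exact: differentiable_cst.
- by move=> k; exact: crd_differentiable.
- by move=> f g _ df _ dg; exact: differentiableD.
- by move=> f g _ df _ dg; exact: differentiableM.
- by move=> f _ df f0; exact: differentiableV.
Qed.

Lemma smooth_alg_partial k f : smooth_alg f -> smooth_alg (partial k f).
Proof.
elim=> {f}.
(* Differentiating [partial k f] along [s] is differentiating [f] along [rcons s k]. *)
- by move=> f sf; apply: smooth_alg_smooth => s x; have := sf (rcons s k) x; rewrite foldr_rcons.
- move=> c; rewrite (_ : partial _ _ = fun=> 0); first exact: smooth_alg_cst.
  by apply/funext => x; rewrite partial_cst.
- move=> l; rewrite (_ : partial _ _ = fun=> (k == l)%:R); first exact: smooth_alg_cst.
  by apply/funext => x; rewrite partial_crd.
- move=> f g sf pf sg pg.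
  rewrite (_ : partial _ _ = fun x => partial k f x + partial k g x).
    exact: smooth_algD.
  by apply/funext => x; rewrite partialD//; exact: smooth_alg_differentiable.
- move=> f g sf pf sg pg.
  rewrite (_ : partial _ _ = fun x => partial k f x * g x + f x * partial k g x).
    by apply: smooth_algD; exact: smooth_algM.
  by apply/funext => x; rewrite partialM//; exact: smooth_alg_differentiable.
- move=> f sf pf f0.
  (* No constructor gives opposites, hence the constant factor -1. *)
  rewrite (_ : partial _ _ =
    fun x => (-1) * (partial k f x * ((f x)^-1 * (f x)^-1))).
    apply: smooth_algM; first exact: smooth_alg_cst.
    by apply: smooth_algM => //; apply: smooth_algM; exact: smooth_algV.
  apply/funext => x; rewrite partialV ?mulN1r//; exact: smooth_alg_differentiable.
Qed.

Lemma smooth_algP f : smooth_alg f <-> smooth f.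
Proof.
split=> [sf s x|]; last exact: smooth_alg_smooth.
apply: smooth_alg_differentiable; elim: s => //= k s; exact: smooth_alg_partial.
Qed.

Lemma smooth_diff f x : smooth f -> differentiable f x.
Proof. by move=> /(_ [::]). Qed.

Lemma smooth_partial k f : smooth f -> smooth (partial k f).
Proof. by move=> /smooth_algP/(smooth_alg_partial k)/smooth_algP. Qed.

Lemma smooth_cst (c : R) : smooth (fun=> c : R).
Proof. exact/smooth_algP/smooth_alg_cst. Qed.

Lemma smooth_crd k : smooth (fun x : R3 R => crd x k).
Proof. exact/smooth_algP/smooth_alg_crd. Qed.

Lemma smoothD f g : smooth f -> smooth g -> smooth (fun x => f x + g x).
Proof. by move=> /smooth_algP sf /smooth_algP sg; exact/smooth_algP/smooth_algD. Qed.

Lemma smoothM f g : smooth f -> smooth g -> smooth (fun x => f x * g x).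
Proof. by move=> /smooth_algP sf /smooth_algP sg; exact/smooth_algP/smooth_algM. Qed.

Lemma smoothV f : smooth f -> (forall x, f x != 0) -> smooth (fun x => (f x)^-1).
Proof. by move=> /smooth_algP sf f0; exact/smooth_algP/smooth_algV. Qed.

Lemma smoothN f : smooth f -> smooth (fun x => - f x).
Proof.
move=> sf; rewrite (_ : (fun x => - f x) = fun x => (-1) * f x).
  by apply: smoothM => //; exact: smooth_cst.
by apply/funext => x; rewrite mulN1r.
Qed.

Lemma smoothB f g : smooth f -> smooth g -> smooth (fun x => f x - g x).
Proof. by move=> sf sg; apply: smoothD => //; exact: smoothN. Qed.

Lemma smooth_continuous f : smooth f -> continuous f.
Proof. by move=> sf x; exact/differentiable_continuous/smooth_diff. Qed.

End Smooth.

Section Lines.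
Variable R : realType.
Implicit Types (f : R3 R -> R) (k : 'I_3).

Lemma is_derive_line f (x v : R3 R) (t : R) : differentiable f (x + t *: v) ->
  is_derive t (1 : R) (fun s : R => f (x + s *: v)) ('D_v f (x + t *: v)).
Proof.
move=> df.
have E : (fun h : R => h^-1 *: ((fun s : R => f (x + s *: v)) (h *: 1 + t) -
    f (x + t *: v))) = (fun h => h^-1 *: (f (h *: v + (x + t *: v)) - f (x + t *: v))).
  apply/funext => h; congr (_ *: (f _ - _)).
  by rewrite /GRing.scale/= mulr1 -/(GRing.scale _ _) scalerDl addrCA.
have := @diff_derivable _ _ _ f (x + t *: v) v df.
rewrite /derivable -E => dfv.
by apply: DeriveDef => //; rewrite /derive E.
Qed.

Lemma line_MVT k f (x : R3 R) (h : R) : smooth f -> 0 < h ->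
  exists2 t, 0 < t < h & f (x + h *: ebas R k) - f x = partial k f (x + t *: ebas R k) * h.
Proof.
move=> sf h0.
have df t : is_derive t (1 : R) (fun s : R => f (x + s *: ebas R k))
    (partial k f (x + t *: ebas R k)).
  by apply: is_derive_line; exact: smooth_diff.
have [|t] := @MVT R (fun s : R => f (x + s *: ebas R k)) _ 0 h h0 (fun t _ => df t).
  apply/continuous_subspaceT => t.
  by apply/differentiable_continuous/derivable1_diffP; case: (df t).
rewrite in_itv/= scale0r addr0 subr0 => th ->.
by exists t.
Qed.

(** Schwarz's theorem. The second difference over a square of side h is symmetric in the two
    directions; two mean value theorems make it h^2 times either mixed derivative at a point less
    than 2h away, and both derivatives are continuous. *)
Lemma partialC_mixed i j f (x : R3 R) : smooth f ->
  partial i (partial j f) x = partial j (partial i f) x.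
Proof.
move=> sf.
have norm_ebas k : `|ebas R k| <= 1.
  rewrite /ebas !prod_normE/= !ge_max !ger0_norm//.
  by apply/andP; split; [apply/andP; split|]; rewrite lern1; case: eqP.
have key (u v : 'I_3) (h : R) : 0 < h -> exists2 y, `|x - y| < 2 * h &
    f (x + h *: ebas R u + h *: ebas R v) - f (x + h *: ebas R v)
     - (f (x + h *: ebas R u) - f x) = partial u (partial v f) y * h ^+ 2.
  move=> h0.
  have df t : is_derive t (1 : R)
     (fun s : R => f (x + h *: ebas R u + s *: ebas R v) - f (x + s *: ebas R v))
     (partial v f (x + h *: ebas R u + t *: ebas R v) - partial v f (x + t *: ebas R v)).
    by apply: is_deriveB; apply: is_derive_line; exact: smooth_diff.
  have [|t] := @MVT R (fun s : R => f (x + h *: ebas R u + s *: ebas R v) - f (x + s *: ebas R v))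
      _ 0 h h0 (fun t _ => df t).
    apply/continuous_subspaceT => t.
    by apply/differentiable_continuous/derivable1_diffP; case: (df t).
  rewrite in_itv/= !scale0r !addr0 subr0 => /andP[t0 th] ->.
  have [s /andP[s0 sh]] := line_MVT u (x + t *: ebas R v) (smooth_partial v sf) h0.
  rewrite addrAC => ->; exists (x + t *: ebas R v + s *: ebas R u).
    rewrite -addrA opprD addNKr normrN (le_lt_trans (ler_normD _ _))//.
    rewrite !normrZ !gtr0_norm//.
    have := norm_ebas u; have := norm_ebas v; nra.
  by rewrite -mulrA expr2.
have c1 := smooth_continuous (smooth_partial i (smooth_partial j sf)) (x := x).
have c2 := smooth_continuous (smooth_partial j (smooth_partial i sf)) (x := x).
move: (key i j) (key j i) c1 c2 => {key sf}.
move: (partial i (partial j f)) (partial j (partial i f)) => F G keyF keyG c1 c2.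
apply/eqP; rewrite -subr_eq0 -normr_le0; apply/ler_addgt0Pl => e e0; rewrite addr0.
have e2 : 0 < e / 2 by rewrite divr_gt0.
have [d1 /= d10 h1] := (nbhs_normP _ _).1 (cvgr_distC_lt _ _ c1 _ e2).
have [d2 /= d20 h2] := (nbhs_normP _ _).1 (cvgr_distC_lt _ _ c2 _ e2).
pose h := Num.min d1 d2 / 2.
have h0 : 0 < h by rewrite divr_gt0// lt_min d10.
have hd : 2 * h = Num.min d1 d2 by rewrite /h mulrC divfK.
have [y1 yx1 E1] := keyF h h0; have [y2 yx2 E2] := keyG h h0.
have E : F y1 = G y2.
  apply: (mulIf (x := h ^+ 2)); first by rewrite expf_neq0// gt_eqF.
  rewrite -E1 -E2 (addrAC x (h *: ebas R j)).
  have swap (a b c d : R) : a - b - (c - d) = a - c - (b - d) by ring.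
  exact: swap.
rewrite hd lt_min in yx1; rewrite hd lt_min in yx2.
have /= := h1 y1 (proj1 (andP yx1)); have /= := h2 y2 (proj2 (andP yx2)).
rewrite E; move: (G y2) (F x) (G x) => p q r.
by rewrite !ltr_norml ler_norml => /andP[? ?] /andP[? ?]; apply/andP; split; lra.
Qed.
End Lines.

(** * Measurability of continuous functions for the product sigma-algebra *)

Section ContinuousMeasurable.
Variable R : realType.

Lemma bigcup_countType_measurable d (T : measurableType d) (I : countType)
    (F : I -> set T) : (forall i, measurable (F i)) -> measurable (\bigcup_i F i).
Proof.
move=> mF.
have -> : \bigcup_i F i = \bigcup_n (oapp F set0 (unpickle n)).
  apply/seteqP; split=> x [i _].
    by move=> Fx; exists (pickle i) => //; rewrite pickleK.
  by case: (unpickle i) => // j Fx; exists j.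
apply: bigcupT_measurable => n.
by case: (unpickle n) => //=; exact: measurable0.
Qed.

(** The sigma-algebra is generated by products, so an open set is written as the union of the
    countably many cubes with rational centre and radius that it contains. *)
Lemma open_measurable_R3 (U : set (R3 R)) : open U ->
  measurable (U : set (measurableTypeR R * measurableTypeR R * measurableTypeR R)).
Proof.
move=> oU.
pose box (q : rat * rat * rat * rat) : set (R3 R) :=
  (ball (ratr q.1.1.1 : R) (ratr q.2) `*` ball (ratr q.1.1.2 : R) (ratr q.2))
    `*` ball (ratr q.1.2 : R) (ratr q.2).
have mbox q : measurable (box q : set (measurableTypeR R * measurableTypeR R * measurableTypeR R)).
  apply: measurableX; [apply: measurableX|]; exact: measurable_ball.
pose D : set (rat * rat * rat * rat) := [set q | box q `<=` U].
have -> : U = \bigcup_(q in D) box q.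
  apply/seteqP; split=> [x Ux|x [q Dq bx]]; last exact: Dq.
  have /nbhs_ballP[e /= e0 xe] := oU x Ux.
  (* Two points of a cube of radius r are less than 2r apart, so r < e / 2 keeps a cube through x
     inside the ball of radius e. *)
  have /rat_in_itvoo[r] : 0 < e / 2 by rewrite divr_gt0.
  rewrite in_itv/= => /andP[r0 re].
  have rat_near (y : R) : exists q : rat, ball (ratr q : R) (ratr r) y.
    have /rat_in_itvoo[q] : y - ratr r < y + ratr r by rewrite ltrBlDr -addrA ltrDl addr_gt0.
    rewrite in_itv/= => /andP[q1 q2]; exists q.
    by rewrite /ball/= ltr_norml; apply/andP; split; lra.
  have [q1 h1] := rat_near x.1.1; have [q2 h2] := rat_near x.1.2.
  have [q3 h3] := rat_near x.2.
  exists (q1, q2, q3, r) => //= y [[/= y1 y2] y3]; apply: xe.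
  have nr (z q w : R) : ball q (ratr r) z -> ball q (ratr r) w -> ball z e w.
    rewrite /ball/= !ltr_norml => /andP[? ?] /andP[? ?]; apply/andP; split; lra.
  by split; [split|]; [exact: nr h1 _|exact: nr h2 _|exact: nr h3 _].
rewrite bigcup_mkcond; apply: bigcup_countType_measurable => q.
by case: ifP => // _; exact: measurable0.
Qed.

Lemma continuous_measurable_R3 (f : R3 R -> R) : continuous f -> measurable_fun setT f.
Proof.
move=> cf; apply: (measurability _ (RGenOpens.measurableE R)).
move=> _ [_ [a [b ->] <-]]; rewrite setTI; apply: open_measurable_R3.
by move/continuousP : cf; apply; exact: interval_open.
Qed.

End ContinuousMeasurable.

(** * Compactly supported functions and integration by parts *)

Section CompactSupport.
Variable R : realType.
Implicit Types (f g : R3 R -> R) (k : 'I_3).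

Lemma smooth_edot : smooth (fun x : R3 R => edot x x).
Proof.
rewrite (_ : (fun x => _) = fun x => crd x ord0 * crd x ord0 +
    (crd x (lift ord0 ord0) * crd x (lift ord0 ord0) +
     crd x (lift ord0 (lift ord0 ord0)) * crd x (lift ord0 (lift ord0 ord0)))).
  by apply: smoothD; [|apply: smoothD]; apply: smoothM; exact: smooth_crd.
by apply/funext => x; rewrite /edot !big_ord_recl big_ord0 addr0.
Qed.

Lemma edot_ge0 (x : R3 R) : 0 <= edot x x.
Proof. by apply: sumr_ge0 => k _; rewrite -expr2 sqr_ge0. Qed.

Lemma enorm_ge0 (x : R3 R) : 0 <= enorm x.
Proof. exact: sqrtr_ge0. Qed.

Lemma enorm_sqr (x : R3 R) : enorm x ^+ 2 = edot x x.
Proof. by rewrite sqr_sqrtr// edot_ge0. Qed.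

Lemma crd_le_enorm (x : R3 R) k : `|crd x k| <= enorm x.
Proof.
rewrite -sqrtr_sqr ler_wsqrtr// /edot (bigD1 k)//= expr2 lerDl.
by apply: sumr_ge0 => l _; rewrite -expr2 sqr_ge0.
Qed.

Lemma enorm_continuous : continuous (@enorm R).
Proof.
move=> x; apply: (@continuous_comp _ _ _ (fun x : R3 R => edot x x) Num.sqrt).
  exact: smooth_continuous smooth_edot _.
exact: sqrt_continuous.
Qed.

Lemma Cc_smooth f : Cc_infty f -> smooth f.
Proof. by case. Qed.

(** The region where M < |x| is open, so f vanishes near each of its points and the same M works for
    the derivative. *)
Lemma Cc_partial k f : Cc_infty f -> Cc_infty (partial k f).
Proof.
move=> [sf [M fM]]; split; first exact: smooth_partial.
exists M => x Mx; have nM : \forall y \near x, M < enorm y.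
  exact: (cvgr_gt _ (enorm_continuous (x := x))).
rewrite -(partial_cst k 0 x) /partial; apply: near_eq_derive.
by near=> y; apply: fM; near: y.
Unshelve. all: by end_near. Qed.

Lemma Cc_smoothM f g : smooth f -> Cc_infty g -> Cc_infty (fun x => f x * g x).
Proof.
move=> sf [sg [M gM]]; split; first exact: smoothM.
by exists M => x /gM ->; rewrite mulr0.
Qed.

Lemma CcD f g : Cc_infty f -> Cc_infty g -> Cc_infty (fun x => f x + g x).
Proof.
move=> [sf [M fM]] [sg [N gN]]; split; first exact: smoothD.
exists (Num.max M N) => x; rewrite gt_max => /andP[/fM -> /gN ->].
by rewrite addr0.
Qed.

Lemma Cc_bounded f : Cc_infty f -> exists C, forall x, `|f x| <= C.
Proof.
move=> [sf [M fM]].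
pose K : set (R3 R) := (`[- M, M] `*` `[- M, M]) `*` `[- M, M].
have cK : compact K by do 2 (apply: compact_setX; last exact: segment_compact);
  exact: segment_compact.
have cf : compact (f @` K).
  by apply: continuous_compact => //; apply: continuous_subspaceT; exact: smooth_continuous.
have [C [_ /(_ (C + 1))]] := compact_bounded cf.
rewrite ltrDl ltr01 => /(_ isT) h.
exists (Num.max 0 (C + 1)) => x; rewrite le_max.
have [/fM ->|xM] := ltP M (enorm x); first by rewrite normr0 lexx.
apply/orP; right; apply: h; exists x => //.
have xk k : - M <= crd x k <= M by rewrite -ler_norml (le_trans (crd_le_enorm x k)).
split; [split|]; rewrite /= in_itv/=;
  [exact: (xk ord0)|exact: (xk (lift ord0 ord0))|exact: (xk ord_max)].
Qed.

(** Balls are replaced by boxes of positive size, whose product measure is computed one coordinate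
    at a time. *)
Lemma box_support f : Cc_infty f -> exists2 M, 0 < M & forall x k, M < `|crd x k| -> f x = 0.
Proof.
move=> [sf [M fM]]; exists (Num.max M 1) => [|x k]; first by rewrite lt_max ltr01 orbT.
by rewrite gt_max => /andP[Mx _]; apply: fM; rewrite (lt_le_trans Mx)// crd_le_enorm.
Qed.

End CompactSupport.

Section DominatedByBox.
Context d (T : measurableType d) (R : realType) (mu : {measure set T -> \bar R}).

Lemma bounded_support_integrable (g : T -> R) (B : set T) (C : R) :
  measurable B -> (mu B < +oo)%E -> measurable_fun setT g ->
  (forall x, `|g x| <= C) -> (forall x, ~ B x -> g x = 0) ->
  mu.-integrable setT (EFin \o g).
Proof.
move=> mB Boo mg gC gB.
apply: (@le_integrable _ _ _ mu setT measurableT _ (EFin \o (fun x => C * \1_B x))).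
- exact/measurable_EFinP.
- move=> x _ /=; rewrite lee_fin indicE.
  have [xB|xB] := boolP (x \in B).
    by rewrite mulr1 (le_trans (gC x))// ler_norm.
  by rewrite gB ?normr0// => Bx; move/negP : xB; rewrite inE.
- rewrite (_ : _ \o _ = (fun x => C%:E * (\1_B x)%:E)%E); last by apply/funext.
  apply: integrableZl => //; apply/integrableP; split; first exact/measurable_EFinP.
  rewrite (eq_integral (fun x => (\1_B x)%:E)) ?integral_indic ?setIT//.
  by move=> x _; rewrite gee0_abs// lee_fin.
Qed.

End DominatedByBox.

Section IntegralPartial.
Variable R : realType.
Notation la := (@lebesgue_measure R).

(** Fubini's theorem on the triple product needs the measure on the first two factors as a
    sigma-finite measure of its own. *)
Definition leb2 : set (measurableTypeR R * measurableTypeR R) -> \bar R := (la \x la)%E.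
HB.instance Definition _ := Measure.on leb2.
Lemma leb2_sigma_finite : sigma_finite setT leb2.
Proof.
have /sigma_finiteP[F [TF ndF Foo]] := sigma_finiteT la.
exists (fun n => F n `*` F n).
  rewrite -setXTT TF predeqE => -[x y]; split.
    move=> [/= [n _ Fnx] [k _ Gky]]; exists (maxn n k) => //; split.
    - by move: x Fnx; exact/subsetPset/ndF/leq_maxl.
    - by move: y Gky; exact/subsetPset/ndF/leq_maxr.
  by move=> [n _ []/= ? ?]; split; exists n.
move=> k; have [? ?] := Foo k.
split; first exact: measurableX.
by rewrite /leb2 product_measure1E// lte_mul_pinfty// ge0_fin_numE.
Qed.
HB.instance Definition _ := Measure_isSigmaFinite.Build _ _ _ leb2 leb2_sigma_finite.

Lemma leb3_Fubini1 (f : R3 R -> \bar R) : (leb3 R).-integrable setT f ->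
  (\int[leb3 R]_x f x = \int[la]_x \int[leb2]_p f (p, x))%E.
Proof.
move=> If; have If' : (leb2 \x la)%E.-integrable setT f by [].
exact: esym (integral21_prod_meas1 If').
Qed.

Lemma leb3_Fubini2 (f : R3 R -> \bar R) : (leb3 R).-integrable setT f ->
  (\int[leb3 R]_x f x = \int[leb2]_p \int[la]_x f (p, x))%E.
Proof.
move=> If; have If' : (leb2 \x la)%E.-integrable setT f by [].
exact: esym (integral12_prod_meas1 If').
Qed.

Lemma leb2_Fubini1 (f : R * R -> \bar R) : leb2.-integrable setT f ->
  (\int[leb2]_x f x = \int[la]_y \int[la]_x f (x, y))%E.
Proof. by move=> If; exact: esym (integral21_prod_meas1 If). Qed.

Lemma leb2_Fubini2 (f : R * R -> \bar R) : leb2.-integrable setT f ->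
  (\int[leb2]_x f x = \int[la]_x \int[la]_y f (x, y))%E.
Proof. by move=> If; exact: esym (integral12_prod_meas1 If). Qed.

(** The primitive has to vanish at the endpoints of [-M, M] themselves, hence the weak inequality
    for F; the strict one is enough for f. *)
Lemma integral_derive_compact (F f : R -> R) (M : R) : 0 < M ->
  (forall t, is_derive t (1 : R) F (f t)) -> continuous f ->
  (forall t, M <= `|t| -> F t = 0) -> (forall t, M < `|t| -> f t = 0) ->
  (\int[la]_t (f t)%:E)%E = 0%E.
Proof.
move=> M0 dF cf FM fM.
have -> : (\int[la]_t (f t)%:E = \int[la]_(t in `[(- M)%R, M]) (f t)%:E)%E.
  rewrite [RHS]integral_mkcond; apply: eq_integral => t _.
  rewrite /patch; case: ifPn => // /negP tM; rewrite fM// ltNge; apply/negP => h.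
  by apply: tM; rewrite inE/= in_itv/= -ler_norml.
have cF : continuous F.
  by move=> t; apply/differentiable_continuous/derivable1_diffP; case: (dF t).
rewrite (@continuous_FTC2 _ f F).
- by rewrite !FM ?normrN ?ger0_norm// ?ltW// sube0.
- by rewrite (lt_trans _ M0)// oppr_lt0.
- exact: continuous_subspaceT.
- split; [by move=> t _; case: (dF t)|exact: cvg_at_right_filter (cF _)|].
  exact: cvg_at_left_filter (cF _).
- by move=> t _; rewrite derive1E; case: (dF t).
Qed.

Lemma lebesgue_itv_fin (M : R) : (la `[(- M)%R, M] < +oo)%E.
Proof. by rewrite lebesgue_measure_itv/=; case: ifP => _; rewrite -?EFinD ltry. Qed.

Lemma lebesgue_square_fin (M : R) :
  (leb2 (`[(- M)%R, M] `*` `[(- M)%R, M]) < +oo)%E.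
Proof.
rewrite /leb2 product_measure1E//= lte_mul_pinfty//; last exact: lebesgue_itv_fin.
by rewrite ge0_fin_numE//; exact: lebesgue_itv_fin.
Qed.

Lemma leb3_box_fin (M : R) :
  (leb3 R (`[(- M)%R, M] `*` `[(- M)%R, M] `*` `[(- M)%R, M]) < +oo)%E.
Proof.
rewrite /leb3/= product_measure1E//=; last exact: measurableX.
rewrite lte_mul_pinfty//; last exact: lebesgue_itv_fin.
by rewrite ge0_fin_numE//; exact: lebesgue_square_fin.
Qed.

Lemma Cc_measurable f : Cc_infty f -> measurable_fun [set: R3 R] f.
Proof. by move=> /Cc_smooth/smooth_continuous; exact: continuous_measurable_R3. Qed.

Lemma not_itv_gt (M t : R) : ~ t \in `[- M, M] -> M < `|t|.
Proof.
by move=> h; rewrite ltNge; apply/negP => tM; apply: h; rewrite in_itv/= -ler_norml.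
Qed.

Lemma Cc_integrable (f : R3 R -> R) : Cc_infty f ->
  (leb3 R).-integrable setT (EFin \o f).
Proof.
move=> cf; have [C fC] := Cc_bounded cf; have [M M0 fM] := box_support cf.
apply: (bounded_support_integrable _ (leb3_box_fin M) _ fC).
- by apply: measurableX => //; exact: measurableX.
- exact: Cc_measurable.
- move=> x /= xB; have [//|fx0] := eqVneq (f x) 0.
  have xk k : crd x k \in `[- M, M].
    by apply/contraT => /negP /not_itv_gt /fM fx; rewrite fx eqxx in fx0.
  by case: xB; split; [split|]; [exact: (xk ord0)|exact: (xk (lift ord0 ord0))|exact: (xk ord_max)].
Qed.

Lemma crd_line k (x : R3 R) (t : R) : crd (x + t *: ebas R k) k = crd x k + t.
Proof.
by case: k => -[|[|[|//]]] /= ?; rewrite /crd/ebas /= /GRing.scale/= mulr1.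
Qed.

Lemma integral_slice k (f : R3 R -> R) (x : R3 R) : Cc_infty f ->
  crd x k = 0 ->
  (\int[la]_t (partial k f (x + t *: ebas R k))%:E)%E = 0%E.
Proof.
move=> cf xk0; have [M M0 fM] := box_support cf.
have [N N0 fN] := box_support (Cc_partial k cf).
have E t : crd (x + t *: ebas R k) k = t by rewrite crd_line xk0 add0r.
(* Adding 1 to M turns the strict inequality of [box_support] into the weak one needed at the
   endpoints. *)
have MN0 : 0 < Num.max (M + 1) N by rewrite lt_max N0 orbT.
apply: (integral_derive_compact (F := fun t => f (x + t *: ebas R k)) MN0).
- by move=> t; apply: is_derive_line; exact/smooth_diff/Cc_smooth.
- move=> t.
  apply: (@cvg_comp _ _ _ (fun s : R => x + s *: ebas R k) (partial k f)
     _ (nbhs (x + t *: ebas R k))).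
    by apply: cvgD; [exact: cvg_cst|exact: scalel_continuous].
  exact/smooth_continuous/smooth_partial/Cc_smooth.
- move=> t; rewrite ge_max => /andP[tM _]; apply: (fM _ k); rewrite E.
  by rewrite (lt_le_trans _ tM)// ltrDl.
- by move=> t; rewrite gt_max => /andP[_ tM]; apply: (fN _ k); rewrite E.
Qed.

(** The order of integration is chosen for each k so that the innermost integral runs in the
    direction of the derivative, where it is 0. *)
Lemma integral_partial k (f : R3 R -> R) : Cc_infty f ->
  (\int[leb3 R]_x (partial k f x)%:E)%E = 0%E.
Proof.
move=> cf; have ci := Cc_integrable (Cc_partial k cf).
have [C fC] := Cc_bounded (Cc_partial k cf).
have [M M0 fM] := box_support (Cc_partial k cf).
have iz z : leb2.-integrable setT (EFin \o (fun p => partial k f (p, z))).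
  apply: (bounded_support_integrable _ (lebesgue_square_fin M) (C := C)).
  - exact: measurableX.
  - exact: (measurableT_comp (Cc_measurable (Cc_partial k cf)) (measurable_pair2 z)).
  - by move=> p; exact: fC.
  - move=> p /= pB; have [//|fx0] := eqVneq (partial k f (p, z)) 0.
    have xk l : crd (p, z) l \in `[- M, M].
      by apply/contraT => /negP /not_itv_gt /fM fx; rewrite fx eqxx in fx0.
    by case: pB; split; [exact: (xk ord0)|exact: (xk (lift ord0 ord0))].
have slice x := @integral_slice k f x cf.
have shift0 (x y z t : R) : ((x, y), z) + t *: ebas R k =
    ((x + t * (val k == 0)%:R, y + t * (val k == 1)%:R), z + t * (val k == 2)%:R) by [].
move: ci iz slice shift0 {C M M0 fC fM}; case: k => -[|[|[|//]]] /= k3 ci iz slice shift0.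
- apply: etrans (leb3_Fubini1 ci) _; rewrite integral0_eq// => z _.
  apply: etrans (leb2_Fubini1 (iz z)) _; rewrite integral0_eq// => y _.
  apply: etrans (slice ((0, y), z) erefl); apply: eq_integral => t _.
  by rewrite shift0 add0r !mulr0 mulr1 !addr0.
- apply: etrans (leb3_Fubini1 ci) _; rewrite integral0_eq// => z _.
  apply: etrans (leb2_Fubini2 (iz z)) _; rewrite integral0_eq// => x _.
  apply: etrans (slice ((x, 0), z) erefl); apply: eq_integral => t _.
  by rewrite shift0 add0r !mulr0 mulr1 !addr0.
- apply: etrans (leb3_Fubini2 ci) _; rewrite integral0_eq// => -[x y] _.
  apply: etrans (slice ((x, y), 0) erefl); apply: eq_integral => t _.
  by rewrite shift0 add0r !mulr0 mulr1 !addr0.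
Qed.

End IntegralPartial.

(** * Square integrable spinors *)

Section SpinorL2.
Variable R : realType.
Implicit Types (v w : spinor R) (f g h : R3 R -> spinor R) (a : R3 R -> R).
Local Notation mu := (leb3 R).

(** The real part of the Hermitian product. The energies involve nothing else, and all integrals
    stay real. *)
Definition sdot v w : R := \sum_j (complex.Re (v j 0) * complex.Re (w j 0) +
                                   complex.Im (v j 0) * complex.Im (w j 0)).

Definition rscal (t : R) v : spinor R := Complex t 0 *: v.

Lemma sdotC v w : sdot v w = sdot w v.
Proof. by apply: eq_bigr => j _; rewrite mulrC [X in _ + X]mulrC. Qed.

Lemma ReDv v w j : complex.Re ((v + w) j 0) = complex.Re (v j 0) + complex.Re (w j 0).
Proof. by rewrite mxE; case: (v j 0) (w j 0) => [? ?] [? ?]. Qed.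

Lemma ImDv v w j : complex.Im ((v + w) j 0) = complex.Im (v j 0) + complex.Im (w j 0).
Proof. by rewrite mxE; case: (v j 0) (w j 0) => [? ?] [? ?]. Qed.

Lemma ReNv v j : complex.Re ((- v) j 0) = - complex.Re (v j 0).
Proof. by rewrite mxE; case: (v j 0). Qed.

Lemma ImNv v j : complex.Im ((- v) j 0) = - complex.Im (v j 0).
Proof. by rewrite mxE; case: (v j 0). Qed.

Lemma ReZv t v j : complex.Re (rscal t v j 0) = t * complex.Re (v j 0).
Proof. by rewrite mxE; case: (v j 0) => [? ?] /=; rewrite mul0r subr0. Qed.

Lemma ImZv t v j : complex.Im (rscal t v j 0) = t * complex.Im (v j 0).
Proof. by rewrite mxE; case: (v j 0) => [? ?] /=; rewrite mul0r addr0. Qed.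

Definition cptE := (ReDv, ImDv, ReNv, ImNv, ReZv, ImZv).

Lemma spinorP v w :
  (forall j, complex.Re (v j 0) = complex.Re (w j 0)) ->
  (forall j, complex.Im (v j 0) = complex.Im (w j 0)) -> v = w.
Proof.
move=> hR hI; apply/matrixP => j k; rewrite (ord1 k).
by have := hR j; have := hI j; case: (v j 0) (w j 0) => [? ?] [? ?] /= -> ->.
Qed.

Lemma sdotDl u v w : sdot (u + v) w = sdot u w + sdot v w.
Proof.
by rewrite -big_split/=; apply: eq_bigr => j _; rewrite !cptE !mulrDl addrACA.
Qed.

Lemma sdotZl t u w : sdot (rscal t u) w = t * sdot u w.
Proof. by rewrite mulr_sumr; apply: eq_bigr => j _; rewrite !cptE mulrDr !mulrA. Qed.

Lemma rscalN1 v : rscal (-1) v = - v.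
Proof. by apply: spinorP => j; rewrite !cptE mulN1r. Qed.

Lemma sdotNl u w : sdot (- u) w = - sdot u w.
Proof. by rewrite -rscalN1 sdotZl mulN1r. Qed.

Lemma sdotDr u v w : sdot w (u + v) = sdot w u + sdot w v.
Proof. by rewrite sdotC sdotDl !(sdotC w). Qed.

Lemma sdotNr u w : sdot w (- u) = - sdot w u.
Proof. by rewrite sdotC sdotNl !(sdotC w). Qed.

Lemma sdotZr t u w : sdot w (rscal t u) = t * sdot w u.
Proof. by rewrite sdotC sdotZl !(sdotC w). Qed.

Lemma sdotvv v : sdot v v = sqn v.
Proof. by []. Qed.

Lemma sqn_ge0 v : 0 <= sqn v.
Proof. by apply: sumr_ge0 => j _; rewrite addr_ge0// sqr_ge0. Qed.

Lemma sqr_Re_le_sqn v j : complex.Re (v j 0) ^+ 2 <= sqn v.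
Proof.
rewrite /sqn (bigD1 j)//= -addrA lerDl addr_ge0 ?sqr_ge0// sumr_ge0// => k _.
by rewrite addr_ge0// sqr_ge0.
Qed.

Lemma sqr_Im_le_sqn v j : complex.Im (v j 0) ^+ 2 <= sqn v.
Proof.
rewrite /sqn (bigD1 j)//= addrAC lerDr addr_ge0 ?sqr_ge0// sumr_ge0// => k _.
by rewrite addr_ge0// sqr_ge0.
Qed.

Lemma sqnZ t v : sqn (rscal t v) = t ^+ 2 * sqn v.
Proof. by rewrite -!sdotvv sdotZl sdotZr mulrA expr2. Qed.

Lemma sqnN v : sqn (- v) = sqn v.
Proof. by rewrite -!sdotvv sdotNl sdotNr opprK. Qed.

Lemma sqnD v w : sqn (v + w) = sqn v + sqn w + 2 * sdot v w.
Proof.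
rewrite -!sdotvv sdotDl !sdotDr (sdotC w v).
by move: (sdot v v) (sdot v w) (sdot w w) => p q r; ring.
Qed.

Lemma sqn_le2 v w : sqn (v + w) <= 2 * sqn v + 2 * sqn w.
Proof.
have := sqn_ge0 (v - w); rewrite !sqnD sqnN sdotNr.
by move: (sqn v) (sqn w) (sdot v w) => p q r; lra.
Qed.

Lemma sdot_le v w : `|sdot v w| <= sqn v + sqn w.
Proof.
have := sqn_ge0 (v - w); have := sqn_ge0 (v + w); rewrite !sqnD sqnN sdotNr.
have := sqn_ge0 v; have := sqn_ge0 w.
move: (sqn v) (sqn w) (sdot v w) => p q r.
by rewrite ler_norml => *; apply/andP; split; lra.
Qed.

Definition spinor_mfun f := forall j, measurable_fun setT (fun x => complex.Re (f x j 0)) /\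
  measurable_fun setT (fun x => complex.Im (f x j 0)).

Lemma spinor_mfunD f g : spinor_mfun f -> spinor_mfun g -> spinor_mfun (fun x => f x + g x).
Proof.
move=> mf mg j; have [? ?] := mf j; have [? ?] := mg j.
by split; [under eq_fun do rewrite ReDv|under eq_fun do rewrite ImDv];
  exact: measurable_funD.
Qed.

Lemma spinor_mfunZ a f : measurable_fun setT a -> spinor_mfun f ->
  spinor_mfun (fun x => rscal (a x) (f x)).
Proof.
move=> ma mf j; have [? ?] := mf j.
by split; [under eq_fun do rewrite ReZv|under eq_fun do rewrite ImZv];
  exact: measurable_funM.
Qed.

Lemma spinor_mfunN f : spinor_mfun f -> spinor_mfun (fun x => - f x).
Proof.
move=> mf; under eq_fun do rewrite -rscalN1.
by apply: (@spinor_mfunZ (fun=> -1)) => //; exact: measurable_cst.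
Qed.

Lemma spinor_mfunB f g : spinor_mfun f -> spinor_mfun g -> spinor_mfun (fun x => f x - g x).
Proof. by move=> mf mg; apply: spinor_mfunD => //; exact: spinor_mfunN. Qed.

Lemma measurable_sdot f g : spinor_mfun f -> spinor_mfun g ->
  measurable_fun setT (fun x => sdot (f x) (g x)).
Proof.
move=> mf mg; apply: measurable_sum => j; have [? ?] := mf j; have [? ?] := mg j.
by apply: measurable_funD; exact: measurable_funM.
Qed.

Lemma measurable_sqn f : spinor_mfun f -> measurable_fun setT (fun x => sqn (f x)).
Proof. by move=> mf; exact: measurable_sdot. Qed.

Lemma L2P f : L2 f <-> spinor_mfun f /\ mu.-integrable setT (EFin \o (fun x => sqn (f x))).
Proof.
have E : (\int[mu]_x `|(EFin \o (fun x => sqn (f x))) x| = L2_normsq f)%E.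
  by apply: eq_integral => x _; rewrite /= ger0_norm// sqn_ge0.
split=> [[mf fo]|[mf /integrableP[_]]]; last by rewrite E.
split=> //; apply/integrableP; split; last by rewrite E.
apply/measurable_EFinP. exact: measurable_sqn.
Qed.

Lemma L2_spinor_mfun f : L2 f -> spinor_mfun f. Proof. by case/L2P. Qed.

Lemma L2_sqn f : L2 f -> mu.-integrable setT (EFin \o (fun x => sqn (f x))).
Proof. by case/L2P. Qed.

Lemma integrableZ2D (a b : R3 R -> R) (s t : R) :
  mu.-integrable setT (EFin \o a) -> mu.-integrable setT (EFin \o b) ->
  mu.-integrable setT (EFin \o (fun x => s * a x + t * b x)).
Proof.
move=> ia ib; rewrite (_ : _ \o _ =
  ((fun x => s%:E * (EFin \o a) x) \+ (fun x => t%:E * (EFin \o b) x))%E) //.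
by apply: integrableD => //; exact: integrableZl.
Qed.

Lemma L2_sdot f g : L2 f -> L2 g ->
  mu.-integrable setT (EFin \o (fun x => sdot (f x) (g x))).
Proof.
move=> /L2P[mf If] /L2P[mg Ig].
apply: (@le_integrable _ _ _ mu setT measurableT _
  (EFin \o (fun x => 1 * sqn (f x) + 1 * sqn (g x)))).
- by apply/measurable_EFinP; exact: measurable_sdot.
- move=> x _ /=; rewrite !mul1r lee_fin (le_trans (sdot_le _ _))// ger0_norm//.
  by rewrite addr_ge0// sqn_ge0.
- exact: integrableZ2D.
Qed.

Lemma le_L2 f (b : R3 R -> R) : spinor_mfun f -> (forall x, sqn (f x) <= b x) ->
  mu.-integrable setT (EFin \o b) -> L2 f.
Proof.
move=> mf fb ib; apply/L2P; split=> //.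
apply: (le_integrable _ _ _ ib) => //; first by apply/measurable_EFinP; exact: measurable_sqn.
move=> x _ /=; rewrite lee_fin ger0_norm ?sqn_ge0// (le_trans (fb x))//.
exact: ler_norm.
Qed.

Lemma L2D f g : L2 f -> L2 g -> L2 (fun x => f x + g x).
Proof.
move=> /L2P[mf If] /L2P[mg Ig]; apply: (le_L2 _ (fun x => sqn_le2 (f x) (g x))).
  exact: spinor_mfunD.
exact: integrableZ2D.
Qed.

Lemma sqnZ_le t C v : `|t| <= C -> sqn (rscal t v) <= C ^+ 2 * sqn v.
Proof.
move=> tC; rewrite sqnZ ler_wpM2r ?sqn_ge0// -real_normK ?num_real//.
by rewrite lerXn2r ?nnegrE// (le_trans _ tC).
Qed.

Lemma L2Z a f C : measurable_fun setT a -> (forall x, `|a x| <= C) ->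
  L2 f -> L2 (fun x => rscal (a x) (f x)).
Proof.
move=> ma aC /L2P[mf If].
apply: (@le_L2 _ (fun x => C ^+ 2 * sqn (f x) + 0 * sqn (f x))); first exact: spinor_mfunZ.
  by move=> x; rewrite mul0r addr0 sqnZ_le.
exact: integrableZ2D.
Qed.

Lemma L2Zc t f : L2 f -> L2 (fun x => rscal t (f x)).
Proof. by apply: (@L2Z (fun=> t) f `|t|) => //; exact: measurable_cst. Qed.

Lemma L2N f : L2 f -> L2 (fun x => - f x).
Proof. by move=> /(L2Zc (-1)) Lf; under eq_fun do rewrite -rscalN1. Qed.

Lemma L2B f g : L2 f -> L2 g -> L2 (fun x => f x - g x).
Proof. by move=> Lf Lg; apply: L2D => //; exact: L2N. Qed.

Definition rdot f g : R := \int[mu]_x sdot (f x) (g x).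
Definition nrm2 f : R := \int[mu]_x sqn (f x).

Lemma L2_normsqE f : L2 f -> L2_normsq f = (nrm2 f)%:E.
Proof.
move=> Lf; rewrite /nrm2 /Rintegral fineK//.
by have := L2_sqn Lf; exact: integrable_fin_num.
Qed.

Lemma rdotff f : rdot f f = nrm2 f. Proof. by []. Qed.

Lemma rdotC f g : rdot f g = rdot g f.
Proof. by apply: eq_Rintegral => x _; rewrite sdotC. Qed.

Lemma rdotDl f g h : L2 f -> L2 g -> L2 h ->
  rdot (fun x => f x + g x) h = rdot f h + rdot g h.
Proof.
move=> Lf Lg Lh; rewrite -RintegralD//; try exact: L2_sdot.
by apply: eq_Rintegral => x _; rewrite sdotDl.
Qed.

Lemma rdotBl f g h : L2 f -> L2 g -> L2 h ->
  rdot (fun x => f x - g x) h = rdot f h - rdot g h.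
Proof.
move=> Lf Lg Lh; rewrite -RintegralB//; try exact: L2_sdot.
by apply: eq_Rintegral => x _; rewrite sdotDl sdotNl.
Qed.

Lemma rdotDr f g h : L2 f -> L2 g -> L2 h ->
  rdot h (fun x => f x + g x) = rdot h f + rdot h g.
Proof. by move=> *; rewrite rdotC rdotDl// !(rdotC h). Qed.

Lemma rdotBr f g h : L2 f -> L2 g -> L2 h ->
  rdot h (fun x => f x - g x) = rdot h f - rdot h g.
Proof. by move=> *; rewrite rdotC rdotBl// !(rdotC h). Qed.

Lemma rdotZl t f g : L2 f -> L2 g -> rdot (fun x => rscal t (f x)) g = t * rdot f g.
Proof.
move=> Lf Lg; rewrite -RintegralZl//; last exact: L2_sdot.
by apply: eq_Rintegral => x _; rewrite sdotZl.
Qed.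

Lemma nrm2_ge0 f : 0 <= nrm2 f.
Proof. by apply: Rintegral_ge0 => x _; exact: sqn_ge0. Qed.

Lemma nrm2Zc t f : L2 f -> nrm2 (fun x => rscal t (f x)) = t ^+ 2 * nrm2 f.
Proof.
move=> Lf; rewrite -RintegralZl//; last exact: L2_sqn.
by apply: eq_Rintegral => x _; rewrite sqnZ.
Qed.

Lemma nrm2D f g : L2 f -> L2 g ->
  nrm2 (fun x => f x + g x) = nrm2 f + nrm2 g + 2 * rdot f g.
Proof.
move=> Lf Lg; have Lfg := L2D Lf Lg.
rewrite -rdotff rdotDl// !rdotDr// !rdotff (rdotC g f).
by move: (nrm2 f) (nrm2 g) (rdot f g) => p q r; ring.
Qed.

Lemma nrm2B f g : L2 f -> L2 g ->
  nrm2 (fun x => f x - g x) = nrm2 f + nrm2 g - 2 * rdot f g.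
Proof.
move=> Lf Lg; have Lfg := L2B Lf Lg.
rewrite -rdotff rdotBl// !rdotBr// !rdotff (rdotC g f).
by move: (nrm2 f) (nrm2 g) (rdot f g) => p q r; ring.
Qed.

Lemma nrm2_le2 f g : L2 f -> L2 g ->
  nrm2 (fun x => f x + g x) <= 2 * nrm2 f + 2 * nrm2 g.
Proof.
move=> Lf Lg; have := nrm2_ge0 (fun x => f x - g x); rewrite nrm2B// nrm2D//.
by move: (nrm2 f) (nrm2 g) (rdot f g) => p q r; lra.
Qed.

Lemma nrm2BC f g : nrm2 (fun x => f x - g x) = nrm2 (fun x => g x - f x).
Proof. by apply: eq_Rintegral => x _; rewrite -sqnN opprB. Qed.

Lemma rdot_CS f g : L2 f -> L2 g -> rdot f g ^+ 2 <= nrm2 f * nrm2 g.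
Proof.
move=> Lf Lg.
have key t : 0 <= nrm2 f + t ^+ 2 * nrm2 g - 2 * (t * rdot f g).
  have := nrm2_ge0 (fun x => f x - rscal t (g x)).
  by rewrite nrm2B//; [rewrite rdotC rdotZl// nrm2Zc// (rdotC g)|exact: L2Zc].
move: (nrm2_ge0 f) (nrm2_ge0 g) key.
move: (nrm2 f) (nrm2 g) (rdot f g) => p q r p0 q0 key.
have [q00|qn0] := eqVneq q 0.
  rewrite q00 mulr0; have [->|rn0] := eqVneq r 0; first by rewrite expr0n.
  (* With q = 0 the quadratic expression is affine in t, and this t would give it the value -1. *)
  have := key ((p + 1) / (2 * r)).
  rewrite q00 mulr0 addr0 (_ : 2 * _ = p + 1); first lra.
  by field.
have qp : 0 < q by rewrite lt_neqAle eq_sym qn0.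
(* The minimizer of the quadratic expression in t. *)
have := key (r / q); rewrite -(ler_pM2r qp) mul0r.
rewrite (_ : (_ - _) * q = p * q - r ^+ 2); first by rewrite subr_ge0.
by field.
Qed.

Lemma nrm2Z_le a f C : measurable_fun setT a -> (forall x, `|a x| <= C) -> L2 f ->
  nrm2 (fun x => rscal (a x) (f x)) <= C ^+ 2 * nrm2 f.
Proof.
move=> ma aC Lf; rewrite -RintegralZl//; last exact: L2_sqn.
apply: le_Rintegral => //; first exact/L2_sqn/(L2Z ma aC).
  rewrite (_ : _ \o _ = EFin \o (fun x => C ^+ 2 * sqn (f x) + 0 * sqn (f x))).
    by apply: integrableZ2D; exact: L2_sqn.
  by apply/funext => x /=; rewrite mul0r addr0.
by move=> x _; exact: sqnZ_le.
Qed.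

End SpinorL2.

(** * Fatou's lemma and the completeness of real L^2 *)

Section Convergence.
Context d (T : measurableType d) (R : realType) (mu : {measure set T -> \bar R}).

Lemma limn_einf_le (u : (\bar R)^nat) B : (forall n, u n <= B)%E -> (limn_einf u <= B)%E.
Proof.
move=> uB; apply: le_trans (limn_einf_sup u) _.
apply: (@le_trans _ _ (ereal_sup (u @` setT))).
  by apply: ereal_inf_lbound; exists setT => //; exact: filterT.
by apply: ge_ereal_sup => _ [n _ <-].
Qed.

Lemma measurable_limn_einf (f : (T -> \bar R)^nat) :
  (forall n, measurable_fun setT (f n)) -> measurable_fun setT (fun x => limn_einf (f ^~ x)).
Proof.
move=> mf.
have -> : (fun x => limn_einf (f ^~ x)) = -%E \o (fun x => limn_esup (fun n => - f n x))%E.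
  apply/funext => x /=; rewrite -limn_einfN; congr limn_einf.
  by apply/funext => n /=; rewrite oppeK.
apply: measurableT_comp => //; apply: measurable_fun_limn_esup => n.
exact: measurableT_comp.
Qed.

Lemma fatou_le (g_ : nat -> T -> R) (g : T -> R) (B : \bar R) :
  (forall n, measurable_fun setT (g_ n)) -> measurable_fun setT g ->
  (forall n x, 0 <= g_ n x) -> (forall x, 0 <= g x) ->
  {ae mu, forall x, g_ n x @[n --> \oo] --> g x} ->
  (forall n, \int[mu]_x (g_ n x)%:E <= B)%E -> (\int[mu]_x (g x)%:E <= B)%E.
Proof.
move=> mg_ mg g_0 g0 gg gB.
rewrite (@ge0_ae_eq_integral _ _ _ mu setT _ (fun x => limn_einf (fun n => (g_ n x)%:E))).
- apply: le_trans (limn_einf_le gB); apply: fatou => //.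
  + by move=> n; exact/measurable_EFinP.
  + by move=> n x _; rewrite lee_fin.
- exact: measurableT.
- exact/measurable_EFinP.
- by apply: measurable_limn_einf => n; exact/measurable_EFinP.
- by move=> x _; rewrite lee_fin.
- move=> x _; rewrite limn_einf_lim; apply: lime_ge; first exact: is_cvg_einfs.
  by apply: nearW => n; apply: le_ereal_inf_tmp => _ [k _ <-]; rewrite lee_fin.
- apply: filterS gg => x gx _; apply: esym; apply: (fst (cvg_limn_einf_sup _)).
  by apply: cvg_EFin => //; exact: nearW.
Qed.

Lemma L2_complete_real (u : nat -> T -> R) :
  (forall n, measurable_fun setT (u n)) ->
  (forall e : R, 0 < e -> exists N, forall n m, (N <= n)%N -> (N <= m)%N ->
     (\int[mu]_x ((u n x - u m x) ^+ 2)%:E <= e%:E)%E) ->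
  exists2 v : T -> R, measurable_fun setT v & forall e : R, 0 < e -> exists N, forall n, (N <= n)%N ->
     (\int[mu]_x ((u n x - v x) ^+ 2)%:E <= e%:E)%E.
Proof.
move=> mu_ Cu.
(* Along a subsequence with squared increments of norm [8 ^- k], the sum of
   [4 ^+ k * w k x ^+ 2] is finite almost everywhere, so [w k x = O(2 ^- k)]. *)
have /choice[N HN] : forall k, exists N, forall n m, (N <= n)%N -> (N <= m)%N ->
     (\int[mu]_x ((u n x - u m x) ^+ 2)%:E <= (8^-1 ^+ k)%:E)%E.
  by move=> k; apply: Cu; rewrite exprn_gt0.
(* Summing the indices makes [phi] nondecreasing and keeps it above both [N k] and k. *)
pose phi k := (\sum_(i < k.+1) (N i).+1)%N.
have phiN k : (N k <= phi k)%N by rewrite /phi big_ord_recr/= (leq_trans _ (leq_addl _ _)).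
have phiS k : (phi k <= phi k.+1)%N by rewrite /phi [leqRHS]big_ord_recr/= leq_addr.
have phik k : (k <= phi k)%N.
  elim: k => // k IH; rewrite /phi big_ord_recr/= -/(phi k) addnS ltnS.
  exact: leq_trans IH (leq_addr _ _).
pose w k x := u (phi k.+1) x - u (phi k) x.
have mw k : measurable_fun setT (w k) by exact: measurable_funB.
have m4w k : measurable_fun setT (fun x => 4 ^+ k * w k x ^+ 2).
  by apply: measurable_funM => //; exact: measurable_funX.
pose S x := (\sum_(0 <= k <oo) (4 ^+ k * w k x ^+ 2)%:E)%E.
have t0 k x : (0 <= (4 ^+ k * w k x ^+ 2)%:E)%E.
  by rewrite lee_fin mulr_ge0 ?sqr_ge0// exprn_ge0.
have S0 x : (0 <= S x)%E by apply: nneseries_ge0 => *; exact: t0.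
have iS : mu.-integrable setT S.
  apply/integrableP; split.
    apply: (@ge0_emeasurable_sum _ _ _ _ (fun k x => (4 ^+ k * w k x ^+ 2)%:E) xpredT).
      by move=> k x _ _; exact: t0.
    by move=> k _; exact/measurable_EFinP.
  rewrite (eq_integral S); last by move=> x _; rewrite gee0_abs.
  rewrite integral_nneseries//; last by move=> n; exact/measurable_EFinP.
  (* The terms are at most 4^k 8^-k = 2 / 2^(k+1), in the form that [epsilon_trick0] sums. *)
  apply: (@le_lt_trans _ _ (\sum_(0 <= k <oo) (2 / (2 ^ k.+1)%:R)%:E)%E); last first.
    by apply: le_lt_trans (epsilon_trick0 _ _) (ltry 2).
  apply: lee_nneseries; first by move=> *; apply: integral_ge0 => *; exact: t0.
  move=> k _; under eq_integral do rewrite EFinM.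
  rewrite ge0_integralZl_EFin ?exprn_ge0//; last first.
  - by apply/measurable_EFinP; exact: measurable_funX.
  - by move=> x _; rewrite lee_fin sqr_ge0.
  apply: (@le_trans _ _ ((4 ^+ k)%:E * (8^-1 ^+ k)%:E)%E).
    rewrite lee_pmul2l// ?lte_fin ?exprn_gt0//.
    by apply: HN; rewrite ?phiN// (leq_trans (phiN k)).
  rewrite -EFinM lee_fin -exprMn natrX exprS invfM mulrA divff// mul1r -exprVn.
  by rewrite (_ : 4 / 8 = 2^-1)//; lra.
have cvgu : {ae mu, forall x, cvgn (fun k => u (phi k) x)}.
  apply: filterS (integrable_ae measurableT iS) => x /(_ I) Sx.
  pose s := fine (S x).
  have s0 : 0 <= s by exact: fine_ge0.
  have ws k : `|w k x| <= Num.sqrt s * 2^-1 ^+ k.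
    have : 4 ^+ k * w k x ^+ 2 <= s.
      rewrite -lee_fin fineK//.
      apply: le_trans (nneseries_lim_ge k.+1 _); last by move=> *; exact: t0.
      by rewrite big_nat_recr//= leeDr// sume_ge0.
    move=> ws2; rewrite -(@ler_pXn2r _ 2)// ?nnegrE ?mulr_ge0 ?sqrtr_ge0 ?exprn_ge0//.
    rewrite exprMn sqr_sqrtr// real_normK ?num_real// -exprM mulnC exprM.
    rewrite (_ : 2^-1 ^+ 2 = 4^-1 :> R); last by rewrite expr2 -invfM -natrM.
    rewrite exprVn ler_pdivlMr ?exprn_gt0//.
    by rewrite mulrC.
  have cw : cvgn (series (fun k => w k x)).
    apply: normed_cvg; apply: (@series_le_cvg _ _ (geometric (Num.sqrt s) 2^-1)) => //.
    - by move=> n; exact: normr_ge0.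
    - by move=> n; rewrite /= mulr_ge0 ?sqrtr_ge0 ?exprn_ge0.
    - by apply: is_cvg_geometric_series; rewrite ger0_norm//; lra.
  have -> : (fun k => u (phi k) x) = (fun k => u (phi 0) x + series (fun k => w k x) k).
    by apply/funext => k; exact: (eq_sum_telescope (fun k => u (phi k) x) k).
  by apply: is_cvgD => //; exact: is_cvg_cst.
(* The upper limit is measurable whether or not the sequence converges; the value that [fine] gives
   to an infinite limit matters only on a null set. *)
pose v x := fine (limn_esup (fun k => (u (phi k) x)%:E)).
have mv : measurable_fun setT v.
  apply: measurableT_comp => //; apply: measurable_fun_limn_esup => n.
  exact/measurable_EFinP.
exists v => // e e0; have [M HM] := Cu e e0.
exists M => n Mn.
apply: (@fatou_le (fun k x => (u n x - u (phi (k + M)%N) x) ^+ 2)).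
- by move=> k; apply: measurable_funX; exact: measurable_funB.
- by apply: measurable_funX; exact: measurable_funB.
- by move=> *; exact: sqr_ge0.
- by move=> *; exact: sqr_ge0.
- apply: filterS cvgu => x cx.
  have uv : u (phi k) x @[k --> \oo] --> v x.
    rewrite /v.
    have cE : (u (phi k) x)%:E @[k --> \oo] --> (limn (fun k => u (phi k) x))%:E.
      by apply: cvg_EFin => //; exact: nearW.
    by have [_ ->] := cvg_limn_einf_sup cE.
  rewrite expr2; under eq_fun do rewrite expr2.
  have h : u n x - u (phi (k + M)%N) x @[k --> \oo] --> u n x - v x.
    apply: cvgB; first exact: cvg_cst.
    by rewrite (cvg_shiftn M (fun k => u (phi k) x)).
  exact: cvgM.
- by move=> k; apply: HM => //; rewrite (leq_trans _ (phik _))// leq_addl.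
Qed.

End Convergence.

(** * Strong convergence of spinors *)

Section SpinorLimits.
Variable R : realType.
Implicit Types (f g h : R3 R -> spinor R) (F G : nat -> R3 R -> spinor R).
Local Notation mu := (leb3 R).

Definition cvL2 F f := nrm2 (fun x => F n x - f x) @[n --> \oo] --> (0 : R).

(** The shape in which the Cauchy-Schwarz inequality yields limits. *)
Lemma cvg0_sqr_le (u b : nat -> R) c : (forall n, u n ^+ 2 <= b n * c) ->
  b n @[n --> \oo] --> (0 : R) -> u n @[n --> \oo] --> (0 : R).
Proof.
move=> ub b0.
have cb : Num.sqrt (b n * c) @[n --> \oo] --> (0 : R).
  have bc : b n * c @[n --> \oo] --> (0 : R).
    by rewrite -(mul0r c); apply: cvgM => //; exact: cvg_cst.
  by have := @cvg_comp _ _ _ _ Num.sqrt _ _ _ bc (@sqrt_continuous R 0); rewrite sqrtr0.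
apply/cvgr0Pnorm_le => e e0.
move/cvgr0Pnorm_le : cb => /(_ e e0); apply: filterS => n; apply: le_trans.
by apply: le_trans (ler_norm _); rewrite -sqrtr_sqr ler_wsqrtr.
Qed.

Lemma cvL2_rdot F f g : (forall n, L2 (F n)) -> L2 f -> L2 g -> cvL2 F f ->
  rdot (F n) g @[n --> \oo] --> rdot f g.
Proof.
move=> LF Lf Lg Ff; apply/subr_cvg0.
apply: (@cvg0_sqr_le _ _ (nrm2 g) _ Ff) => n.
by rewrite -rdotBl//; apply: rdot_CS => //; exact: L2B.
Qed.

Lemma cvL2_nrm2 F f : (forall n, L2 (F n)) -> L2 f -> cvL2 F f ->
  nrm2 (F n) @[n --> \oo] --> nrm2 f.
Proof.
move=> LF Lf Ff.
have E n : nrm2 (F n) = nrm2 (fun x => F n x - f x) + (2 * rdot (F n) f - nrm2 f).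
  by rewrite nrm2B//; ring.
have E0 : 0 + (2 * rdot f f - nrm2 f) = nrm2 f by rewrite rdotff; ring.
have : nrm2 (F n) @[n --> \oo] --> 0 + (2 * rdot f f - nrm2 f).
  under eq_fun do rewrite E.
  apply: cvgD => //; apply: cvgB; last exact: cvg_cst.
  by apply: cvgM; [exact: cvg_cst|exact: cvL2_rdot].
by rewrite E0.
Qed.

Lemma cvL2_squeeze F f (b : nat -> R) :
  (forall n, nrm2 (fun x => F n x - f x) <= b n) -> b n @[n --> \oo] --> (0 : R) ->
  cvL2 F f.
Proof.
move=> Fb b0; apply: (squeeze_cvgr _ (cvg_cst 0) b0).
by apply: nearW => n; rewrite nrm2_ge0 Fb.
Qed.

Lemma cvL2D F G f g : (forall n, L2 (F n)) -> (forall n, L2 (G n)) -> L2 f -> L2 g ->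
  cvL2 F f -> cvL2 G g -> cvL2 (fun n x => F n x + G n x) (fun x => f x + g x).
Proof.
move=> LF LG Lf Lg Ff Gg.
apply: (@cvL2_squeeze _ _ (fun n => 2 * nrm2 (fun x => F n x - f x)
   + 2 * nrm2 (fun x => G n x - g x))) => [n|].
  apply: le_trans (nrm2_le2 (L2B (LF n) Lf) (L2B (LG n) Lg)).
  rewrite le_eqVlt; apply/orP; left; apply/eqP; apply: eq_Rintegral => x _.
  by rewrite opprD addrACA.
have <- : 2 * 0 + 2 * 0 = 0 :> R by rewrite !mulr0 addr0.
exact: cvgD (cvgM (cvg_cst _) Ff) (cvgM (cvg_cst _) Gg).
Qed.

Lemma rscalB t (v w : spinor R) : rscal t (v - w) = rscal t v - rscal t w.
Proof. exact: scalerBr. Qed.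

Lemma cvL2Z (a : R3 R -> R) (C : R) F f : measurable_fun setT a -> (forall x, `|a x| <= C) ->
  (forall n, L2 (F n)) -> L2 f -> cvL2 F f ->
  cvL2 (fun n x => rscal (a x) (F n x)) (fun x => rscal (a x) (f x)).
Proof.
move=> ma aC LF Lf Ff.
apply: (@cvL2_squeeze _ _ (fun n => C ^+ 2 * nrm2 (fun x => F n x - f x))) => [n|].
  apply: le_trans (nrm2Z_le ma aC (L2B (LF n) Lf)).
  rewrite le_eqVlt; apply/orP; left; apply/eqP; apply: eq_Rintegral => x _.
  by rewrite rscalB.
by rewrite -(mulr0 (C ^+ 2)); apply: cvgM => //; exact: cvg_cst.
Qed.

Lemma cvL2_normsq F f : (forall n, L2 (F n)) -> L2 f ->
  L2_normsq (fun x => F n x - f x) @[n --> \oo] --> (0 : \bar R)%E -> cvL2 F f.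
Proof.
move=> LF Lf; under eq_fun => n do rewrite (L2_normsqE (L2B (LF n) Lf)).
by move=> /fine_cvgP[].
Qed.

Lemma cvL2_cauchy F f : (forall n, L2 (F n)) -> L2 f -> cvL2 F f ->
  forall e : R, 0 < e -> exists N, forall n m, (N <= n)%N -> (N <= m)%N ->
    nrm2 (fun x => F n x - F m x) <= e.
Proof.
move=> LF Lf Ff e e0.
have e4 : 0 < e / 4 by rewrite divr_gt0.
move/cvgr0Pnorm_le : Ff => /(_ _ e4)[N _ HN].
exists N => n m Nn Nm.
have := HN n Nn; have := HN m Nm; rewrite /= !ger0_norm ?nrm2_ge0// => hm hn.
have E : nrm2 (fun x => F n x - F m x) =
    nrm2 (fun x => (F n x - f x) + (f x - F m x)).
  by apply: eq_Rintegral => x _; rewrite addrA subrK.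
rewrite E (le_trans (nrm2_le2 (L2B (LF n) Lf) (L2B Lf (LF m))))//.
rewrite [nrm2 (fun x => f x - _)]nrm2BC.
by move: (nrm2 _) (nrm2 _) hm hn => p q; lra.
Qed.

(** Completeness is applied to each real component. The limit h is square integrable because it is
    the difference of F_N and F_N - h. *)
Lemma L2_complete F : (forall n, L2 (F n)) ->
  (forall e : R, 0 < e -> exists N, forall n m, (N <= n)%N -> (N <= m)%N ->
    nrm2 (fun x => F n x - F m x) <= e) ->
  exists2 h, L2 h & cvL2 F h.
Proof.
move=> LF CF.
have comp (p : spinor R -> R) : (forall v w, p (v - w) = p v - p w) ->
    (forall v, p v ^+ 2 <= sqn v) -> (forall n, measurable_fun setT (fun x => p (F n x))) ->
  exists2 v : R3 R -> R, measurable_fun setT v & forall e : R, 0 < e -> exists N, forall n, (N <= n)%N ->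
     (\int[mu]_x ((p (F n x) - v x) ^+ 2)%:E <= e%:E)%E.
  move=> pB psqn mp; apply: (@L2_complete_real _ _ _ mu (fun n x => p (F n x))) => // e e0.
  have [N HN] := CF e e0; exists N => n m Nn Nm.
  apply: (@le_trans _ _ (L2_normsq (fun x => F n x - F m x))).
    apply: ge0_le_integral => //.
    - by move=> x _; rewrite lee_fin sqr_ge0.
    - by apply/measurable_EFinP; apply: measurable_funX; exact: (measurable_funB (mp n) (mp m)).
    - by apply/measurable_EFinP; apply: measurable_sqn; apply: spinor_mfunB; exact: L2_spinor_mfun.
    - by move=> x _; rewrite lee_fin -pB psqn.
  by rewrite L2_normsqE ?lee_fin ?HN//; exact: L2B.
have /choice[hR HR] : forall j : 'I_4, exists v : R3 R -> R, measurable_fun setT v /\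
    forall e : R, 0 < e -> exists N, forall n, (N <= n)%N ->
     (\int[mu]_x ((complex.Re (F n x j 0) - v x) ^+ 2)%:E <= e%:E)%E.
  move=> j; have [|||v] := comp (fun v => complex.Re (v j 0)).
  - by move=> v w; rewrite !cptE.
  - by move=> v; exact: sqr_Re_le_sqn.
  - by move=> n; have [] := L2_spinor_mfun (LF n) j.
  - by exists v.
have /choice[hI HI] : forall j : 'I_4, exists v : R3 R -> R, measurable_fun setT v /\
    forall e : R, 0 < e -> exists N, forall n, (N <= n)%N ->
     (\int[mu]_x ((complex.Im (F n x j 0) - v x) ^+ 2)%:E <= e%:E)%E.
  move=> j; have [|||v] := comp (fun v => complex.Im (v j 0)).
  - by move=> v w; rewrite !cptE.
  - by move=> v; exact: sqr_Im_le_sqn.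
  - by move=> n; have [] := L2_spinor_mfun (LF n) j.
  - by exists v.
pose h : R3 R -> spinor R := fun x => \col_j Complex (hR j x) (hI j x).
have mh : spinor_mfun h.
  move=> j; split; [under eq_fun do rewrite mxE /=|under eq_fun do rewrite mxE /=].
    by have [] := HR j.
  by have [] := HI j.
have small (e : R) : 0 < e -> exists N, forall n, (N <= n)%N ->
    (L2_normsq (fun x => F n x - h x)%R <= e%:E)%E.
  (* There are eight real components. *)
  move=> e0; have e8 : 0 < e / 8 by rewrite divr_gt0.
  have /choice[NR HNR] : forall j, exists N, forall n, (N <= n)%N ->
     (\int[mu]_x ((complex.Re (F n x j 0) - hR j x) ^+ 2)%:E <= (e / 8)%:E)%E.
    by move=> j; have [_ /(_ _ e8)] := HR j.
  have /choice[NI HNI] : forall j, exists N, forall n, (N <= n)%N ->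
     (\int[mu]_x ((complex.Im (F n x j 0) - hI j x) ^+ 2)%:E <= (e / 8)%:E)%E.
    by move=> j; have [_ /(_ _ e8)] := HI j.
  exists (\sum_j (NR j + NI j))%N => n nN.
  have jN j : (NR j <= n)%N /\ (NI j <= n)%N.
    by move: nN; rewrite (bigD1 j)//= -!addnA => nN; split;
      apply: leq_trans nN; rewrite ?leq_addr// addnCA leq_addr.
  have mR j : measurable_fun setT (fun x => (complex.Re (F n x j 0) - hR j x) ^+ 2).
    have [? _] := L2_spinor_mfun (LF n) j; have [? _] := HR j.
    by apply: measurable_funX; exact: measurable_funB.
  have mI j : measurable_fun setT (fun x => (complex.Im (F n x j 0) - hI j x) ^+ 2).
    have [_ ?] := L2_spinor_mfun (LF n) j; have [? _] := HI j.
    by apply: measurable_funX; exact: measurable_funB.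
  have -> : L2_normsq (fun x => F n x - h x) = (\int[mu]_x \sum_(j < 4)
      (((complex.Re (F n x j 0) - hR j x) ^+ 2)%:E +
       ((complex.Im (F n x j 0) - hI j x) ^+ 2)%:E))%E.
    apply: eq_integral => x _; rewrite /sqn -sumEFin; apply: eq_bigr => j _.
    by rewrite !cptE !mxE -EFinD.
  rewrite ge0_integral_sum//; last 2 first.
  - by move=> j; apply: emeasurable_funD; apply/measurable_EFinP; [exact: mR|exact: mI].
  - by move=> j x _; rewrite -EFinD lee_fin addr_ge0// sqr_ge0.
  rewrite (_ : e%:E = (\sum_(j < 4) (e / 4)%:E)%E); last first.
    by rewrite sumEFin sumr_const card_ord -mulr_natr; congr EFin; field.
  apply: lee_sum => j _; rewrite ge0_integralD//; last 4 first.
  - by move=> x _; rewrite lee_fin sqr_ge0.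
  - by apply/measurable_EFinP; exact: mR.
  - by move=> x _; rewrite lee_fin sqr_ge0.
  - by apply/measurable_EFinP; exact: mI.
  have [j1 j2] := jN j.
  apply: (@le_trans _ _ ((e / 8)%:E + (e / 8)%:E)%E).
    by apply: leeD; [exact: HNR|exact: HNI].
  by rewrite -EFinD lee_fin; lra.
have Lh : L2 h.
  have [N /(_ N (leqnn N)) HN] := small 1 ltr01.
  have LFh : L2 (fun x => F N x - h x).
    split; last exact: le_lt_trans HN (ltry _).
    by apply: spinor_mfunB => //; exact: L2_spinor_mfun.
  have := L2B (LF N) LFh; rewrite (_ : (fun x => _) = h)//.
  by apply/funext => x; rewrite opprB addrCA subrr addr0.
exists h => //; apply/cvgr0Pnorm_le => e e0.
have [N HN] := small e e0; exists N => // n /= Nn.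
have := HN n Nn; rewrite L2_normsqE ?lee_fin; last exact: L2B.
by rewrite ger0_norm// nrm2_ge0.
Qed.

Lemma leb3_set0 : leb3 R [set 0] = 0%E.
Proof.
rewrite (_ : [set 0] = [set (0 : R)] `*` [set (0 : R)] `*` [set (0 : R)]).
  rewrite /leb3/= product_measure1E//=; last exact: measurableX.
  by rewrite lebesgue_measure_set1 mule0.
by apply/seteqP; split=> [x -> //|[[x y] z] [[/= -> ->] ->]].
Qed.

(** The cutoffs tend to 1 and the field bounds make sense only away from the origin, which is a null
    set. *)
Lemma ae_not0 (P : R3 R -> Prop) : (forall x, x != 0 -> P x) -> {ae leb3 R, forall x, P x}.
Proof.
move=> hP; exists [set 0]; split => //; last first.
- move=> x /= nP; apply/eqP/contraT => x0.
  by case: nP; exact: hP.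
- exact: leb3_set0.
- rewrite (_ : [set 0] = [set (0 : R)] `*` [set (0 : R)] `*` [set (0 : R)]).
    by apply: measurableX => //; exact: measurableX.
  by apply/seteqP; split=> [x -> //|[[x y] z] [[/= -> ->] ->]].
Qed.

Lemma dominated_nrm2 (a : nat -> R3 R -> R) C f :
  (forall n, measurable_fun setT (a n)) -> (forall n x, `|a n x| <= C) ->
  (forall x, x != 0 -> a n x @[n --> \oo] --> (0 : R)) -> L2 f ->
  nrm2 (fun x => rscal (a n x) (f x)) @[n --> \oo] --> (0 : R).
Proof.
move=> ma aC a0 Lf.
have iD : mu.-integrable setT (EFin \o (fun x => C ^+ 2 * sqn (f x) + 0 * sqn (f x))).
  by apply: integrableZ2D; exact: L2_sqn.
have := @dominated_convergence _ _ _ mu setT measurableT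
  (fun n x => (sqn (rscal (a n x) (f x)))%:E) (cst 0%E)
  (EFin \o (fun x => C ^+ 2 * sqn (f x) + 0 * sqn (f x))).
case.
- move=> n; apply/measurable_EFinP; apply: measurable_sqn.
  by apply: spinor_mfunZ => //; exact: L2_spinor_mfun.
- exact: measurable_cst.
- apply: ae_not0 => x /a0 ax _; apply: cvg_EFin; first exact: nearW.
  under eq_fun do rewrite /= sqnZ expr2.
  have <- : 0 * 0 * sqn (f x) = 0 by rewrite !mul0r.
  by apply: cvgM; [exact: cvgM|exact: cvg_cst].
- exact: iD.
- apply: aeW => x n _; rewrite /= lee_fin mul0r addr0 ger0_norm ?sqn_ge0//.
  exact: sqnZ_le.
- move=> _ _; rewrite integral0 => /fine_cvgP[_].
  by [].
Qed.

End SpinorLimits.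

(** * The Dirac matrices in components *)

Section DiracComponents.
Variable R : realType.
Implicit Types (v : spinor R) (D : 'I_3 -> spinor R).
Local Notation I := (Complex 0 1 : R[i]).

(** Explicit indices, so that sums expand into named components on which [ring] can work. *)
Definition j0 : 'I_4 := @Ordinal 4 0 isT.
Definition j1 : 'I_4 := @Ordinal 4 1 isT.
Definition j2 : 'I_4 := @Ordinal 4 2 isT.
Definition j3 : 'I_4 := @Ordinal 4 3 isT.
Definition k0 : 'I_3 := @Ordinal 3 0 isT.
Definition k1 : 'I_3 := @Ordinal 3 1 isT.
Definition k2 : 'I_3 := @Ordinal 3 2 isT.

Lemma sum4 (V : nmodType) (F : 'I_4 -> V) : \sum_j F j = F j0 + F j1 + F j2 + F j3.
Proof.
rewrite !big_ord_recl big_ord0 addr0 !addrA.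
by congr (_ + _ + _ + _); congr F; apply: val_inj.
Qed.

Lemma sum3 (V : nmodType) (F : 'I_3 -> V) : \sum_j F j = F k0 + F k1 + F k2.
Proof.
rewrite !big_ord_recl big_ord0 addr0 !addrA.
by congr (_ + _ + _); congr F; apply: val_inj.
Qed.

(** A table that reduces by computation, in contrast to the block matrices. *)
Definition alpha_entry (k : 'I_3) (i j : 'I_4) : R[i] :=
  match val k, val i, val j with
  | 0%N, 0%N, 3%N | 0%N, 1%N, 2%N | 0%N, 2%N, 1%N | 0%N, 3%N, 0%N => 1
  | 1%N, 0%N, 3%N | 1%N, 2%N, 1%N => - I
  | 1%N, 1%N, 2%N | 1%N, 3%N, 0%N => I
  | 2%N, 0%N, 2%N | 2%N, 2%N, 0%N => 1
  | 2%N, 1%N, 3%N | 2%N, 3%N, 1%N => -1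
  | _, _, _ => 0
  end.

Lemma mx2E (a b c d : R[i]) (i j : 'I_2) : mx2 a b c d i j =
  if (i == 0%N :> nat) then (if (j == 0%N :> nat) then a else b)
  else (if (j == 0%N :> nat) then c else d).
Proof.
(* The indices are restated in the sum type that [split_ordP] and the block lemmas expect. *)
suff E (i' j' : 'I_(1 + 1)) : (block_mx a%:M b%:M c%:M d%:M : 'M[R[i]]_(1 + 1)) i' j' =
  if (i' == 0%N :> nat) then (if (j' == 0%N :> nat) then a else b)
  else (if (j' == 0%N :> nat) then c else d) by exact: E.
case: (split_ordP i') => i1 ->; case: (split_ordP j') => j1 ->;
  rewrite ?block_mxEul ?block_mxEur ?block_mxEdl ?block_mxEdr !(ord1 i1, ord1 j1) !mxE;
  by rewrite eqxx mulr1n.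
Qed.

Lemma dirac_alphaE k i j : dirac_alpha R k i j = alpha_entry k i j.
Proof.
suff E (i' j' : 'I_(2 + 2)) : (block_mx 0 (pauli R k) (pauli R k) 0 : 'M[R[i]]_(2 + 2)) i' j' =
  alpha_entry k i' j' by exact: E.
case: (split_ordP i') => i1 ->; case: (split_ordP j') => j1 ->;
  rewrite ?block_mxEul ?block_mxEur ?block_mxEdl ?block_mxEdr ?[0 _ _]mxE
    /alpha_entry /pauli/=;
  case: k => -[|[|[|//]]] k3 /=; rewrite ?mx2E;
  case: i1 => -[|[|//]] ?; case: j1 => -[|[|//]] ? //=; rewrite mxE//.
Qed.

Definition beta_entry (i j : 'I_4) : R[i] :=
  if (i == j :> nat) then (if (i < 2)%N then 1 else -1) else 0.

Lemma dirac_betaE i j : dirac_beta R i j = beta_entry i j.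
Proof.
suff E (i' j' : 'I_(2 + 2)) : (block_mx 1%:M 0 0 (- 1%:M) : 'M[R[i]]_(2 + 2)) i' j' =
  beta_entry i' j' by exact: E.
case: (split_ordP i') => i1 ->; case: (split_ordP j') => j1 ->;
  rewrite ?block_mxEul ?block_mxEur ?block_mxEdl ?block_mxEdr !mxE /beta_entry/=;
  by case: i1 => -[|[|//]] ?; case: j1 => -[|[|//]] ?; rewrite -?val_eqE/= ?mulr1n ?mulr0n ?oppr0.
Qed.

(** The Dirac operator at one point, with the covariant derivatives and the value of the spinor as
    independent vectors: the matrix identities become polynomial identities in their components. *)
Definition dirac_vec (m : R) D v : spinor R :=
  I^-1 *: (\sum_k dirac_alpha R k *m D k) + Complex m 0 *: (dirac_beta R *m v).

Lemma dirac_vec_cpt m D v :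
  let d k j := complex.Re (D k j 0) in let e k j := complex.Im (D k j 0) in
  let H j := dirac_vec m D v j 0 in
  [/\ [/\ complex.Re (H j0) = e k2 j2 + e k0 j3 - d k1 j3 + m * complex.Re (v j0 0),
      complex.Im (H j0) = - (d k2 j2 + d k0 j3 + e k1 j3) + m * complex.Im (v j0 0),
      complex.Re (H j1) = e k0 j2 + d k1 j2 - e k2 j3 + m * complex.Re (v j1 0) &
      complex.Im (H j1) = - (d k0 j2 - e k1 j2 - d k2 j3) + m * complex.Im (v j1 0)],
      complex.Re (H j2) = e k2 j0 + e k0 j1 - d k1 j1 - m * complex.Re (v j2 0),
      complex.Im (H j2) = - (d k2 j0 + d k0 j1 + e k1 j1) - m * complex.Im (v j2 0),
      complex.Re (H j3) = e k0 j0 + d k1 j0 - e k2 j1 - m * complex.Re (v j3 0) &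
      complex.Im (H j3) = - (d k0 j0 - e k1 j0 - d k2 j1) - m * complex.Im (v j3 0)].
Proof.
have invI : I^-1 = - I.
  apply: (mulfI (x := I)); first by rewrite eq_complex/= eqxx oner_eq0 andbF.
  rewrite mulfV ?eq_complex/= ?eqxx ?oner_eq0 ?andbF//.
  by rewrite mulrN; apply/eqP; rewrite eq_complex/=; apply/andP; split; apply/eqP; ring.
move=> d e H.
have HE j : H j = - I * (\sum_k \sum_l alpha_entry k j l * D k l 0)
    + Complex m 0 * (\sum_l beta_entry j l * v l 0).
  rewrite /H /dirac_vec invI !mxE summxE; congr (_ * _ + _ * _).
    by apply: eq_bigr => k _; rewrite mxE; apply: eq_bigr => l _; rewrite dirac_alphaE.
  by apply: eq_bigr => l _; rewrite dirac_betaE.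
rewrite !HE /d /e !sum3 !sum4 /alpha_entry /beta_entry/=.
rewrite !mul0r ?add0r ?addr0 ?mul1r ?addr0 ?add0r {H HE d e}.
move: (D k0 j0 0) (D k0 j1 0) (D k0 j2 0) (D k0 j3 0) => [? ?] [? ?] [? ?] [? ?].
move: (D k1 j0 0) (D k1 j1 0) (D k1 j2 0) (D k1 j3 0) => [? ?] [? ?] [? ?] [? ?].
move: (D k2 j0 0) (D k2 j1 0) (D k2 j2 0) (D k2 j3 0) => [? ?] [? ?] [? ?] [? ?].
move: (v j0 0) (v j1 0) (v j2 0) (v j3 0) => [? ?] [? ?] [? ?] [? ?] /=.
by split; [split|..]; ring.
Qed.

End DiracComponents.

(** * Covariant derivatives *)

Section SquareIntegrable.
Variable R : realType.
Implicit Types (u v : R3 R -> R) (f : R3 R -> spinor R) (k : 'I_3).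
Local Notation mu := (leb3 R).
Local Notation intg u := (mu.-integrable setT (EFin \o u)).

Definition rL2 u := measurable_fun setT u /\ intg (fun x => u x ^+ 2).

Lemma le_intg u v : measurable_fun setT u -> (forall x, `|u x| <= v x) -> intg v -> intg u.
Proof.
move=> mmu uv iv; apply: (le_integrable _ _ _ iv) => //; first exact/measurable_EFinP.
by move=> x _ /=; rewrite lee_fin (le_trans (uv x))// ler_norm.
Qed.

Lemma intgD u v : intg u -> intg v -> intg (fun x => u x + v x).
Proof. by move=> iu iv; have := integrableZ2D 1 1 iu iv; under eq_fun do rewrite !mul1r. Qed.

Lemma intgZ c u : intg u -> intg (fun x => c * u x).
Proof.
by move=> iu; have := integrableZ2D c 0 iu iu; under eq_fun do rewrite mul0r addr0.
Qed.

Lemma le_rL2 u v : measurable_fun setT u -> (forall x, u x ^+ 2 <= v x) -> intg v -> rL2 u.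
Proof.
move=> mmu uv iv; split=> //; apply: (le_intg _ _ iv); first exact: measurable_funX.
by move=> x; rewrite ger0_norm ?sqr_ge0.
Qed.

Lemma rL2D u v : rL2 u -> rL2 v -> rL2 (fun x => u x + v x).
Proof.
move=> [mmu iu] [mv iv]; apply: (le_rL2 _ _ (integrableZ2D 2 2 iu iv)).
  exact: measurable_funD.
move=> x; move: (u x) (v x) => p q; have := sqr_ge0 (p - q); nra.
Qed.

Lemma rL2N u : rL2 u -> rL2 (fun x => - u x).
Proof.
move=> [mmu iu]; split; first exact: measurableT_comp.
by under eq_fun do rewrite sqrrN.
Qed.

Lemma rL2B u v : rL2 u -> rL2 v -> rL2 (fun x => u x - v x).
Proof. by move=> hu hv; apply: rL2D => //; exact: rL2N. Qed.

Lemma rL2M_intg u v : rL2 u -> rL2 v -> intg (fun x => u x * v x).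
Proof.
move=> [mmu iu] [mv iv]; apply: (le_intg _ _ (integrableZ2D 1 1 iu iv)).
  exact: measurable_funM.
move=> x; move: (u x) (v x) => p q; rewrite !mul1r ler_norml.
have := sqr_ge0 (p - q); have := sqr_ge0 (p + q).
have := sqr_ge0 p; have := sqr_ge0 q.
by move=> *; apply/andP; split; nra.
Qed.

Lemma Cc_rL2 u : Cc_infty u -> rL2 u.
Proof.
move=> cu; split; first exact: Cc_measurable.
by apply: (@Cc_integrable _ (fun x => u x * u x)); apply: Cc_smoothM => //; exact: Cc_smooth.
Qed.

Lemma L2_rL2 f : L2 f <-> forall j, rL2 (fun x => complex.Re (f x j 0)) /\
  rL2 (fun x => complex.Im (f x j 0)).
Proof.
split=> [/L2P[mf If] j|rf].
  have [mR mI] := mf j.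
  by split; apply: (le_rL2 _ _ If) => // x; [exact: sqr_Re_le_sqn|exact: sqr_Im_le_sqn].
apply/L2P; split; first by move=> j; have [[? _] [? _]] := rf j.
have -> : EFin \o (fun x => sqn (f x)) = (fun x => \sum_(j < 4)
    ((EFin \o (fun x => complex.Re (f x j 0) ^+ 2)%R) x +
     (EFin \o (fun x => complex.Im (f x j 0) ^+ 2)%R) x)%E).
  by apply/funext => x /=; rewrite /sqn -sumEFin; apply: eq_bigr => j _; rewrite EFinD.
apply: integrable_sum => // j _; have [[_ ?] [_ ?]] := rf j.
exact: integrableD.
Qed.

(** These functions form a vector space. An integrated identity is therefore proved by exhibiting
    the difference of its integrands as a linear combination of known null functions, a pointwise
    matter. *)
Definition null u := intg u /\ \int[mu]_x u x = 0.

Lemma null_eq u v : null u -> u =1 v -> null v.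
Proof. by move=> nu /funext <-. Qed.

Lemma nullD u v : null u -> null v -> null (fun x => u x + v x).
Proof.
move=> [iu u0] [iv v0]; split.
  exact: intgD.
by rewrite RintegralD// u0 v0 addr0.
Qed.

Lemma nullZ c u : null u -> null (fun x => c * u x).
Proof.
move=> [iu u0]; split.
  exact: intgZ.
by rewrite RintegralZl// u0 mulr0.
Qed.

Lemma nullN u : null u -> null (fun x => - u x).
Proof. by move=> /(nullZ (-1)); under eq_fun do rewrite mulN1r. Qed.

Lemma nullB u v : null u -> null v -> null (fun x => u x - v x).
Proof. by move=> nu nv; apply: nullD => //; exact: nullN. Qed.

Lemma null_partial k u : Cc_infty u -> null (partial k u).
Proof.
move=> cu; split; first exact/Cc_integrable/Cc_partial.
by rewrite /Rintegral integral_partial.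
Qed.

Lemma null_product k u v : Cc_infty u -> Cc_infty v ->
  null (fun x => partial k u x * v x + u x * partial k v x).
Proof.
move=> cu cv; apply: null_eq (null_partial k (Cc_smoothM (Cc_smooth cu) cv)) _ => x.
by rewrite partialM//; exact/smooth_diff/Cc_smooth.
Qed.

(* [d_i u d_j v - d_j u d_i v = d_i (u d_j v) - d_j (u d_i v)] *)
Lemma null_jacobian i j u v : Cc_infty u -> Cc_infty v ->
  null (fun x => partial i u x * partial j v x - partial j u x * partial i v x).
Proof.
move=> cu cv; apply: null_eq
  (nullB (null_product i cu (Cc_partial j cv)) (null_product j cu (Cc_partial i cv))) _.
move=> x; rewrite (partialC_mixed i j x (Cc_smooth cv)).
move: (partial j (partial i v) x) (partial i u x) (partial j u x) => p q r.
by ring.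
Qed.

End SquareIntegrable.

Section CovariantDerivative.
Variable R : realType.
Implicit Types (phi : R3 R -> R) (f g psi : R3 R -> spinor R) (k : 'I_3).
Implicit Types (A : R3 R -> R3 R).
Local Notation I := (Complex 0 1 : R[i]).

(** Locked, so that simplification leaves it alone until [Re_cdv] and [Im_cdv] are rewritten. *)
Definition cdv A k f : R3 R -> spinor R :=
  locked (fun x => partial_spinor k f x - (I * Complex (crd (A x) k) 0) *: f x).

Lemma cdvE A k f x :
  cdv A k f x = partial_spinor k f x - (I * Complex (crd (A x) k) 0) *: f x.
Proof. by rewrite /cdv -lock. Qed.

Lemma Re_cdv A k f x j : complex.Re (cdv A k f x j 0) =
  partial k (fun y => complex.Re (f y j 0)) x + crd (A x) k * complex.Im (f x j 0).
Proof. by rewrite cdvE !mxE /=; case: (f x j 0) => a b /=; ring. Qed.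

Lemma Im_cdv A k f x j : complex.Im (cdv A k f x j 0) =
  partial k (fun y => complex.Im (f y j 0)) x - crd (A x) k * complex.Re (f x j 0).
Proof. by rewrite cdvE !mxE /=; case: (f x j 0) => a b /=; ring. Qed.

Lemma dirac_vecE m A f x : Defs.dirac m A f x = dirac_vec m (fun k => cdv A k f x) (f x).
Proof. by rewrite /dirac_vec; under [in RHS]eq_bigr do rewrite cdvE. Qed.

(** Local square integrability of A, expressed through test functions because A occurs only in such
    products. *)
Definition locL2 A := forall phi k, Cc_infty phi -> rL2 (fun x => crd (A x) k * phi x).

Definition basis_spinor (j : 'I_4) (c : R[i]) phi : R3 R -> spinor R :=
  fun x => \col_l (if l == j then c * Complex (phi x) 0 else 0).

Lemma Re_basis j c phi x l : complex.Re (basis_spinor j c phi x l 0) =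
  (if l == j then complex.Re c else 0) * phi x.
Proof. by rewrite mxE; case: eqP; case: c => a b /= _; ring. Qed.

Lemma Im_basis j c phi x l : complex.Im (basis_spinor j c phi x l 0) =
  (if l == j then complex.Im c else 0) * phi x.
Proof. by rewrite mxE; case: eqP; case: c => a b /= _; ring. Qed.

Lemma Cc_basis j c phi : Cc_infty phi -> Cc_infty_spinor (basis_spinor j c phi).
Proof.
move=> cphi l; split; [under eq_fun do rewrite Re_basis|under eq_fun do rewrite Im_basis];
  by apply: Cc_smoothM => //; exact: smooth_cst.
Qed.

Lemma partialZ k (c : R) phi x : differentiable phi x ->
  partial k (fun y => c * phi y) x = c * partial k phi x.
Proof.
by move=> d; rewrite partialM ?partial_cst ?mul0r ?add0r//; exact: differentiable_cst.
Qed.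

(** For a spinor whose only nonzero component is the first one, phi, the last two components of its
    image under H are, up to sign and derivatives of phi, the three products A^k phi. *)
Lemma locL2_of_dirac m A : (forall f, Cc_infty_spinor f -> L2 (Defs.dirac m A f)) -> locL2 A.
Proof.
move=> LH phi k cphi.
have := LH _ (Cc_basis j0 1 cphi).
rewrite (_ : Defs.dirac m A _ = fun x => dirac_vec m
  (fun k => cdv A k (basis_spinor j0 1 phi) x) (basis_spinor j0 1 phi x)); last first.
  by apply/funext => x; rewrite dirac_vecE.
move=> /L2_rL2 rH.
have dphi x : differentiable phi x by exact/smooth_diff/Cc_smooth.
have dE i j x : complex.Re (cdv A i (basis_spinor j0 1 phi) x j 0) =
    (if j == j0 then 1 else 0) * partial i phi x.
  rewrite Re_cdv; under [in partial _ _]eq_fun do rewrite Re_basis.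
  rewrite Im_basis partialZ// if_same mul0r mulr0 addr0.
  by case: eqP.
have eE i j x : complex.Im (cdv A i (basis_spinor j0 1 phi) x j 0) =
    - ((if j == j0 then 1 else 0) * (crd (A x) i * phi x)).
  rewrite Im_cdv; under [in partial _ _]eq_fun do rewrite Im_basis.
  rewrite Re_basis partialZ// if_same mul0r add0r.
  by case: eqP => _ /=; ring.
have cpt x := dirac_vec_cpt m (fun k => cdv A k (basis_spinor j0 1 phi) x)
  (basis_spinor j0 1 phi x).
have rp i : rL2 (partial i phi) by exact/Cc_rL2/Cc_partial.
have [_ _] := rH j3; have [+ _] := rH j2; have [+ +] := rH j3.
move=> h3R h3I h2R.
case: k => -[|[|[|//]]] k3.
- have := rL2B (rp k1) h3R; congr rL2; apply/funext => x.
  have [_ _ _ -> _] := cpt x; rewrite !dE !eE Re_basis/=.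
  by rewrite (_ : Ordinal k3 = k0); [ring|exact: val_inj].
- have := rL2B (rL2N (rp k0)) h3I; congr rL2; apply/funext => x.
  have [_ _ _ _ ->] := cpt x; rewrite !dE !eE Im_basis/=.
  by rewrite (_ : Ordinal k3 = k1); [ring|exact: val_inj].
- have := rL2N h2R; congr rL2; apply/funext => x.
  have [_ -> _ _ _] := cpt x; rewrite !dE !eE Re_basis/=.
  by rewrite (_ : Ordinal k3 = k2); [ring|exact: val_inj].
Qed.

Lemma Cc_L2 f : Cc_infty_spinor f -> L2 f.
Proof. by move=> cf; apply/L2_rL2 => j; have [? ?] := cf j; split; exact: Cc_rL2. Qed.

Lemma L2_cdv A k f : locL2 A -> Cc_infty_spinor f -> L2 (cdv A k f).
Proof.
move=> lA cf; apply/L2_rL2 => j; have [cR cI] := cf j.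
split; [under eq_fun do rewrite Re_cdv|under eq_fun do rewrite Im_cdv].
  by apply: rL2D; [exact/Cc_rL2/Cc_partial|exact: lA].
by apply: rL2B; [exact/Cc_rL2/Cc_partial|exact: lA].
Qed.

(* Integration by parts in the real inner product, for which [cdv A k] is
   antisymmetric; equivalent to [weak_cov_deriv]. *)
Definition weak_cdv A k f g := L2 g /\
  forall psi, Cc_infty_spinor psi -> rdot g psi = - rdot f (cdv A k psi).

(** The potential terms cancel pointwise, multiplication by i A^k being antisymmetric for the real
    product; exact derivatives remain. *)
Lemma weak_cdv_cdv A k f : locL2 A -> Cc_infty_spinor f -> weak_cdv A k f (cdv A k f).
Proof.
move=> lA cf; have Lf := Cc_L2 cf; have Ldf := L2_cdv k lA cf.
split=> // psi cpsi; apply/eqP; rewrite -subr_eq0 opprK.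
have Lp := Cc_L2 cpsi; have Ldp := L2_cdv k lA cpsi.
rewrite -RintegralD//; [|exact: L2_sdot|exact: L2_sdot].
apply/eqP; pose P j x :=
  (partial k (fun y => complex.Re (f y j 0)) x * complex.Re (psi x j 0) +
   complex.Re (f x j 0) * partial k (fun y => complex.Re (psi y j 0)) x) +
  (partial k (fun y => complex.Im (f y j 0)) x * complex.Im (psi x j 0) +
   complex.Im (f x j 0) * partial k (fun y => complex.Im (psi y j 0)) x).
have nP j : null (P j).
  have [? ?] := cf j; have [? ?] := cpsi j.
  by apply: nullD; exact: null_product.
suff [] : null (fun x => sdot (cdv A k f x) (psi x) + sdot (f x) (cdv A k psi x)) by [].
apply: null_eq (nullD (nullD (nullD (nP j0) (nP j1)) (nP j2)) (nP j3)) _ => x.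
rewrite -(sum4 (fun j => P j x)) -big_split; apply: eq_bigr => j _ /=.
by rewrite !Re_cdv !Im_cdv /P; ring.
Qed.

End CovariantDerivative.

Section WeakDerivative.
Variable R : realType.
Implicit Types (u phi : R3 R -> R) (f g : R3 R -> spinor R) (k : 'I_3).
Implicit Types (A : R3 R -> R3 R).
Local Notation mu := (leb3 R).
Local Notation I := (Complex 0 1 : R[i]).
Local Notation intg u := (mu.-integrable setT (EFin \o u)).

Lemma cint_scale f j u :
  cint (fun x => f x j 0 * Complex (u x) 0) =
  Complex (\int[mu]_x (complex.Re (f x j 0) * u x)) (\int[mu]_x (complex.Im (f x j 0) * u x)).
Proof.
by rewrite /cint; congr Complex; apply: eq_Rintegral => x _;
  case: (f x j 0) => a b /=; ring.
Qed.

Lemma weak_cov_derivE A k f g phi j :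
  (cint (fun x => g x j 0 * Complex (phi x) 0) =
    - cint (fun x => f x j 0 * Complex (partial k phi x) 0)
    - I * cint (fun x => f x j 0 * Complex (crd (A x) k * phi x) 0)) <->
  (\int[mu]_x (complex.Re (g x j 0) * phi x) =
    (- (\int[mu]_x (complex.Re (f x j 0) * partial k phi x))
    + (\int[mu]_x (complex.Im (f x j 0) * (crd (A x) k * phi x))))%R) /\
  (\int[mu]_x (complex.Im (g x j 0) * phi x) =
    (- (\int[mu]_x (complex.Im (f x j 0) * partial k phi x))
    - (\int[mu]_x (complex.Re (f x j 0) * (crd (A x) k * phi x))))%R).
Proof.
rewrite !cint_scale.
have E (p q r s : R) : - Complex p q - I * Complex r s = Complex (- p + s) (- q - r).
  by apply/eqP; rewrite eq_complex/=; apply/andP; split; apply/eqP; ring.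
rewrite E.
by split=> [[-> ->]|[-> ->]].
Qed.

Lemma rdot_cpt f g : L2 f -> L2 g -> rdot f g =
  \sum_j (\int[mu]_x (complex.Re (f x j 0) * complex.Re (g x j 0)) +
          \int[mu]_x (complex.Im (f x j 0) * complex.Im (g x j 0))).
Proof.
move=> /L2_rL2 rf /L2_rL2 rg.
have iR j : intg (fun x => complex.Re (f x j 0) * complex.Re (g x j 0)).
  by have [? _] := rf j; have [? _] := rg j; exact: rL2M_intg.
have iI j : intg (fun x => complex.Im (f x j 0) * complex.Im (g x j 0)).
  by have [_ ?] := rf j; have [_ ?] := rg j; exact: rL2M_intg.
have iD j : intg (fun x => complex.Re (f x j 0) * complex.Re (g x j 0) +
    complex.Im (f x j 0) * complex.Im (g x j 0)).
  exact: intgD.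
rewrite sum4 /rdot; under eq_Rintegral do rewrite /sdot sum4.
have i01 := intgD (iD j0) (iD j1); have i012 := intgD i01 (iD j2).
rewrite (RintegralD measurableT i012 (iD j3)) (RintegralD measurableT i01 (iD j2)).
rewrite (RintegralD measurableT (iD j0) (iD j1)).
by do 4 (rewrite (RintegralD measurableT (iR _) (iI _))).
Qed.

(** One way, the real and imaginary parts of the components of psi serve as scalar test functions.
    The other way, phi is placed in the component j with coefficient 1 or i, which isolates the real
    or the imaginary part of the equation. *)
Lemma weak_cdvP A k f g : locL2 A -> L2 f -> weak_cov_deriv A k f g <-> weak_cdv A k f g.
Proof.
move=> lA Lf; have /L2_rL2 rf := Lf.
split=> -[Lg H]; split=> //.
- move=> psi cpsi; have Lp := Cc_L2 cpsi; have Ldp := L2_cdv k lA cpsi.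
  rewrite !rdot_cpt// -sumrN; apply: eq_bigr => j _.
  have [cR cI] := cpsi j; have [rR rI] := rf j.
  have [_ hR] := (weak_cov_derivE A k f g _ j).1 (H _ j cI).
  have [hI _] := (weak_cov_derivE A k f g _ j).1 (H _ j cR).
  rewrite hI hR.
  under [X in _ = - (X + _)]eq_Rintegral do rewrite Re_cdv mulrDr.
  under [X in _ = - (_ + X)]eq_Rintegral do rewrite Im_cdv mulrBr.
  rewrite RintegralD//; last 2 first.
  - by apply: rL2M_intg => //; exact/Cc_rL2/Cc_partial.
  - by apply: rL2M_intg => //; exact: lA.
  rewrite RintegralB//; last 2 first.
  - by apply: rL2M_intg => //; exact/Cc_rL2/Cc_partial.
  - by apply: rL2M_intg => //; exact: lA.
  have E (p q r s : R) : - p + q + (- r - s) = - (p + s + (r - q)) by ring.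
  exact: E.
- move=> phi j cphi; apply/weak_cov_derivE; have [rR rI] := rf j.
  have key c : \sum_(l < 4)
      (\int[mu]_x (complex.Re (g x l 0) * complex.Re (basis_spinor j c phi x l 0)) +
       \int[mu]_x (complex.Im (g x l 0) * complex.Im (basis_spinor j c phi x l 0))) =
    - \sum_(l < 4)
      (\int[mu]_x (complex.Re (f x l 0) * complex.Re (cdv A k (basis_spinor j c phi) x l 0)) +
       \int[mu]_x (complex.Im (f x l 0) * complex.Im (cdv A k (basis_spinor j c phi) x l 0))).
    have cb := Cc_basis j c cphi.
    have Lb := Cc_L2 cb; have Ldb := L2_cdv k lA cb.
    exact: etrans (esym (rdot_cpt Lg Lb)) (etrans (H _ cb) (congr1 -%R (rdot_cpt Lf Ldb))).
  have dphi x : differentiable phi x by exact/smooth_diff/Cc_smooth.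
  have int0 (w : R3 R -> R) : (forall x, w x = 0) -> \int[mu]_x w x = 0.
    by move=> w0; under eq_Rintegral do rewrite w0; rewrite Rintegral_cst// mul0r.
  have cR x l c : complex.Re (cdv A k (basis_spinor j c phi) x l 0) =
      (if l == j then complex.Re c * partial k phi x + complex.Im c * (crd (A x) k * phi x) else 0).
    rewrite Re_cdv; under [in partial _ _]eq_fun do rewrite Re_basis.
    by rewrite Im_basis partialZ//; case: eqP => _; ring.
  have cI x l c : complex.Im (cdv A k (basis_spinor j c phi) x l 0) =
      (if l == j then complex.Im c * partial k phi x - complex.Re c * (crd (A x) k * phi x) else 0).
    rewrite Im_cdv; under [in partial _ _]eq_fun do rewrite Im_basis.
    by rewrite Re_basis partialZ//; case: eqP => _; ring.
  have {}key c : \int[mu]_x (complex.Re (g x j 0) * (complex.Re c * phi x)) +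
      \int[mu]_x (complex.Im (g x j 0) * (complex.Im c * phi x)) =
    - (\int[mu]_x (complex.Re (f x j 0) *
         (complex.Re c * partial k phi x + complex.Im c * (crd (A x) k * phi x))) +
      \int[mu]_x (complex.Im (f x j 0) *
         (complex.Im c * partial k phi x - complex.Re c * (crd (A x) k * phi x)))).
    have := key c; rewrite [in LHS](bigD1 j)//= [in RHS](bigD1 j)//=.
    rewrite [X in _ + X = _]big1 => [|l lj]; last first.
      by rewrite !int0 ?addr0// => x; rewrite ?Re_basis ?Im_basis (negbTE lj) mul0r mulr0.
    rewrite [X in - (_ + X)]big1 => [|l lj]; last first.
      by rewrite !int0 ?addr0// => x; rewrite ?cR ?cI (negbTE lj) mulr0.
    rewrite !addr0.
    under eq_Rintegral do rewrite Re_basis eqxx.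
    under [X in _ + X]eq_Rintegral do rewrite Im_basis eqxx.
    under [X in - (X + _)]eq_Rintegral do rewrite cR eqxx.
    by under [X in - (_ + X)]eq_Rintegral do rewrite cI eqxx.
  split.
  + have /= := key 1.
    under eq_Rintegral do rewrite mul1r.
    rewrite (int0 (fun x => complex.Im (g x j 0) * (0 * phi x))); last by move=> x; ring.
    rewrite addr0 => ->.
    under eq_Rintegral do rewrite mul1r mul0r addr0.
    under [X in - (_ + X)]eq_Rintegral do rewrite mul1r mul0r add0r mulrN -mulN1r.
    rewrite RintegralZl//; first by rewrite mulN1r opprD opprK.
    by apply: rL2M_intg => //; exact: lA.
  + have /= := key I.
    under [X in _ + X]eq_Rintegral do rewrite mul1r.
    rewrite (int0 (fun x => complex.Re (g x j 0) * (0 * phi x))); last by move=> x; ring.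
    rewrite add0r => ->.
    under eq_Rintegral do rewrite mul1r mul0r add0r.
    under [X in - (_ + X)]eq_Rintegral do rewrite mul1r mul0r subr0.
    by rewrite addrC opprD.
Qed.

End WeakDerivative.

(** * The magnetic Hardy inequality *)

Section Cutoffs.
Variables (R : realType) (eta : R).
Hypothesis eta0 : 0 < eta.
Implicit Types (x : R3 R) (k : 'I_3).

Definition regsq x := edot x x + eta.
Definition cutoff x := edot x x / regsq x.
Definition radial k x := crd x k / regsq x.
(** The field x / (|x|^2 + eta) alone would be smooth too. The additional factor [cutoff] bounds the
    products of this field with the gradients of an approximating sequence by the cut-off
    gradients. *)
Definition hardy_field k x := radial k x * cutoff x.

Lemma regsq_gt0 x : 0 < regsq x.
Proof. by rewrite ltr_wpDl// edot_ge0. Qed.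

Lemma regsq_neq0 x : regsq x != 0.
Proof. by rewrite gt_eqF// regsq_gt0. Qed.

Lemma smooth_regsq : smooth regsq.
Proof. by apply: smoothD; [exact: smooth_edot|exact: smooth_cst]. Qed.

Lemma smooth_cutoff : smooth cutoff.
Proof.
apply: smoothM; first exact: smooth_edot.
by apply: smoothV; [exact: smooth_regsq|exact: regsq_neq0].
Qed.

Lemma smooth_radial k : smooth (radial k).
Proof.
apply: smoothM; first exact: smooth_crd.
by apply: smoothV; [exact: smooth_regsq|exact: regsq_neq0].
Qed.

Lemma smooth_hardy_field k : smooth (hardy_field k).
Proof. by apply: smoothM; [exact: smooth_radial|exact: smooth_cutoff]. Qed.

Lemma edotE x : edot x x = crd x k0 ^+ 2 + crd x k1 ^+ 2 + crd x k2 ^+ 2.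
Proof. by rewrite /edot sum3 !expr2. Qed.

Lemma sqr_crd_le x k : crd x k ^+ 2 <= edot x x.
Proof. by rewrite /edot (bigD1 k)//= expr2 lerDl sumr_ge0// => l _; rewrite -expr2 sqr_ge0. Qed.

Lemma partial_edot k x : partial k (fun y : R3 R => edot y y) x = 2 * crd x k.
Proof.
have d l : differentiable (fun y : R3 R => crd y l) x by exact: crd_differentiable.
rewrite (_ : (fun y => edot y y) = (fun y => crd y k0 * crd y k0 + crd y k1 * crd y k1
  + crd y k2 * crd y k2)); last by apply/funext => y; rewrite edotE !expr2.
have dM l : differentiable (fun y : R3 R => crd y l * crd y l) x by exact: differentiableM.
rewrite partialD//; last exact: differentiableD.
rewrite partialD// !partialM// !partial_crd.
have kE : (k == k0)%:R * crd x k0 + (k == k1)%:R * crd x k1 + (k == k2)%:R * crd x k2 = crd x k.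
  by case: k => -[|[|[|//]]] k3; rewrite /crd/= ?mul0r ?mul1r ?addr0 ?add0r.
rewrite -kE; move: (k == k0)%:R (k == k1)%:R (k == k2)%:R (crd x k0) (crd x k1) (crd x k2).
by move=> p q r a b c; ring.
Qed.

Lemma partial_regsq k x : partial k regsq x = 2 * crd x k.
Proof.
rewrite partialD ?partial_edot ?partial_cst ?addr0//.
exact/smooth_diff/smooth_edot.
Qed.

Lemma partial_cutoff k x : partial k cutoff x = 2 * crd x k * eta / regsq x ^+ 2.
Proof.
have q0 := regsq_neq0 x; have dq := smooth_diff x smooth_regsq.
rewrite partialM; [|exact/smooth_diff/smooth_edot|exact: differentiableV].
rewrite partialV// partial_edot partial_regsq.
have -> : edot x x = regsq x - eta by rewrite addrK.
by move: (regsq x) q0 => q q0; field.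
Qed.

Lemma partial_radial k x : partial k (radial k) x = (regsq x)^-1 - 2 * crd x k ^+ 2 / regsq x ^+ 2.
Proof.
have q0 := regsq_neq0 x; have dq := smooth_diff x smooth_regsq.
rewrite partialM; [|exact: crd_differentiable|exact: differentiableV].
rewrite partialV// partial_crd partial_regsq eqxx.
by rewrite mulr1n; move: (regsq x) (crd x k) q0 => q c q0; field.
Qed.

Lemma partial_hardy_field k x : partial k (hardy_field k) x =
  ((regsq x)^-1 - 2 * crd x k ^+ 2 / regsq x ^+ 2) * (edot x x / regsq x) +
  2 * crd x k ^+ 2 * eta / regsq x ^+ 3.
Proof.
have q0 := regsq_neq0 x.
rewrite partialM; [|exact/smooth_diff/smooth_radial|exact/smooth_diff/smooth_cutoff].
rewrite partial_radial partial_cutoff; congr (_ + _).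
by rewrite /radial; move: (regsq x) (crd x k) q0 => q c q0; field.
Qed.

Lemma frac_itv x t : 0 <= t -> t <= regsq x -> 0 <= t / regsq x <= 1.
Proof.
have q0 := regsq_gt0 x => t0 tq.
by rewrite divr_ge0//= ?ler_pdivrMr ?mul1r// ltW.
Qed.

Lemma cutoff_itv x : 0 <= cutoff x <= 1.
Proof.
by apply: frac_itv; rewrite ?edot_ge0// lerDl ltW.
Qed.

Lemma cutoff_le1 x : `|cutoff x| <= 1.
Proof. by have /andP[? ?] := cutoff_itv x; rewrite ger0_norm. Qed.

Lemma regsqV_le x : (regsq x)^-1 <= eta^-1.
Proof. by rewrite lef_pV2 ?posrE ?regsq_gt0// lerDr edot_ge0. Qed.

(** This bound and the following ones serve for fixed eta only and may blow up as eta tends to 0. *)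
Lemma radial_le k x : `|radial k x| <= 1 + eta^-1.
Proof.
rewrite normrM normfV (ger0_norm (ltW (regsq_gt0 x))) ler_pdivrMr ?regsq_gt0//.
have c1 : `|crd x k| <= 1 + edot x x.
  have := sqr_crd_le x k; rewrite -real_normK ?num_real//.
  have := normr_ge0 (crd x k); move: `|crd x k| (edot x x) => c d; nra.
apply: le_trans c1 _.
have -> : (1 + eta^-1) * regsq x = edot x x + eta + eta^-1 * edot x x + 1.
  by rewrite /regsq; move: (edot x x) => t; field; rewrite gt_eqF.
have : 0 <= eta^-1 * edot x x by rewrite mulr_ge0 ?edot_ge0// invr_ge0 ltW.
by have := eta0; lra.
Qed.

Lemma partial_cutoff_le k x : `|partial k cutoff x| <= 2 * (1 + eta^-1).
Proof.
have q0 := regsq_neq0 x.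
have -> : partial k cutoff x = 2 * radial k x * (eta / regsq x).
  by rewrite partial_cutoff /radial; field.
have e1 : `|eta / regsq x| <= 1.
  have /andP[? ?] : 0 <= eta / regsq x <= 1.
    by apply: frac_itv; [exact: ltW|rewrite lerDr edot_ge0].
  by rewrite ger0_norm.
rewrite normrM -[leRHS]mulr1 ler_pM// normrM ler_pM//.
  by rewrite ger0_norm.
exact: radial_le.
Qed.

Lemma hardy_field_le k x : `|hardy_field k x| <= 1 + eta^-1.
Proof.
rewrite normrM -[leRHS]mulr1 ler_pM//; [exact: radial_le|exact: cutoff_le1].
Qed.

Lemma partial_hardy_field_le k x : `|partial k (hardy_field k) x| <= 5 * eta^-1.
Proof.
have q0 := regsq_gt0 x; have c2 := sqr_crd_le x k; have s0 := edot_ge0 x.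
have e0 : 0 < eta^-1 by rewrite invr_gt0.
have -> : partial k (hardy_field k) x = (regsq x)^-1 *
   ((1 - 2 * (crd x k ^+ 2 / regsq x)) * (edot x x / regsq x) +
    2 * ((crd x k ^+ 2 / regsq x) * (eta / regsq x))).
  by rewrite partial_hardy_field; field; rewrite gt_eqF.
have sq : edot x x <= regsq x by rewrite lerDl ltW.
have /andP[a0 a1] := @frac_itv x _ (sqr_ge0 (crd x k)) (le_trans c2 sq).
have /andP[b0 b1] := @frac_itv x _ s0 sq.
have eq : eta <= regsq x by rewrite lerDr.
have /andP[d0 d1] := @frac_itv x _ (ltW eta0) eq.
rewrite normrM [5 * _]mulrC ler_pM//.
  by rewrite ger0_norm ?regsqV_le// invr_ge0 ltW.
move: (crd x k ^+ 2 / _) (edot x x / _) (eta / _) a0 a1 b0 b1 d0 d1 => a b c ? ? ? ? ? ?.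
by rewrite ler_norml; apply/andP; split; nra.
Qed.

(** The square of the length of the field [hardy_field]; it increases to 1 / |x|^2 as eta decreases
    to 0. *)
Definition hardy_weight x := edot x x ^+ 3 / regsq x ^+ 4.

(* With [s = |x|^2] and [q = s + eta], the left-hand side is
   [(5 / 2) s / q^2 - 2 s^2 / q^3 - s^3 / (4 q^4)]. *)
Lemma hardy_field_div x : hardy_weight x / 4 <=
  \sum_k (2^-1 * partial k (hardy_field k) x - 4^-1 * hardy_field k x ^+ 2).
Proof.
have q0 := regsq_gt0 x; have s0 := edot_ge0 x.
have -> : \sum_k (2^-1 * partial k (hardy_field k) x - 4^-1 * hardy_field k x ^+ 2) =
  (5 / 2 * edot x x * regsq x ^+ 2 - 2 * edot x x ^+ 2 * regsq x - edot x x ^+ 3 / 4) /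
   regsq x ^+ 4.
  rewrite sum3 !partial_hardy_field /hardy_field /radial /cutoff.
  rewrite !exprMn.
  have -> : crd x k2 ^+ 2 = edot x x - crd x k0 ^+ 2 - crd x k1 ^+ 2.
    by rewrite edotE; move: (crd x k0) (crd x k1) (crd x k2) => p q r; ring.
  have -> : eta = regsq x - edot x x by rewrite /regsq addrC addKr.
  move: (gt_eqF q0) => /negbT; move: (regsq x) (edot x x) (crd x k0 ^+ 2) (crd x k1 ^+ 2).
  by move=> q t a b qn0; field.
rewrite /hardy_weight mulrAC ler_pM2r ?invr_gt0 ?exprn_gt0//.
have : edot x x <= regsq x by rewrite lerDl ltW.
move: (regsq x) (edot x x) q0 s0 => q t q0 t0 tq.
(* The excess has the factor q - t = eta, so it is nonnegative and the sharp constant 1/4 is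
   kept. *)
have -> : 5 / 2 * t * q ^+ 2 - 2 * t ^+ 2 * q - t ^+ 3 / 4 =
  t ^+ 3 / 4 + t * ((q - t) * (5 / 2 * q + t / 2)) by field.
rewrite lerDl mulr_ge0// mulr_ge0 ?subr_ge0//; lra.
Qed.

End Cutoffs.

Section Hardy.
Variable R : realType.
Implicit Types (f g : R3 R -> spinor R) (F G : nat -> R3 R -> spinor R) (k : 'I_3).
Implicit Types (A : R3 R -> R3 R) (W : R3 R -> R) (eta : R).
Local Notation mu := (leb3 R).

Lemma smooth_measurable W : smooth W -> measurable_fun setT W.
Proof. by move/smooth_continuous; exact: continuous_measurable_R3. Qed.

Lemma Cc_spinor_scal W f : smooth W -> Cc_infty_spinor f ->
  Cc_infty_spinor (fun x => rscal (W x) (f x)).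
Proof.
move=> sW cf j; have [? ?] := cf j.
by split; [under eq_fun do rewrite ReZv|under eq_fun do rewrite ImZv]; exact: Cc_smoothM.
Qed.

Lemma Cc_spinorD f g : Cc_infty_spinor f -> Cc_infty_spinor g ->
  Cc_infty_spinor (fun x => f x + g x).
Proof.
move=> cf cg j; have [? ?] := cf j; have [? ?] := cg j.
by split; [under eq_fun do rewrite ReDv|under eq_fun do rewrite ImDv]; exact: CcD.
Qed.

Lemma Cc_spinorB f g : Cc_infty_spinor f -> Cc_infty_spinor g ->
  Cc_infty_spinor (fun x => f x - g x).
Proof.
move=> cf cg; apply: (Cc_spinorD cf).
have := Cc_spinor_scal (smooth_cst (-1)) cg.
by under eq_fun do rewrite rscalN1.
Qed.

Lemma spinor_diff f j x : Cc_infty_spinor f ->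
  differentiable (fun y => complex.Re (f y j 0)) x /\
  differentiable (fun y => complex.Im (f y j 0)) x.
Proof. by move=> cf; have [cR cI] := cf j; split; exact/smooth_diff/Cc_smooth. Qed.

Lemma cdv_scal A k W f x : smooth W -> Cc_infty_spinor f ->
  cdv A k (fun y => rscal (W y) (f y)) x =
  rscal (partial k W x) (f x) + rscal (W x) (cdv A k f x).
Proof.
move=> sW cf; have dW := smooth_diff x sW.
apply: spinorP => j; have [dR dI] := spinor_diff j x cf; rewrite !cptE.
  rewrite !Re_cdv !cptE; under [in partial _ _]eq_fun do rewrite ReZv.
  by rewrite partialM//; ring.
rewrite !Im_cdv !cptE; under [in partial _ _]eq_fun do rewrite ImZv.
by rewrite partialM//; ring.
Qed.

Lemma cdvB A k f g x : Cc_infty_spinor f -> Cc_infty_spinor g ->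
  cdv A k (fun y => f y - g y) x = cdv A k f x - cdv A k g x.
Proof.
move=> cf cg; apply: spinorP => j.
  have [dR dI] := spinor_diff j x cf; have [dR' dI'] := spinor_diff j x cg.
  rewrite !cptE !Re_cdv !cptE; under [in partial _ _]eq_fun do rewrite ReDv ReNv.
  by rewrite partialB//; ring.
have [dR dI] := spinor_diff j x cf; have [dR' dI'] := spinor_diff j x cg.
rewrite !cptE !Im_cdv !cptE; under [in partial _ _]eq_fun do rewrite ImDv ImNv.
by rewrite partialB//; ring.
Qed.

(** Integration of the derivative of W |f|^2. The potential drops out, since the product of f with i
    A^k f has real part 0. *)
Lemma rdot_radial_derivative A k W f C C' : locL2 A -> smooth W -> Cc_infty_spinor f ->
  (forall x, `|W x| <= C) -> (forall x, `|partial k W x| <= C') ->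
  rdot f (fun x => rscal (W x) (cdv A k f x)) =
  - (2^-1 * rdot f (fun x => rscal (partial k W x) (f x))).
Proof.
move=> lA sW cf WC WC'; have Lf := Cc_L2 cf.
have L1 := L2Z (smooth_measurable sW) WC (L2_cdv k lA cf).
have L2' := L2Z (smooth_measurable (smooth_partial k sW)) WC' Lf.
pose P j x :=
  (partial k (fun y => W y * complex.Re (f y j 0)) x * complex.Re (f x j 0) +
   (W x * complex.Re (f x j 0)) * partial k (fun y => complex.Re (f y j 0)) x) +
  (partial k (fun y => W y * complex.Im (f y j 0)) x * complex.Im (f x j 0) +
   (W x * complex.Im (f x j 0)) * partial k (fun y => complex.Im (f y j 0)) x).
have nP j : null (P j).
  have [? ?] := cf j; apply: nullD; apply: (null_product k (Cc_smoothM sW _)) => //.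
have [_] : null (fun x => 2 * sdot (f x) (rscal (W x) (cdv A k f x)) +
    sdot (f x) (rscal (partial k W x) (f x))).
  apply: null_eq (nullD (nullD (nullD (nP j0) (nP j1)) (nP j2)) (nP j3)) _ => x.
  rewrite -(sum4 (fun j => P j x)) mulr_sumr -big_split; apply: eq_bigr => j _ /=.
  have [dR dI] := spinor_diff j x cf; have dW := smooth_diff x sW.
  by rewrite /P !cptE Re_cdv Im_cdv !partialM//; ring.
rewrite RintegralD//; [|exact: (integrableZl measurableT 2 (L2_sdot Lf L1))|exact: L2_sdot].
rewrite RintegralZl//; last exact: L2_sdot.
rewrite -/(rdot f _) -/(rdot f _); move: (rdot f _) (rdot f _) => p q; lra.
Qed.

Lemma cvL2_rdot2 F G f g : (forall n, L2 (F n)) -> (forall n, L2 (G n)) -> L2 f -> L2 g ->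
  cvL2 F f -> cvL2 G g -> rdot (F n) (G n) @[n --> \oo] --> rdot f g.
Proof.
move=> LF LG Lf Lg Ff Gg.
have E u v : L2 u -> L2 v ->
    rdot u v = 2^-1 * (nrm2 (fun x => u x + v x) - nrm2 u - nrm2 v).
  by move=> Lu Lv; rewrite nrm2D//; move: (nrm2 u) (nrm2 v) (rdot u v) => p q r; field.
rewrite E//; under eq_fun do rewrite E//.
apply: cvgM; first exact: cvg_cst.
apply: cvgB; last exact: cvL2_nrm2.
apply: cvgB; last exact: cvL2_nrm2.
apply: (@cvL2_nrm2 _ (fun n x => F n x + G n x)).
- by move=> n; exact: L2D.
- exact: L2D.
- exact: cvL2D.
Qed.

Lemma smooth_hardy_weight eta : 0 < eta -> smooth (hardy_weight (R := R) eta).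
Proof.
move=> eta0; rewrite /hardy_weight.
under eq_fun do rewrite exprS expr2 exprS exprS expr2.
have se := @smooth_edot R; have sr := smooth_regsq eta.
have E x : regsq eta x != 0 by exact: regsq_neq0.
apply: smoothM; first by apply: smoothM => //; exact: smoothM.
apply: smoothV => [|x]; last by rewrite !mulf_neq0.
by apply: smoothM => //; apply: smoothM => //; exact: smoothM.
Qed.

Lemma hardy_weight_cvg (x : R3 R) :
  hardy_weight n.+1%:R^-1 x @[n --> \oo] --> (edot x x)^-1.
Proof.
rewrite /hardy_weight /regsq.
(* At the origin both sides are 0, the inverse of 0 being 0, so the convergence holds everywhere. *)
have [->|s0] := eqVneq (edot x x) 0.
  under eq_fun do rewrite expr0n/= mul0r.
  by rewrite invr0; exact: cvg_cst.
have -> : (edot x x)^-1 = edot x x ^+ 3 / (edot x x + 0) ^+ 4.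
  by rewrite addr0; move: (edot x x) s0 => t t0; field.
apply: cvgM; first exact: cvg_cst.
apply: cvgV; first by rewrite addr0 expf_neq0.
have h : edot x x + n.+1%:R^-1 @[n --> \oo] --> edot x x + 0.
  by apply: cvgD; [exact: cvg_cst|exact: cvg_harmonic].
exact: (@cvg_comp _ _ _ _ (fun t : R => t ^+ 4) _ _ _ h (@exprn_continuous R 4 _)).
Qed.

(** A pointwise limit of smooth weights, the inverse square not being continuous at the origin. *)
Lemma measurable_edotV : measurable_fun setT (fun x : R3 R => (edot x x)^-1).
Proof.
apply: (measurable_fun_cvg (h := fun n => hardy_weight n.+1%:R^-1)).
  by move=> n; apply: smooth_measurable; apply: smooth_hardy_weight; rewrite invr_gt0.
by move=> x _; exact: hardy_weight_cvg.
Qed.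

Lemma measurable_enormV : measurable_fun setT (fun x : R3 R => (enorm x)^-1).
Proof.
under eq_fun do rewrite /enorm -sqrtrV ?edot_ge0//.
apply: measurableT_comp; last exact: measurable_edotV.
by apply: continuous_measurable_fun; exact: sqrt_continuous.
Qed.

Lemma hardy_fatou f (B : \bar R) : spinor_mfun f ->
  (forall eta, 0 < eta -> (\int[mu]_x (hardy_weight eta x * sqn (f x))%:E <= B)%E) ->
  (\int[mu]_x (sqn (f x) / enorm x ^+ 2)%:E <= B)%E.
Proof.
move=> mf hB.
apply: (@fatou_le _ _ _ mu (fun n x => hardy_weight n.+1%:R^-1 x * sqn (f x))).
- move=> n; apply: measurable_funM; last exact: measurable_sqn.
  by apply: smooth_measurable; apply: smooth_hardy_weight; rewrite invr_gt0.
- under eq_fun do rewrite enorm_sqr.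
  by apply: measurable_funM; [exact: measurable_sqn|exact: measurable_edotV].
- move=> n x; rewrite mulr_ge0 ?sqn_ge0// divr_ge0 ?exprn_ge0 ?edot_ge0//.
  by rewrite ltW// regsq_gt0// invr_gt0.
- by move=> x; rewrite divr_ge0 ?sqn_ge0// sqr_ge0.
- apply: aeW => x; rewrite enorm_sqr [sqn (f x) / _]mulrC.
  by apply: cvgM; [exact: hardy_weight_cvg|exact: cvg_cst].
- by move=> n; apply: hB; rewrite invr_gt0.
Qed.

End Hardy.

Section HardyInequality.
Variable R : realType.
Implicit Types (f g : R3 R -> spinor R) (F : nat -> R3 R -> spinor R) (k : 'I_3).
Implicit Types (A : R3 R -> R3 R) (eta : R).
Local Notation mu := (leb3 R).
Local Notation intg u := (mu.-integrable setT (EFin \o u)).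

(** The identity of [rdot_radial_derivative] for a merely weak derivative g, although the gradients
    of F_n need not converge to g. In the test of g against W F_n, these gradients are paired with f
    - F_n, which tends to 0; it is enough that W times them stays bounded. *)
Lemma rdot_weak_cdv_field A f g F k eta : 0 < eta -> locL2 A -> L2 f -> weak_cdv A k f g ->
  (forall n, Cc_infty_spinor (F n)) -> cvL2 F f ->
  (exists C, forall n, nrm2 (fun x => rscal (cutoff eta x) (cdv A k (F n) x)) <= C) ->
  rdot g (fun x => rscal (hardy_field eta k x) (f x)) =
  - (2^-1 * rdot f (fun x => rscal (partial k (hardy_field eta k) x) (f x))).
Proof.
move=> eta0 lA Lf [Lg Hg] cF Ff [C HC].
set W := hardy_field eta k.
have sW : smooth W := smooth_hardy_field eta0 k.
have sC := smooth_cutoff (R := R) eta0; have sU := smooth_radial eta0 k.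
have WC x : `|W x| <= 1 + eta^-1 := hardy_field_le eta0 k x.
have dWC x : `|partial k W x| <= 5 * eta^-1 := partial_hardy_field_le eta0 k x.
have mW := smooth_measurable sW; have mdW := smooth_measurable (smooth_partial k sW).
have LF n : L2 (F n) by exact: Cc_L2.
have LcF n : L2 (cdv A k (F n)) by exact: L2_cdv.
have LWf := L2Z mW WC Lf; have LdWf := L2Z mdW dWC Lf.
have LWF n : L2 (fun x => rscal (W x) (F n x)) by exact: (L2Z mW WC).
have LdWF n : L2 (fun x => rscal (partial k W x) (F n x)) by exact: (L2Z mdW dWC).
have LWcF n : L2 (fun x => rscal (W x) (cdv A k (F n) x)) by exact: (L2Z mW WC).
have cWF := cvL2Z mW WC LF Lf Ff; have cdWF := cvL2Z mdW dWC LF Lf Ff.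
(* The pairing of f with W D F_n is split at F_n; the part with F_n integrates by parts exactly. *)
have E n : rdot g (fun x => rscal (W x) (F n x)) =
    - rdot f (fun x => rscal (partial k W x) (F n x))
    + 2^-1 * rdot (F n) (fun x => rscal (partial k W x) (F n x))
    - rdot (fun x => f x - F n x) (fun x => rscal (W x) (cdv A k (F n) x)).
  rewrite Hg; last exact: Cc_spinor_scal.
  rewrite (_ : cdv A k (fun x => rscal (W x) (F n x)) = fun x =>
    rscal (partial k W x) (F n x) + rscal (W x) (cdv A k (F n) x)); last first.
    by apply/funext => x; rewrite cdv_scal.
  rewrite rdotDr// rdotBl// (rdot_radial_derivative lA sW (cF n) WC dWC).
  have arith (p q r : R) : - (p + q) = - p + 2^-1 * r - (q - - (2^-1 * r)) by ring.
  exact: arith.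
have l1 : rdot g (fun x => rscal (W x) (F n x)) @[n --> \oo] -->
    rdot g (fun x => rscal (W x) (f x)).
  by under eq_fun do rewrite rdotC; rewrite rdotC; exact: cvL2_rdot.
have l2 : rdot (fun x => f x - F n x) (fun x => rscal (W x) (cdv A k (F n) x))
    @[n --> \oo] --> (0 : R).
  apply: (@cvg0_sqr_le _ _ (fun n => nrm2 (fun x => F n x - f x)) ((1 + eta^-1) ^+ 2 * C)).
    move=> n; apply: le_trans (rdot_CS (L2B Lf (LF n)) (LWcF n)) _.
    rewrite nrm2BC ler_wpM2l ?nrm2_ge0//.
    (* W is the bounded function [radial] times [cutoff], so the hypothesis on the cut-off gradients
       applies. *)
    have -> : (fun x => rscal (W x) (cdv A k (F n) x)) = fun x =>
        rscal (radial eta k x) (rscal (cutoff eta x) (cdv A k (F n) x)).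
      by apply/funext => x; apply: spinorP => j; rewrite !cptE /W /hardy_field mulrA.
    have Lc : L2 (fun x => rscal (cutoff eta x) (cdv A k (F n) x)).
      exact: (L2Z (smooth_measurable sC) (cutoff_le1 eta0) (LcF n)).
    apply: le_trans (nrm2Z_le (smooth_measurable sU) (radial_le eta0 k) Lc) _.
    by rewrite ler_wpM2l// sqr_ge0.
  exact: Ff.
have l3 : rdot g (fun x => rscal (W x) (F n x)) @[n --> \oo] -->
    - rdot f (fun x => rscal (partial k W x) (f x))
    + 2^-1 * rdot f (fun x => rscal (partial k W x) (f x)) - 0.
  under eq_fun do rewrite E.
  apply: cvgB => //; apply: cvgD.
    apply: cvgN; under eq_fun do rewrite rdotC; rewrite rdotC.
    exact: cvL2_rdot.
  by apply: cvgM; [exact: cvg_cst|exact: cvL2_rdot2].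
rewrite (cvg_unique _ l1 l3) //.
have arith (p : R) : - p + 2^-1 * p - 0 = - (2^-1 * p) by field.
exact: arith.
Qed.

(** The g k form any weak gradient of f, and F is an approximation whose gradients are controlled
    only away from the origin. Later this bounds all weak gradients at once, without a uniqueness
    argument. *)
Theorem hardy A f (g : 'I_3 -> R3 R -> spinor R) F :
  locL2 A -> L2 f -> (forall k, weak_cdv A k f (g k)) ->
  (forall n, Cc_infty_spinor (F n)) -> cvL2 F f ->
  (forall eta, 0 < eta -> forall k, exists C, forall n,
     nrm2 (fun x => rscal (cutoff eta x) (cdv A k (F n) x)) <= C) ->
  (\int[mu]_x (sqn (f x) / enorm x ^+ 2)%:E <= (4 * \sum_k nrm2 (g k))%:E)%E.
Proof.
move=> lA Lf wg cF Ff HC; apply: hardy_fatou; first exact: L2_spinor_mfun.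
move=> eta eta0; pose W := hardy_field (R := R) eta.
have sW k : smooth (W k) := smooth_hardy_field eta0 k.
have WC k x : `|W k x| <= 1 + eta^-1 := hardy_field_le eta0 k x.
have dWC k x : `|partial k (W k) x| <= 5 * eta^-1 := partial_hardy_field_le eta0 k x.
have mW k := smooth_measurable (sW k).
have mdW k := smooth_measurable (smooth_partial k (sW k)).
have LWf k := L2Z (mW k) (WC k) Lf; have LdWf k := L2Z (mdW k) (dWC k) Lf.
pose e k x := 2^-1 * sdot (f x) (rscal (partial k (W k) x) (f x))
  + (- 4^-1) * sqn (rscal (W k x) (f x)).
have ie k : intg (e k) by apply: integrableZ2D; [exact: L2_sdot|exact: L2_sqn].
have inte k : \int[mu]_x e k x <= nrm2 (g k).
  have [Lg _] := wg k.
  rewrite /e RintegralD//; [|exact: (integrableZl measurableT _ (L2_sdot Lf (LdWf k)))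
     |exact: (integrableZl measurableT _ (L2_sqn (LWf k)))].
  rewrite (RintegralZl _ measurableT (L2_sdot Lf (LdWf k))).
  rewrite (RintegralZl _ measurableT (L2_sqn (LWf k))).
  rewrite -/(rdot f _) -/(nrm2 (fun x => rscal (W k x) (f x))).
  (* The square |g_k + W_k f / 2|^2 is expanded; [rdot_weak_cdv_field] evaluates its cross term. *)
  have := nrm2_ge0 (fun x => g k x + rscal 2^-1 (rscal (W k x) (f x))).
  rewrite nrm2D//; last exact: L2Zc.
  rewrite nrm2Zc// rdotC rdotZl// rdotC.
  rewrite (rdot_weak_cdv_field eta0 lA Lf (wg k) cF Ff (HC eta eta0 k)).
  move: (nrm2 (g k)) (nrm2 (fun x => rscal (W k x) (f x))) (rdot f _) => p q r h.
  have -> : 2^-1 * r + - 4^-1 * q = p - (p + 2^-1 ^+ 2 * q + 2 * (2^-1 * - (2^-1 * r))) by field.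
  by rewrite gerBl.
have isum : intg (fun x => \sum_k e k x).
  under eq_fun do rewrite sum3.
  exact: intgD (intgD (ie k0) (ie k1)) (ie k2).
have I4 : intg (fun x => 4 * (\sum_k e k x)) by exact: intgZ.
have we x : hardy_weight eta x * sqn (f x) <= 4 * (\sum_k e k x).
  have -> : \sum_k e k x = (\sum_k (2^-1 * partial k (W k) x - 4^-1 * W k x ^+ 2)) * sqn (f x).
    rewrite mulr_suml; apply: eq_bigr => k _; rewrite /e sdotZr sdotvv sqnZ.
    by move: (sqn (f x)) (partial _ _ _) (W k x) => p q r; ring.
  rewrite mulrA ler_wpM2r ?sqn_ge0//.
  by have := hardy_field_div eta0 x; rewrite ler_pdivrMr// mulrC.
apply: (@le_trans _ _ (\int[mu]_x (4 * (\sum_k e k x))%:E)%E).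
  apply: ge0_le_integral => //.
  - move=> x _; rewrite lee_fin mulr_ge0 ?sqn_ge0// divr_ge0 ?exprn_ge0 ?edot_ge0//.
    by rewrite ltW// regsq_gt0.
  - apply/measurable_EFinP; apply: measurable_funM; last first.
      by apply: measurable_sqn; exact: L2_spinor_mfun.
    by apply: smooth_measurable; exact: smooth_hardy_weight.
  - by have /integrableP[] := I4.
  - by move=> x _; rewrite lee_fin.
rewrite -[leLHS]fineK; last exact: (integrable_fin_num measurableT I4).
rewrite lee_fin -/(Rintegral mu setT (fun x => 4 * (\sum_k e k x))).
rewrite RintegralZl// ler_pM2l// sum3.
under eq_Rintegral do rewrite sum3.
have i01 := intgD (ie k0) (ie k1).
rewrite (RintegralD measurableT i01 (ie k2)) (RintegralD measurableT (ie k0) (ie k1)).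
by rewrite !lerD.
Qed.

End HardyInequality.

(** * Pauli's identity *)

Section DiracEnergy.
Variable R : realType.
Implicit Types (f : R3 R -> spinor R) (k l : 'I_3) (A B : R3 R -> R3 R) (v : spinor R).
Implicit Types (phi u w : R3 R -> R).
Local Notation mu := (leb3 R).
Local Notation intg u := (mu.-integrable setT (EFin \o u)).

(* The density [<Sigma_l v, v>], where [Sigma_l] is the block diagonal matrix
   with two copies of [sigma_l]. *)
Definition spin_density l v : R :=
  let a j := complex.Re (v j 0) in let b j := complex.Im (v j 0) in
  match val l with
  | 0%N => 2 * (a j0 * a j1 + b j0 * b j1 + a j2 * a j3 + b j2 * b j3)
  | 1%N => 2 * (b j1 * a j0 - a j1 * b j0 + b j3 * a j2 - a j3 * b j2)
  | _ => a j0 * a j0 + b j0 * b j0 - a j1 * a j1 - b j1 * b j1 +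
         a j2 * a j2 + b j2 * b j2 - a j3 * a j3 - b j3 * b j3
  end.

(* The difference of the two sides is [4 |v_0 v_3 - v_1 v_2|^2]. *)
Lemma spin_density_sqr v : \sum_l spin_density l v ^+ 2 <= sqn v ^+ 2.
Proof.
rewrite sum3 /spin_density /sqn sum4 /= -subr_ge0.
move: (v j0 0) (v j1 0) (v j2 0) (v j3 0) => [a b] [c d] [p q] [r s] /=.
have := mulr_ge0 (ler0n R 4) (addr_ge0 (sqr_ge0 (a * r - b * s - c * p + d * q))
  (sqr_ge0 (a * s + b * r - c * q - d * p))).
by congr (0 <= _); ring.
Qed.

Lemma spin_density_le (b : R3 R) v : `|\sum_l crd b l * spin_density l v| <= enorm b * sqn v.
Proof.
rewrite -(@ler_pXn2r _ 2)// ?nnegrE ?mulr_ge0 ?enorm_ge0 ?sqn_ge0//.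
rewrite real_normK ?num_real// exprMn enorm_sqr.
apply: le_trans (_ : edot b b * (\sum_l spin_density l v ^+ 2) <= _); last first.
  by rewrite ler_wpM2l ?edot_ge0// spin_density_sqr.
rewrite edotE !sum3.
move: (crd b k0) (crd b k1) (crd b k2) => p q r.
move: (spin_density k0 v) (spin_density k1 v) (spin_density k2 v) => x y z.
rewrite -subr_ge0.
(* Lagrange's identity: the difference of the two sides is this sum of squares. *)
have := addr_ge0 (addr_ge0 (sqr_ge0 (p * y - q * x)) (sqr_ge0 (q * z - r * y)))
  (sqr_ge0 (r * x - p * z)).
by congr (0 <= _); ring.
Qed.

(** On the box that supports phi, |t| <= t^2 + 1 passes from square integrability to
    integrability. *)
Lemma intg_potential A k phi : locL2 A -> Cc_infty phi -> intg (fun x => crd (A x) k * phi x).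
Proof.
move=> lA cphi; have [mA iA] := lA phi k cphi.
have [M M0 hM] := box_support cphi.
pose K : set (R3 R) := `[(- M)%R, M] `*` `[(- M)%R, M] `*` `[(- M)%R, M].
have mK : measurable K by apply: measurableX => //; exact: measurableX.
have iK : intg (fun x => \1_K x).
  apply: (@bounded_support_integrable _ _ R mu (fun x => \1_K x) K 1 mK (leb3_box_fin M)) => //.
  - exact: measurable_indic.
  - by move=> x; rewrite indicE ger0_norm// lern1; case: (_ \in _).
  - by move=> x nK; rewrite indicE memNset.
apply: (le_intg mA _ (intgD iA iK)) => x; rewrite indicE.
have [xK|xK] := boolP (x \in K).
  rewrite mulr1n ler_norml; move: (_ * _) => t; apply/andP.
  have := sqr_ge0 (t - 1); have := sqr_ge0 (t + 1); have := sqr_ge0 t.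
  by split; nra.
suff -> : phi x = 0 by rewrite mulr0 expr0n normr0 addr0.
apply/eqP/contraT => fx0.
have xk l : crd x l \in `[- M, M].
  by apply/contraT => /negP /not_itv_gt /hM fx; rewrite fx eqxx in fx0.
case/negP: xK; rewrite inE; split; [split|].
- exact: (xk k0).
- exact: (xk k1).
- exact: (xk k2).
Qed.

(** The weak equation curl A = B tested against u w. It only equates values of integrals, so the
    integrability of B u w is asked for separately. *)
Lemma null_curl A B l u w : locL2 A -> weak_curl A B -> Cc_infty u -> Cc_infty w ->
  intg (fun x => crd (B x) l * (u x * w x)) ->
  null (fun x => crd (B x) l * (u x * w x)
    + (crd (A x) (l + 2) * (partial (l + 1) u x * w x + u x * partial (l + 1) w x)
     - crd (A x) (l + 1) * (partial (l + 2) u x * w x + u x * partial (l + 2) w x))).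
Proof.
move=> lA cAB cu cw iB.
have cuw : Cc_infty (fun x => u x * w x) by apply: Cc_smoothM => //; exact: Cc_smooth.
have dE i x : partial i (fun x => u x * w x) x = partial i u x * w x + u x * partial i w x.
  by rewrite partialM//; exact/smooth_diff/Cc_smooth.
have ia i i' : intg (fun x => crd (A x) i' * (partial i u x * w x + u x * partial i w x)).
  by under eq_fun do rewrite -dE; apply: intg_potential => //; exact: Cc_partial.
have iA : intg (fun x => crd (A x) (l + 2) * (partial (l + 1) u x * w x + u x * partial (l + 1) w x)
     - crd (A x) (l + 1) * (partial (l + 2) u x * w x + u x * partial (l + 2) w x)).
  have := intgD (ia (l + 1) (l + 2)) (intgZ (-1) (ia (l + 2) (l + 1))).
  by under eq_fun do rewrite mulN1r.
split; first exact: intgD.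
rewrite RintegralD// (cAB _ l cuw) RintegralB//; [|exact: intg_potential (Cc_partial _ cuw)..].
rewrite RintegralB//.
under eq_Rintegral do rewrite dE.
under [X in _ - X + _]eq_Rintegral do rewrite dE.
by rewrite addrC addrA subrK subrr.
Qed.

Lemma sqn_dirac_vec m (D : 'I_3 -> spinor R) v :
  let d k j := complex.Re (D k j 0) in let e k j := complex.Im (D k j 0) in
  let a j := complex.Re (v j 0) in let b j := complex.Im (v j 0) in
  sqn (dirac_vec m D v) =
    ((e k2 j2 + e k0 j3 - d k1 j3 + m * a j0) ^+ 2 +
     (- (d k2 j2 + d k0 j3 + e k1 j3) + m * b j0) ^+ 2) +
    ((e k0 j2 + d k1 j2 - e k2 j3 + m * a j1) ^+ 2 +
     (- (d k0 j2 - e k1 j2 - d k2 j3) + m * b j1) ^+ 2) +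
    ((e k2 j0 + e k0 j1 - d k1 j1 - m * a j2) ^+ 2 +
     (- (d k2 j0 + d k0 j1 + e k1 j1) - m * b j2) ^+ 2) +
    ((e k0 j0 + d k1 j0 - e k2 j1 - m * a j3) ^+ 2 +
     (- (d k0 j0 - e k1 j0 - d k2 j1) - m * b j3) ^+ 2).
Proof.
move=> d e a b; rewrite /sqn sum4.
by have [[-> -> -> ->] -> -> -> ->] := dirac_vec_cpt m D v.
Qed.

(** Each alpha_k anticommutes with beta, so the terms linear in m combine into Leibniz expressions
    du w + u dw. Here [da] and [db] stand for the derivatives of the real and imaginary parts and p
    for the potential, which cancels. *)
Lemma dirac_mass_algebra m (D : 'I_3 -> spinor R) v (p : 'I_3 -> R) (da db : 'I_3 -> 'I_4 -> R) :
  let a j := complex.Re (v j 0) in let b j := complex.Im (v j 0) in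
  (forall k j, complex.Re (D k j 0) = da k j + p k * b j) ->
  (forall k j, complex.Im (D k j 0) = db k j - p k * a j) ->
  let P k (du dw : 'I_3 -> R) (u w : R) := du k * w + u * dw k in
  2 * m * (
    (P k2 (db ^~ j2) (da ^~ j0) (b j2) (a j0) - P k2 (da ^~ j2) (db ^~ j0) (a j2) (b j0)
     - P k2 (db ^~ j3) (da ^~ j1) (b j3) (a j1) + P k2 (da ^~ j3) (db ^~ j1) (a j3) (b j1))
  + (P k0 (db ^~ j3) (da ^~ j0) (b j3) (a j0) - P k0 (da ^~ j3) (db ^~ j0) (a j3) (b j0)
     + P k0 (db ^~ j2) (da ^~ j1) (b j2) (a j1) - P k0 (da ^~ j2) (db ^~ j1) (a j2) (b j1))
  + (P k1 (da ^~ j2) (da ^~ j1) (a j2) (a j1) + P k1 (db ^~ j2) (db ^~ j1) (b j2) (b j1)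
     - P k1 (da ^~ j3) (da ^~ j0) (a j3) (a j0) - P k1 (db ^~ j3) (db ^~ j0) (b j3) (b j0)))
  = sqn (dirac_vec m D v) - m ^+ 2 * sqn v - sqn (dirac_vec 0 D v).
Proof.
move=> a b hd he P.
rewrite !sqn_dirac_vec !hd !he /sqn sum4 /P.
rewrite -/(a j0) -/(a j1) -/(a j2) -/(a j3) -/(b j0) -/(b j1) -/(b j2) -/(b j3).
move: (da k0 j0) (db k0 j0) (da k0 j1) (db k0 j1) (da k0 j2) (db k0 j2) (da k0 j3) => ? ? ? ? ? ? ?.
move: (db k0 j3) (da k1 j0) (db k1 j0) (da k1 j1) (db k1 j1) (da k1 j2) (db k1 j2) => ? ? ? ? ? ? ?.
move: (da k1 j3) (db k1 j3) (da k2 j0) (db k2 j0) (da k2 j1) (db k2 j1) (da k2 j2) => ? ? ? ? ? ? ?.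
move: (db k2 j2) (da k2 j3) (db k2 j3) (a j0) (a j1) (a j2) (a j3) => ? ? ? ? ? ? ?.
move: (b j0) (b j1) (b j2) (b j3) (p k0) (p k1) (p k2) => ? ? ? ? ? ? ?.
by ring.
Qed.

(** Addition modulo 3 on the explicit indices, as a product so that one rewrite rule carries all six
    equations. *)
Lemma ord3E : (k0 + 1 = k1) * (k0 + 2 = k2) * ((k1 + 1 = k2) * (k1 + 2 = k0)) *
  ((k2 + 1 = k0) * (k2 + 2 = k1)).
Proof. by do ![split]; apply: val_inj. Qed.

Lemma null_dirac_mass m A f : locL2 A -> Cc_infty_spinor f ->
  null (fun x => sqn (dirac_vec m (fun k => cdv A k f x) (f x)) - m ^+ 2 * sqn (f x)
    - sqn (dirac_vec 0 (fun k => cdv A k f x) (f x))).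
Proof.
move=> lA cf.
have cR j := (cf j).1; have cI j := (cf j).2.
pose a j y := complex.Re (f y j 0); pose b j y := complex.Im (f y j 0).
pose P k u w (x : R3 R) := partial k u x * w x + u x * partial k w x.
have nP k u w : Cc_infty u -> Cc_infty w -> null (P k u w) by exact: null_product.
pose Q x :=
    (P k2 (b j2) (a j0) x - P k2 (a j2) (b j0) x - P k2 (b j3) (a j1) x + P k2 (a j3) (b j1) x)
  + (P k0 (b j3) (a j0) x - P k0 (a j3) (b j0) x + P k0 (b j2) (a j1) x - P k0 (a j2) (b j1) x)
  + (P k1 (a j2) (a j1) x + P k1 (b j2) (b j1) x - P k1 (a j3) (a j0) x - P k1 (b j3) (b j0) x).
have nQ : null Q.
  exact: (nullD (nullD
    (nullD (nullB (nullB (nP k2 _ _ (cI j2) (cR j0)) (nP k2 _ _ (cR j2) (cI j0)))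
      (nP k2 _ _ (cI j3) (cR j1))) (nP k2 _ _ (cR j3) (cI j1)))
    (nullB (nullD (nullB (nP k0 _ _ (cI j3) (cR j0)) (nP k0 _ _ (cR j3) (cI j0)))
      (nP k0 _ _ (cI j2) (cR j1))) (nP k0 _ _ (cR j2) (cI j1))))
    (nullB (nullB (nullD (nP k1 _ _ (cR j2) (cR j1)) (nP k1 _ _ (cI j2) (cI j1)))
      (nP k1 _ _ (cR j3) (cR j0))) (nP k1 _ _ (cI j3) (cI j0)))).
apply: null_eq (nullZ (2 * m) nQ) _ => x.
rewrite /Q /P /a /b {Q P nQ nP a b cR cI}.
have := @dirac_mass_algebra m (fun k => cdv A k f x) (f x) (fun k => crd (A x) k)
  (fun k j => partial k (fun y => complex.Re (f y j 0)) x)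
  (fun k j => partial k (fun y => complex.Im (f y j 0)) x).
by apply => k j; [exact: Re_cdv|exact: Im_cdv].
Qed.

(** The products alpha_j alpha_k with j <> k contribute two kinds of terms. Two derivatives give the
    Jacobians J; one derivative and one potential give p d(u w), which W completes to the weak curl
    equation. The components and signs of the W terms are those of [spin_density]. *)
Lemma dirac_curl_algebra (D : 'I_3 -> spinor R) v (p B : 'I_3 -> R) (da db : 'I_3 -> 'I_4 -> R) :
  let a j := complex.Re (v j 0) in let b j := complex.Im (v j 0) in
  (forall k j, complex.Re (D k j 0) = da k j + p k * b j) ->
  (forall k j, complex.Im (D k j 0) = db k j - p k * a j) ->
  let J k l (du dw : 'I_3 -> R) := du k * dw l - du l * dw k in
  let W l (du dw : 'I_3 -> R) (u w : R) := B l * (u * w)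
    + (p (l + 2) * (du (l + 1) * w + u * dw (l + 1))
       - p (l + 1) * (du (l + 2) * w + u * dw (l + 2))) in
  2 * (J k0 k1 (db ^~ j0) (da ^~ j0)
    - J k0 k1 (db ^~ j1) (da ^~ j1)
    + J k0 k1 (db ^~ j2) (da ^~ j2)
    - J k0 k1 (db ^~ j3) (da ^~ j3)
    + J k1 k2 (db ^~ j1) (da ^~ j0)
    + J k1 k2 (db ^~ j0) (da ^~ j1)
    + J k1 k2 (db ^~ j3) (da ^~ j2)
    + J k1 k2 (db ^~ j2) (da ^~ j3)
    + J k2 k0 (da ^~ j0) (da ^~ j1)
    + J k2 k0 (db ^~ j0) (db ^~ j1)
    + J k2 k0 (da ^~ j2) (da ^~ j3)
    + J k2 k0 (db ^~ j2) (db ^~ j3))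
  + (W k2 (da ^~ j0) (da ^~ j0) (a j0) (a j0)
    + W k2 (db ^~ j0) (db ^~ j0) (b j0) (b j0)
    - W k2 (da ^~ j1) (da ^~ j1) (a j1) (a j1)
    - W k2 (db ^~ j1) (db ^~ j1) (b j1) (b j1)
    + W k2 (da ^~ j2) (da ^~ j2) (a j2) (a j2)
    + W k2 (db ^~ j2) (db ^~ j2) (b j2) (b j2)
    - W k2 (da ^~ j3) (da ^~ j3) (a j3) (a j3)
    - W k2 (db ^~ j3) (db ^~ j3) (b j3) (b j3)
    + 2 * W k0 (da ^~ j0) (da ^~ j1) (a j0) (a j1)
    + 2 * W k0 (db ^~ j0) (db ^~ j1) (b j0) (b j1)
    + 2 * W k0 (da ^~ j2) (da ^~ j3) (a j2) (a j3)
    + 2 * W k0 (db ^~ j2) (db ^~ j3) (b j2) (b j3)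
    + 2 * W k1 (db ^~ j1) (da ^~ j0) (b j1) (a j0)
    - 2 * W k1 (da ^~ j1) (db ^~ j0) (a j1) (b j0)
    + 2 * W k1 (db ^~ j3) (da ^~ j2) (b j3) (a j2)
    - 2 * W k1 (da ^~ j3) (db ^~ j2) (a j3) (b j2))
  = sqn (dirac_vec 0 D v) - \sum_k sqn (D k) + \sum_l B l * spin_density l v.
Proof.
move=> a b hd he J W.
rewrite sqn_dirac_vec !sum3 /sqn !sum4 !hd !he /J /W !ord3E /spin_density/=.
rewrite -/(a j0) -/(a j1) -/(a j2) -/(a j3) -/(b j0) -/(b j1) -/(b j2) -/(b j3).
move: (da k0 j0) (db k0 j0) (da k0 j1) (db k0 j1) (da k0 j2) (db k0 j2) (da k0 j3) => ? ? ? ? ? ? ?.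
move: (db k0 j3) (da k1 j0) (db k1 j0) (da k1 j1) (db k1 j1) (da k1 j2) (db k1 j2) => ? ? ? ? ? ? ?.
move: (da k1 j3) (db k1 j3) (da k2 j0) (db k2 j0) (da k2 j1) (db k2 j1) (da k2 j2) => ? ? ? ? ? ? ?.
move: (db k2 j2) (da k2 j3) (db k2 j3) (a j0) (a j1) (a j2) (a j3) => ? ? ? ? ? ? ?.
move: (b j0) (b j1) (b j2) (b j3) (p k0) (p k1) (p k2) => ? ? ? ? ? ? ?.
move: (B k0) (B k1) (B k2) => ? ? ?.
by ring.
Qed.

Lemma null_dirac_curl A B (b : R3 R -> R) f : locL2 A -> weak_curl A B ->
  (forall l, measurable_fun setT (fun x => crd (B x) l)) ->
  (forall l x, `|crd (B x) l| <= b x) ->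
  intg (fun x => b x * sqn (f x)) -> Cc_infty_spinor f ->
  null (fun x => sqn (dirac_vec 0 (fun k => cdv A k f x) (f x))
    - \sum_k sqn (cdv A k f x) + \sum_l crd (B x) l * spin_density l (f x)).
Proof.
move=> lA cAB mB Bb iBf cf.
have cR j := (cf j).1; have cI j := (cf j).2.
have lR j x := sqr_Re_le_sqn (f x) j; have lI j x := sqr_Im_le_sqn (f x) j.
have iB l u w : Cc_infty u -> Cc_infty w ->
    (forall x, u x ^+ 2 <= sqn (f x)) -> (forall x, w x ^+ 2 <= sqn (f x)) ->
    intg (fun x => crd (B x) l * (u x * w x)).
  move=> cu cw ul wl; apply: (le_intg _ _ iBf).
    by apply: measurable_funM => //; apply: measurable_funM; exact: Cc_measurable.
  move=> x; rewrite normrM ler_pM//.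
  have := ul x; have := wl x; move: (u x) (w x) (sqn _) => p q r h1 h2.
  have := sqr_ge0 (p - q); have := sqr_ge0 (p + q).
  by rewrite ler_norml => *; apply/andP; split; nra.
have nJ k l u w (cu : Cc_infty u) (cw : Cc_infty w) := null_jacobian k l cu cw.
pose V l u w x := crd (B x) l * (u x * w x)
    + (crd (A x) (l + 2) * (partial (l + 1) u x * w x + u x * partial (l + 1) w x)
     - crd (A x) (l + 1) * (partial (l + 2) u x * w x + u x * partial (l + 2) w x)).
have nW l u w (cu : Cc_infty u) (cw : Cc_infty w) :
    (forall x, u x ^+ 2 <= sqn (f x)) -> (forall x, w x ^+ 2 <= sqn (f x)) -> null (V l u w).
  by move=> lu lw; apply: null_curl => //; exact: iB.
(* The combination repeats the left-hand side of [dirac_curl_algebra] term by term. *)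
apply: null_eq (nullD (nullZ 2
    (nullD (nullD (nullD (nullD (nullD (nullD (nullD (nullD (nullB (nullD (nullB
    (nJ k0 k1 _ _ (cI j0) (cR j0))
    (nJ k0 k1 _ _ (cI j1) (cR j1)))
    (nJ k0 k1 _ _ (cI j2) (cR j2)))
    (nJ k0 k1 _ _ (cI j3) (cR j3)))
    (nJ k1 k2 _ _ (cI j1) (cR j0)))
    (nJ k1 k2 _ _ (cI j0) (cR j1)))
    (nJ k1 k2 _ _ (cI j3) (cR j2)))
    (nJ k1 k2 _ _ (cI j2) (cR j3)))
    (nJ k2 k0 _ _ (cR j0) (cR j1)))
    (nJ k2 k0 _ _ (cI j0) (cI j1)))
    (nJ k2 k0 _ _ (cR j2) (cR j3)))
    (nJ k2 k0 _ _ (cI j2) (cI j3))))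
    (nullB (nullD (nullB (nullD (nullD (nullD (nullD (nullD (nullB (nullB (nullD (nullD (nullB (nullB (nullD
    (nW k2 _ _ (cR j0) (cR j0) (lR j0) (lR j0))
    (nW k2 _ _ (cI j0) (cI j0) (lI j0) (lI j0)))
    (nW k2 _ _ (cR j1) (cR j1) (lR j1) (lR j1)))
    (nW k2 _ _ (cI j1) (cI j1) (lI j1) (lI j1)))
    (nW k2 _ _ (cR j2) (cR j2) (lR j2) (lR j2)))
    (nW k2 _ _ (cI j2) (cI j2) (lI j2) (lI j2)))
    (nW k2 _ _ (cR j3) (cR j3) (lR j3) (lR j3)))
    (nW k2 _ _ (cI j3) (cI j3) (lI j3) (lI j3)))
    (nullZ 2 (nW k0 _ _ (cR j0) (cR j1) (lR j0) (lR j1))))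
    (nullZ 2 (nW k0 _ _ (cI j0) (cI j1) (lI j0) (lI j1))))
    (nullZ 2 (nW k0 _ _ (cR j2) (cR j3) (lR j2) (lR j3))))
    (nullZ 2 (nW k0 _ _ (cI j2) (cI j3) (lI j2) (lI j3))))
    (nullZ 2 (nW k1 _ _ (cI j1) (cR j0) (lI j1) (lR j0))))
    (nullZ 2 (nW k1 _ _ (cR j1) (cI j0) (lR j1) (lI j0))))
    (nullZ 2 (nW k1 _ _ (cI j3) (cR j2) (lI j3) (lR j2))))
    (nullZ 2 (nW k1 _ _ (cR j3) (cI j2) (lR j3) (lI j2))))) _ => x.
have := @dirac_curl_algebra (fun k => cdv A k f x) (f x) (fun k => crd (A x) k) (fun k => crd (B x) k)
  (fun k j => partial k (fun y => complex.Re (f y j 0)) x)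
  (fun k j => partial k (fun y => complex.Im (f y j 0)) x).
by apply => k j; [exact: Re_cdv|exact: Im_cdv].
Qed.

End DiracEnergy.

(** * The energy inequality *)

Section Energy.
Variable R : realType.
Implicit Types (f : R3 R -> spinor R) (k : 'I_3).
Local Notation mu := (leb3 R).

(** [Lnorm] at exponent +oo is the essential supremum only if the whole space has positive
    measure. *)
Lemma leb3_setT_gt0 : (0 < mu setT)%E.
Proof.
apply: (@lt_le_trans _ _ (mu (`[(0:R), 1] `*` `[(0:R), 1] `*` `[(0:R), 1]))); last first.
  by apply: le_measure => //; rewrite inE//; apply: measurableX => //; exact: measurableX.
rewrite /leb3/= product_measure1E//=; last exact: measurableX.
by rewrite product_measure1E//= !lebesgue_measure_itv/= lte01 oppr0 adde0 !mule1 lte01.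
Qed.

Lemma Lnormy_ae (u : R3 R -> R) (C : R) : (forall x, 0 <= u x) ->
  Lnorm mu +oo%E (EFin \o u) = C%:E -> {ae mu, forall x, u x <= C}.
Proof.
move=> u0; rewrite unlock /Lnorm.body leb3_setT_gt0 => uC.
have := ess_sup_ge mu (abse \o (EFin \o u)).
by apply: filterS => x /=; rewrite uC lee_fin ger0_norm.
Qed.

Lemma enorm_gt0 (x : R3 R) : x != 0 -> 0 < enorm x.
Proof.
move=> x0; rewrite lt_neqAle enorm_ge0 andbT eq_sym; apply: contra x0 => /eqP x0; apply/eqP.
have c0 k : crd x k = 0 by apply/eqP; rewrite -normr_le0 -x0; exact: crd_le_enorm.
have := c0 k0; have := c0 k1; have := c0 k2; rewrite /crd/=.
by case: x {x0 c0} => [[? ?] ?] /= -> -> ->.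
Qed.

(** The spinor f / |x|, equal to 0 at the origin. *)
Definition hardy_quot f : R3 R -> spinor R := fun x => rscal (enorm x)^-1 (f x).

Lemma sqn_hardy_quot f x : sqn (hardy_quot f x) = sqn (f x) / enorm x ^+ 2.
Proof. by rewrite sqnZ exprVn mulrC. Qed.

Lemma spinor_mfun_hardy_quot f : spinor_mfun f -> spinor_mfun (hardy_quot f).
Proof. by apply: spinor_mfunZ; exact: measurable_enormV. Qed.

Lemma normsq_hardy_quot f : L2_normsq (hardy_quot f) = (\int[mu]_x (sqn (f x) / enorm x ^+ 2)%:E)%E.
Proof. by apply: eq_integral => x _; rewrite sqn_hardy_quot. Qed.

Lemma measurable_crd k : measurable_fun setT (fun x : R3 R => crd x k).
Proof. by apply: smooth_measurable; exact: smooth_crd. Qed.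

Lemma measurable_enorm : measurable_fun setT (@enorm R).
Proof. by apply: continuous_measurable_R3; exact: enorm_continuous. Qed.

End Energy.

(** * Linearity of the Dirac operator and its commutator with a function *)

Section DiracLinear.
Variable R : realType.
Implicit Types (f g : R3 R -> spinor R) (k : 'I_3) (v w : spinor R).
Implicit Types (D : 'I_3 -> spinor R).

Lemma dirac_vecB m D D' v v' :
  dirac_vec m (fun k => D k - D' k) (v - v') = dirac_vec m D v - dirac_vec m D' v' :> spinor R.
Proof.
rewrite /dirac_vec mulmxBr !scalerBr.
rewrite (_ : \sum_k _ = \sum_k dirac_alpha R k *m D k - \sum_k dirac_alpha R k *m D' k).
  by rewrite scalerBr opprD addrACA.
by rewrite -sumrB; apply: eq_bigr => k _; rewrite mulmxBr.
Qed.

Lemma dirac_vecD m D D' v v' :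
  dirac_vec m (fun k => D k + D' k) (v + v') = dirac_vec m D v + dirac_vec m D' v' :> spinor R.
Proof.
rewrite /dirac_vec mulmxDr !scalerDr.
rewrite (_ : \sum_k _ = \sum_k dirac_alpha R k *m D k + \sum_k dirac_alpha R k *m D' k).
  by rewrite scalerDr addrACA.
by rewrite -big_split; apply: eq_bigr => k _; rewrite mulmxDr.
Qed.

Lemma dirac_vecZ m t D v :
  dirac_vec m (fun k => rscal t (D k)) (rscal t v) = rscal t (dirac_vec m D v).
Proof.
rewrite /dirac_vec /rscal scalerDr !scalerA ![Complex t 0 * _]mulrC -!scalerA.
congr (_ *: _ + _ *: _); last by rewrite -scalemxAr.
by rewrite scaler_sumr; apply: eq_bigr => k _; rewrite -scalemxAr.
Qed.

(* [-i sum_k c_k alpha_k v], whose square norm is [|c|^2 |v|^2]. *)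
Definition clifford (c : 'I_3 -> R) v : spinor R := dirac_vec 0 (fun k => rscal (c k) v) 0.

Lemma sqn_clifford c v : sqn (clifford c v) = (\sum_k c k ^+ 2) * sqn v.
Proof.
rewrite /clifford sqn_dirac_vec !ReZv !ImZv !mul0r !addr0 !subr0 /sqn sum3 sum4.
move: (v j0 0) (v j1 0) (v j2 0) (v j3 0) (c k0) (c k1) (c k2).
by move=> [? ?] [? ?] [? ?] [? ?] ? ? ? /=; ring.
Qed.

Lemma cliffordB c v w : clifford c (v - w) = clifford c v - clifford c w.
Proof.
rewrite /clifford -dirac_vecB subrr; congr dirac_vec.
by apply/funext => k; rewrite rscalB.
Qed.

(** The mass term commutes with W, so the commutator is -i alpha . grad W. *)
Lemma dirac_scal m A W f x : smooth W -> Cc_infty_spinor f ->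
  Defs.dirac m A (fun y => rscal (W y) (f y)) x =
  rscal (W x) (Defs.dirac m A f x) + clifford (fun k => partial k W x) (f x).
Proof.
move=> sW cf; rewrite !dirac_vecE -dirac_vecZ.
(* The mass acts here on the zero spinor, so it can be given any value. *)
have -> : clifford (fun k => partial k W x) (f x) =
    dirac_vec m (fun k => rscal (partial k W x) (f x)) 0.
  by rewrite /clifford /dirac_vec !mulmx0 !scaler0.
rewrite -dirac_vecD addr0; congr dirac_vec; apply/funext => k.
by rewrite cdv_scal// addrC.
Qed.

Lemma diracB m A f g x : Cc_infty_spinor f -> Cc_infty_spinor g ->
  Defs.dirac m A (fun y => f y - g y) x = Defs.dirac m A f x - Defs.dirac m A g x.
Proof.
move=> cf cg; rewrite !dirac_vecE -dirac_vecB; congr dirac_vec.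
by apply/funext => k; rewrite cdvB.
Qed.

Lemma spinor_mfun_mulmx (M : 'M[R[i]]_4) f : spinor_mfun f -> spinor_mfun (fun x => M *m f x).
Proof.
move=> mf j; have ReS (F : 'I_4 -> R[i]) : complex.Re (\sum_l F l) = \sum_l complex.Re (F l).
  by apply: (big_morph _ (id1 := 0) (op1 := +%R)) => // -[? ?] [? ?].
have ImS (F : 'I_4 -> R[i]) : complex.Im (\sum_l F l) = \sum_l complex.Im (F l).
  by apply: (big_morph _ (id1 := 0) (op1 := +%R)) => // -[? ?] [? ?].
have ReM (z w : R[i]) : complex.Re (z * w) =
    complex.Re z * complex.Re w - complex.Im z * complex.Im w by case: z w => [? ?] [? ?].
have ImM (z w : R[i]) : complex.Im (z * w) =
    complex.Re z * complex.Im w + complex.Im z * complex.Re w by case: z w => [? ?] [? ?].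
have mZ (c : R) (u : R3 R -> R) : measurable_fun setT u -> measurable_fun setT (fun x => c * u x).
  by move=> mu_; apply: measurable_funM => //; exact: measurable_cst.
split.
  under eq_fun do rewrite mxE ReS; apply: measurable_sum => l; have [? ?] := mf l.
  by under eq_fun do rewrite ReM; apply: measurable_funB; exact: mZ.
under eq_fun do rewrite mxE ImS; apply: measurable_sum => l; have [? ?] := mf l.
by under eq_fun do rewrite ImM; apply: measurable_funD; exact: mZ.
Qed.

Lemma spinor_mfun_dirac_vec m (D : R3 R -> 'I_3 -> spinor R) f :
  (forall k, spinor_mfun (D ^~ k)) -> spinor_mfun f ->
  spinor_mfun (fun x => dirac_vec m (D x) (f x)).
Proof.
move=> mD mf; rewrite /dirac_vec.
have E x : (Complex 0 1)^-1 *: (\sum_k dirac_alpha R k *m D x k) +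
    Complex m 0 *: (dirac_beta R *m f x) =
  (Complex 0 1)^-1%:M *m (dirac_alpha R k0 *m D x k0 + dirac_alpha R k1 *m D x k1 +
    dirac_alpha R k2 *m D x k2) + (Complex m 0)%:M *m (dirac_beta R *m f x).
  by rewrite !mul_scalar_mx sum3.
under eq_fun do rewrite E.
apply: spinor_mfunD; last by do 2 apply: spinor_mfun_mulmx.
by apply: spinor_mfun_mulmx; apply: spinor_mfunD; [apply: spinor_mfunD|]; exact: spinor_mfun_mulmx.
Qed.

Lemma spinor_mfun_clifford (c : R3 R -> 'I_3 -> R) f : (forall k, measurable_fun setT (c ^~ k)) ->
  spinor_mfun f -> spinor_mfun (fun x => clifford (c x) (f x)).
Proof.
move=> mc mf; apply: (spinor_mfun_dirac_vec 0 (D := fun x k => rscal (c x k) (f x)) (f := fun=> 0)).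
  by move=> k; exact: spinor_mfunZ.
have := spinor_mfunZ (measurable_cst (0 : R)) mf.
by under eq_fun do rewrite /rscal scale0r.
Qed.

End DiracLinear.

Section EnergyInequality.
Variables (R : realType) (m : R) (A B1 B2 : R3 R -> R3 R) (C0 N : R).
Local Notation mu := (leb3 R).
Local Notation intg u := (mu.-integrable setT (EFin \o u)).
Hypothesis lA : locL2 A.
Hypothesis LH : forall f, Cc_infty_spinor f -> L2 (Defs.dirac m A f).
Hypothesis cAB : weak_curl A (fun x => B1 x + B2 x).
Hypotheses (mB1 : measurable_fun setT B1) (mB2 : measurable_fun setT B2).
Hypothesis hB1 : {ae mu, forall x, enorm x ^+ 2 * enorm (B1 x) <= C0}.
Hypothesis hB2 : {ae mu, forall x, enorm (B2 x) <= N}.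
Hypotheses (C00 : 0 <= C0) (N0 : 0 <= N).

Lemma hardy_Cc f : Cc_infty_spinor f ->
  L2 (hardy_quot f) /\ nrm2 (hardy_quot f) <= 4 * \sum_k nrm2 (cdv A k f).
Proof.
move=> cf; have Lf := Cc_L2 cf.
have h : (\int[mu]_x (sqn (f x) / enorm x ^+ 2)%:E <= (4 * \sum_k nrm2 (cdv A k f))%:E)%E.
  (* A test spinor is approximated by the constant sequence. *)
  apply: (@hardy _ A f (fun k => cdv A k f) (fun=> f)) => //.
  - by move=> k; exact: weak_cdv_cdv.
  - have E : nrm2 (fun x => f x - f x) = 0.
      under [nrm2 _]eq_Rintegral do rewrite subrr.
      rewrite (_ : sqn 0 = 0) ?Rintegral_cst ?mul0r//.
      by rewrite -[X in sqn X](scaler0 _ (Complex 0 0)) sqnZ expr0n mul0r.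
    by rewrite /cvL2 E; exact: cvg_cst.
  - by move=> eta eta0 k; exists (nrm2 (fun x => rscal (cutoff eta x) (cdv A k f x))).
have Lh : L2 (hardy_quot f).
  split; first by apply: spinor_mfun_hardy_quot; exact: L2_spinor_mfun.
  by rewrite normsq_hardy_quot (le_lt_trans h) ?ltry.
by split=> //; rewrite -lee_fin -L2_normsqE// normsq_hardy_quot.
Qed.

Let b x := enorm (B1 x) + enorm (B2 x).

Let menorm_comp (B : R3 R -> R3 R) : measurable_fun setT B ->
  measurable_fun setT (fun x => enorm (B x)).
Proof. by move=> mB; exact: measurableT_comp (@measurable_enorm R) mB. Qed.

(** Off the origin |B1| <= C0 / |x|^2, so the integral of |B1| |f|^2 is controlled by f / |x|; the
    Hardy inequality for test spinors makes it finite. *)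
Lemma field_density f : Cc_infty_spinor f ->
  intg (fun x => b x * sqn (f x)) /\
  \int[mu]_x (b x * sqn (f x)) <= C0 * nrm2 (hardy_quot f) + N * nrm2 f.
Proof.
move=> cf; have Lf := Cc_L2 cf; have [Lh _] := hardy_Cc cf.
have mb : measurable_fun setT (fun x => b x * sqn (f x)).
  apply: measurable_funM; last by apply: measurable_sqn; exact: L2_spinor_mfun.
  by apply: measurable_funD; exact: menorm_comp.
have b0 x : 0 <= b x * sqn (f x) by rewrite mulr_ge0 ?addr_ge0 ?enorm_ge0 ?sqn_ge0.
have i1 := integrableZ2D C0 N (L2_sqn Lh) (L2_sqn Lf).
have h : (\int[mu]_x (b x * sqn (f x))%:E <=
    \int[mu]_x (C0 * sqn (hardy_quot f x) + N * sqn (f x))%:E)%E.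
  apply: ae_ge0_le_integral => //.
  - by move=> x _; rewrite lee_fin.
  - by apply/measurable_EFinP; exact: mb.
  - by move=> x _; rewrite lee_fin addr_ge0// mulr_ge0 ?sqn_ge0.
  - by have /integrableP[] := i1.
  - have nz : {ae mu, forall x, x != 0} by apply: ae_not0.
    have FF : Filter (almost_everywhere mu) by exact: ae_filter_ringOfSetsType.
    apply: filterS (filterI hB1 (filterI hB2 nz)) => x [h1 [h2 x0]] _; rewrite lee_fin mulrDl.
    apply: lerD; last by rewrite ler_wpM2r ?sqn_ge0.
    rewrite sqn_hardy_quot mulrA mulrAC ler_wpM2r ?sqn_ge0// ler_pdivlMr 1?mulrC//.
    by rewrite exprn_gt0// enorm_gt0.
have ib : intg (fun x => b x * sqn (f x)).
  apply/integrableP; split; first by apply/measurable_EFinP; exact: mb.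
  under eq_integral do rewrite /= ger0_norm//.
  by apply: le_lt_trans h _; exact: (integrable_lty measurableT i1).
split=> //; rewrite -!RintegralZl//; [|exact: L2_sqn..].
rewrite -RintegralD//; [|exact: intgZ (L2_sqn _)..].
by apply: fine_le => //; exact: integrable_fin_num.
Qed.

Let crd_b l x : `|crd (B1 x + B2 x) l| <= b x.
Proof.
have -> : crd (B1 x + B2 x) l = crd (B1 x) l + crd (B2 x) l.
  by case: l => -[|[|[|//]]].
by rewrite (le_trans (ler_normD _ _))// lerD// crd_le_enorm.
Qed.

(** Up to a null function, |Hf|^2 - m^2 |f|^2 is the square of the massless operator applied to
    f. *)
Theorem dirac_mass_le f : Cc_infty_spinor f -> m ^+ 2 * nrm2 f <= nrm2 (Defs.dirac m A f).
Proof.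
move=> cf; have Lf := Cc_L2 cf; have Ld := LH cf.
have [ni n0] := null_dirac_mass m lA cf.
have i1 := L2_sqn Ld; have i2 := intgZ (m ^+ 2) (L2_sqn Lf).
have <- : \int[mu]_x (m ^+ 2 * sqn (f x)) = m ^+ 2 * nrm2 f.
  by rewrite RintegralZl//; exact: L2_sqn.
have i3 := intgD i2 ni.
(* Adding a null function to the integrand makes the two sides comparable pointwise. *)
have -> : \int[mu]_x (m ^+ 2 * sqn (f x)) = \int[mu]_x (m ^+ 2 * sqn (f x) +
    (sqn (dirac_vec m (fun k => cdv A k f x) (f x)) - m ^+ 2 * sqn (f x)
    - sqn (dirac_vec 0 (fun k => cdv A k f x) (f x)))).
  by rewrite RintegralD// n0 addr0.
apply: le_Rintegral => // x _; rewrite dirac_vecE.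
have := sqn_ge0 (dirac_vec 0 (fun k => cdv A k f x) (f x)).
move: (sqn (dirac_vec 0 _ _)) (sqn (dirac_vec m _ _)) (m ^+ 2 * _) => p q r; lra.
Qed.

(** The Hardy term is not absorbed here, so the inequality holds for every C0 and serves also when
    C0 >= 1/4. *)
Theorem dirac_energy_le f : Cc_infty_spinor f ->
  m ^+ 2 * nrm2 f + \sum_k nrm2 (cdv A k f) <=
  nrm2 (Defs.dirac m A f) + (C0 * nrm2 (hardy_quot f) + N * nrm2 f).
Proof.
move=> cf; have Lf := Cc_L2 cf; have Lc k := L2_cdv k lA cf; have Lh := LH cf.
have [ib leb] := field_density cf.
have mB l : measurable_fun setT (fun x => crd (B1 x + B2 x) l).
  apply: (measurableT_comp (measurable_crd l)).
  rewrite (_ : (fun x => B1 x + B2 x) = fun x => ((crd (B1 x) k0 + crd (B2 x) k0,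
     crd (B1 x) k1 + crd (B2 x) k1), crd (B1 x) k2 + crd (B2 x) k2)) //.
  have mc k (B : R3 R -> R3 R) : measurable_fun setT B ->
      measurable_fun setT (fun x => crd (B x) k).
    by move=> mmB; exact: measurableT_comp (measurable_crd k) mmB.
  by apply: measurable_fun_pair; [apply: measurable_fun_pair|];
    apply: measurable_funD; exact: mc.
have n1 := null_dirac_mass m lA cf.
have n2 := null_dirac_curl lA cAB mB crd_b ib cf.
have [ni n0] := nullD n1 n2.
have ic : intg (fun x => m ^+ 2 * sqn (f x) + \sum_k sqn (cdv A k f x)).
  apply: intgD; first exact: intgZ (L2_sqn Lf).
  under eq_fun do rewrite sum3.
  exact: intgD (intgD (L2_sqn (Lc k0)) (L2_sqn (Lc k1))) (L2_sqn (Lc k2)).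
have <- : \int[mu]_x (m ^+ 2 * sqn (f x) + \sum_k sqn (cdv A k f x)) =
    m ^+ 2 * nrm2 f + \sum_k nrm2 (cdv A k f).
  rewrite RintegralD//; [|exact: intgZ (L2_sqn Lf)|].
    rewrite RintegralZl//; last exact: L2_sqn.
    congr (_ + _); rewrite sum3; under eq_Rintegral do rewrite sum3.
    rewrite (RintegralD measurableT (intgD (L2_sqn (Lc k0)) (L2_sqn (Lc k1))) (L2_sqn (Lc k2))).
    by rewrite (RintegralD measurableT (L2_sqn (Lc k0)) (L2_sqn (Lc k1))).
  under eq_fun do rewrite sum3.
  exact: intgD (intgD (L2_sqn (Lc k0)) (L2_sqn (Lc k1))) (L2_sqn (Lc k2)).
apply: (@le_trans _ _ (nrm2 (Defs.dirac m A f) + \int[mu]_x (b x * sqn (f x)))); last first.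
  by rewrite lerD2l.
rewrite -RintegralD//; [|exact: (L2_sqn Lh)].
have -> : \int[mu]_x (m ^+ 2 * sqn (f x) + \sum_k sqn (cdv A k f x)) =
    \int[mu]_x ((m ^+ 2 * sqn (f x) + \sum_k sqn (cdv A k f x)) +
     ((sqn (dirac_vec m (fun k => cdv A k f x) (f x)) - m ^+ 2 * sqn (f x)
    - sqn (dirac_vec 0 (fun k => cdv A k f x) (f x))) +
    (sqn (dirac_vec 0 (fun k => cdv A k f x) (f x))
    - \sum_k sqn (cdv A k f x) + \sum_l crd (B1 x + B2 x) l * spin_density l (f x)))).
  by rewrite [RHS]RintegralD// n0 addr0.
apply: le_Rintegral => //; [exact: intgD|exact: intgD (L2_sqn Lh) ib|].
move=> x _; rewrite dirac_vecE.
have : \sum_l crd (B1 x + B2 x) l * spin_density l (f x) <= b x * sqn (f x).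
  have -> : \sum_l crd (B1 x + B2 x) l * spin_density l (f x) =
      \sum_l crd (B1 x) l * spin_density l (f x) + \sum_l crd (B2 x) l * spin_density l (f x).
    rewrite -big_split; apply: eq_bigr => l _ /=; rewrite -mulrDl; congr (_ * _).
    by case: l => -[|[|[|//]]].
  rewrite mulrDl lerD// (le_trans (ler_norm _))// spin_density_le//.
move: (\sum_k sqn _) (\sum_l _) (sqn (dirac_vec m _ _)) (sqn (dirac_vec 0 _ _)) (m ^+ 2 * _) (b x * _).
by move=> p q r s t u; lra.
Qed.

End EnergyInequality.

(** * The domain of the Dirac operator *)

Section Approximation.
Variable R : realType.
Implicit Types (f g : R3 R -> spinor R) (G Y : nat -> R3 R -> spinor R).

Lemma le_nrm2 f g c : spinor_mfun f -> L2 g -> (forall x, sqn (f x) <= c * sqn (g x)) ->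
  L2 f /\ nrm2 f <= c * nrm2 g.
Proof.
move=> mf Lg fg; have Lf : L2 f by apply: (le_L2 mf fg); exact: intgZ (L2_sqn Lg).
split=> //; rewrite -RintegralZl//; last exact: L2_sqn.
by apply: le_Rintegral => //; [exact: L2_sqn|exact: intgZ (L2_sqn Lg)].
Qed.

Lemma cvL2_diag G Y g : (forall j, L2 (G j)) -> (forall j, L2 (Y j)) -> L2 g ->
  (forall j, nrm2 (fun x => G j x - Y j x) <= j.+1%:R^-1) -> cvL2 Y g -> cvL2 G g.
Proof.
move=> LG LY Lg GY Yg.
apply: (@cvL2_squeeze _ _ _ (fun j => 2 * j.+1%:R^-1 + 2 * nrm2 (fun x => Y j x - g x))).
  move=> j.
  have -> : (fun x => G j x - g x) = (fun x => (G j x - Y j x) + (Y j x - g x)).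
    by apply/funext => x; rewrite addrA subrK.
  apply: le_trans (nrm2_le2 (L2B (LG j) (LY j)) (L2B (LY j) Lg)) _.
  by rewrite lerD2r ler_pM2l.
have <- : 2 * 0 + 2 * 0 = 0 :> R by rewrite !mulr0 addr0.
exact: cvgD (cvgM (cvg_cst _) (@cvg_harmonic R)) (cvgM (cvg_cst _) Yg).
Qed.

(** One index has to serve three convergences: of the spinors, of their images under H and of their
    quotients by |x|. *)
Lemma diagonal3 (u v w : nat -> nat -> R) :
  (forall j, u j n @[n --> \oo] --> (0 : R)) -> (forall j, v j n @[n --> \oo] --> (0 : R)) ->
  (forall j, w j n @[n --> \oo] --> (0 : R)) ->
  exists s : nat -> nat, forall j,
    [/\ u j (s j) <= j.+1%:R^-1, v j (s j) <= j.+1%:R^-1 & w j (s j) <= j.+1%:R^-1].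
Proof.
move=> hu hv hw; suff /choice[s hs] : forall j, exists n,
    [/\ u j n <= j.+1%:R^-1, v j n <= j.+1%:R^-1 & w j n <= j.+1%:R^-1] by exists s.
move=> j.
have e0 : 0 < j.+1%:R^-1 :> R by rewrite invr_gt0.
have small (t : nat -> R) : t n @[n --> \oo] --> (0 : R) ->
    exists N, forall n, (N <= n)%N -> t n <= j.+1%:R^-1.
  move=> /cvgr0Pnorm_le/(_ _ e0)[N _ HN]; exists N => n Nn.
  exact: le_trans (ler_norm _) (HN n Nn).
have [Nu Hu] := small _ (hu j); have [Nv Hv] := small _ (hv j); have [Nw Hw] := small _ (hw j).
exists (Nu + Nv + Nw)%N; split; [apply: Hu|apply: Hv|apply: Hw].
- by rewrite -addnA leq_addr.
- by rewrite addnAC leq_addl.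
- by rewrite leq_addl.
Qed.

Lemma cvg_le_bound (s t : nat -> R) (l : R) : (forall n, s n <= t n) -> t n @[n --> \oo] --> l ->
  exists C, forall n, s n <= C.
Proof.
move=> st tl; have /cvg_seq_bounded[C [_ /(_ (C + 1))]] : cvgn t by apply/cvg_ex; exists l.
rewrite ltrDl ltr01 => /(_ isT) hC; exists (C + 1) => n.
by apply: le_trans (st n) _; apply: le_trans (ler_norm _) _; exact: hC.
Qed.

Lemma cutoff_sub1_le eta (x : R3 R) : 0 < eta -> `|cutoff eta x - 1| <= 1.
Proof.
by move=> eta0; have /andP[? ?] := cutoff_itv eta0 x; rewrite ler_norml; apply/andP; split; lra.
Qed.

Lemma cvg_cutoff (x : R3 R) : x != 0 -> cutoff n.+1%:R^-1 x - 1 @[n --> \oo] --> (0 : R).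
Proof.
move=> /enorm_gt0 x0; have s0 : edot x x != 0 by rewrite -enorm_sqr gt_eqF// exprn_gt0.
have h : edot x x + n.+1%:R^-1 @[n --> \oo] --> edot x x + 0.
  by apply: cvgD; [exact: cvg_cst|exact: cvg_harmonic].
have <- : edot x x / (edot x x + 0) - 1 = 0 by rewrite addr0 divff ?subrr.
apply: cvgB; last exact: cvg_cst.
by apply: cvgM; [exact: cvg_cst|apply: cvgV => //; rewrite addr0].
Qed.

(* [|x| |grad (cutoff eta)| = 2 |x|^2 eta / (|x|^2 + eta)^2] *)
Definition grad_weight eta (x : R3 R) := 2 * (edot x x / regsq eta x) * (eta / regsq eta x).

Lemma smooth_grad_weight eta : 0 < eta -> smooth (grad_weight eta).
Proof.
move=> eta0; have sV : smooth (fun x : R3 R => (regsq eta x)^-1).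
  by apply: smoothV; [exact: smooth_regsq|exact: regsq_neq0].
do 2 (apply: smoothM; last by apply: smoothM => //; try exact: smooth_cst; exact: smooth_edot).
exact: smooth_cst.
Qed.

Lemma grad_weight_le eta x : 0 < eta -> `|grad_weight eta x| <= 2.
Proof.
move=> eta0; have q0 := regsq_gt0 eta0 x.
have /andP[a0 a1] := frac_itv eta0 (x := x) (edot_ge0 x) (ler_wpDr (ltW eta0) (lexx _)).
have /andP[c0 c1] := frac_itv eta0 (x := x) (ltW eta0) (ler_wpDl (edot_ge0 x) (lexx _)).
rewrite /grad_weight; move: (edot x x / _) (eta / _) a0 a1 c0 c1 => p q *.
by rewrite ger0_norm ?mulr_ge0//; nra.
Qed.

Lemma cvg_grad_weight (x : R3 R) : x != 0 -> grad_weight n.+1%:R^-1 x @[n --> \oo] --> (0 : R).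
Proof.
move=> /enorm_gt0 x0; have s0 : edot x x != 0 by rewrite -enorm_sqr gt_eqF// exprn_gt0.
have h : edot x x + n.+1%:R^-1 @[n --> \oo] --> edot x x + 0.
  by apply: cvgD; [exact: cvg_cst|exact: cvg_harmonic].
have hV : (edot x x + n.+1%:R^-1)^-1 @[n --> \oo] --> (edot x x + 0)^-1.
  by apply: cvgV => //; rewrite addr0.
have <- : 2 * (edot x x / (edot x x + 0)) * (0 / (edot x x + 0)) = 0 by rewrite mul0r mulr0.
apply: cvgM; last by apply: cvgM => //; exact: cvg_harmonic.
by apply: cvgM; [exact: cvg_cst|apply: cvgM => //; exact: cvg_cst].
Qed.

Lemma sum_partial_cutoff_sqr eta (x : R3 R) : 0 < eta ->
  \sum_k partial k (cutoff eta) x ^+ 2 = 4 * edot x x * eta ^+ 2 / regsq eta x ^+ 4.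
Proof.
move=> eta0; have q0 := regsq_neq0 eta0 x.
rewrite edotE sum3 !partial_cutoff//.
move: (crd x k0) (crd x k1) (crd x k2) (regsq eta x) q0 => p q r t t0.
by field.
Qed.

(** Writes the commutator of H with the cutoff in terms of f / |x|, with a weight bounded uniformly
    in eta that tends to 0 off the origin; dominated convergence then applies. *)
Lemma sqn_clifford_cutoff eta f x : 0 < eta ->
  sqn (clifford (fun k => partial k (cutoff eta) x) (f x)) =
  sqn (rscal (grad_weight eta x) (hardy_quot f x)).
Proof.
move=> eta0; have q0 := regsq_neq0 eta0 x.
rewrite sqn_clifford sqnZ sqn_hardy_quot sum_partial_cutoff_sqr// enorm_sqr /grad_weight.
have [->|s0] := eqVneq (edot x x) 0.
  by rewrite mulr0 !mul0r mulr0 mul0r expr0n !mul0r.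
by move: (sqn (f x)) (edot x x) (regsq eta x) s0 q0 => p q r q0 r0; field; rewrite q0 r0.
Qed.

(** For fixed eta the commutator is bounded on L^2, without f / |x| in L^2. The factor 3 counts the
    partial derivatives. *)
Lemma sqn_clifford_cutoff_le eta (v : spinor R) x : 0 < eta ->
  sqn (clifford (fun k => partial k (cutoff eta) x) v) <= 3 * (2 * (1 + eta^-1)) ^+ 2 * sqn v.
Proof.
move=> eta0; rewrite sqn_clifford ler_wpM2r ?sqn_ge0//.
have le k : partial k (cutoff eta) x ^+ 2 <= (2 * (1 + eta^-1)) ^+ 2.
  rewrite -real_normK ?num_real// lerXn2r ?nnegrE ?partial_cutoff_le//.
  by apply: le_trans (partial_cutoff_le eta0 k x).
have arith (p q r c : R) : p <= c -> q <= c -> r <= c -> p + q + r <= 3 * c by move=> *; lra.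
by rewrite sum3; apply: arith; exact: le.
Qed.

Lemma spinor_mfun_clifford_cutoff eta f : 0 < eta -> spinor_mfun f ->
  spinor_mfun (fun x => clifford (fun k => partial k (cutoff eta) x) (f x)).
Proof.
move=> eta0 mf; apply: (spinor_mfun_clifford (c := fun x k => partial k (cutoff eta) x)) => // k.
by apply: smooth_measurable; apply: smooth_partial; exact: smooth_cutoff.
Qed.

(** The cutoff vanishes to second order at the origin, so after it division by |x| is bounded on
    L^2. *)
Lemma hardy_quot_cutoff_le eta (x : R3 R) : 0 < eta -> `|(enorm x)^-1 * cutoff eta x| <= 1 + eta^-1.
Proof.
move=> eta0; have q0 := regsq_gt0 eta0 x.
have [e0|e0] := eqVneq (enorm x) 0.
  by rewrite e0 invr0 mul0r normr0 addr_ge0// invr_ge0 ltW.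
have -> : (enorm x)^-1 * cutoff eta x = enorm x / regsq eta x.
  by rewrite /cutoff -enorm_sqr expr2 -mulrA mulKf.
rewrite ger0_norm; last by rewrite divr_ge0 ?enorm_ge0// ltW.
rewrite ler_pdivrMr//.
have -> : (1 + eta^-1) * regsq eta x = edot x x + eta + eta^-1 * edot x x + 1.
  by rewrite /regsq; move: (edot x x) => t; field; rewrite gt_eqF.
have : 0 <= eta^-1 * edot x x by rewrite mulr_ge0 ?edot_ge0// invr_ge0 ltW.
have := enorm_sqr x; have := enorm_ge0 x.
move: (eta^-1 * edot x x) (edot x x) (enorm x) => p q r *; nra.
Qed.

Lemma hardy_quot_scal (a : R3 R -> R) f x :
  hardy_quot (fun y => rscal (a y) (f y)) x = rscal ((enorm x)^-1 * a x) (f x).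
Proof. by apply: spinorP => j; rewrite !cptE mulrA. Qed.

End Approximation.

Section DiracDomain.
Variables (R : realType) (m : R) (A B1 B2 : R3 R -> R3 R) (C0 N : R).
Local Notation mu := (leb3 R).
Local Notation H := (Defs.dirac m A).
Hypothesis lA : locL2 A.
Hypothesis LH : forall f, Cc_infty_spinor f -> L2 (H f).
Hypothesis cAB : weak_curl A (fun x => B1 x + B2 x).
Hypotheses (mB1 : measurable_fun setT B1) (mB2 : measurable_fun setT B2).
Hypothesis hB1 : {ae mu, forall x, enorm x ^+ 2 * enorm (B1 x) <= C0}.
Hypothesis hB2 : {ae mu, forall x, enorm (B2 x) <= N}.
Hypotheses (C00 : 0 <= C0) (N0 : 0 <= N).
Variables (f Hf : R3 R -> spinor R) (F : nat -> R3 R -> spinor R).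
Hypotheses (Lf : L2 f) (LHf : L2 Hf) (cF : forall n, Cc_infty_spinor (F n)).
Hypotheses (Ff : cvL2 F f) (HFf : cvL2 (fun n => H (F n)) Hf).

Let LF n : L2 (F n) := Cc_L2 (cF n).
Let LHF n : L2 (H (F n)) := LH (cF n).
Let energy_le g (cg : Cc_infty_spinor g) := dirac_energy_le lA LH cAB mB1 mB2 hB1 hB2 C00 N0 cg.

Lemma dirac_dom_mass_le : m ^+ 2 * nrm2 f <= nrm2 Hf.
Proof.
have h1 : m ^+ 2 * nrm2 (F n) @[n --> \oo] --> m ^+ 2 * nrm2 f.
  by apply: cvgM; [exact: cvg_cst|exact: cvL2_nrm2].
have h2 := cvL2_nrm2 LHF LHf HFf.
by apply: (ler_cvg_to h1 h2); apply: nearW => n; exact: dirac_mass_le.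
Qed.

(** With J the square norm of the Hardy quotient of F_n, the Hardy and energy inequalities give (1 -
    4 C0) J <= 4 (|H F_n|^2 + N |F_n|^2), a bound uniform in n. *)
Lemma dirac_dom_hardy_quot : C0 < 4^-1 -> L2 (hardy_quot f).
Proof.
move=> C04; pose c := 4 / (1 - 4 * C0).
have C1 : 0 < 1 - 4 * C0 by lra.
have hF n : nrm2 (hardy_quot (F n)) <= c * (nrm2 (H (F n)) + N * nrm2 (F n)).
  have [_ h1] := hardy_Cc lA (cF n); have h2 := energy_le (cF n).
  have h3 : 0 <= m ^+ 2 * nrm2 (F n) by rewrite mulr_ge0 ?sqr_ge0 ?nrm2_ge0.
  rewrite /c mulrAC ler_pdivlMr//.
  move: (nrm2 (hardy_quot _)) (\sum_k _) (nrm2 (H _)) (N * _) (m ^+ 2 * _) h1 h2 h3.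
  by move=> p q r s t; lra.
pose B := c * (nrm2 Hf + N * nrm2 f).
have hB : c * (nrm2 (H (F n)) + N * nrm2 (F n)) @[n --> \oo] --> B.
  apply: cvgM; first exact: cvg_cst.
  apply: cvgD; first exact: cvL2_nrm2.
  by apply: cvgM; [exact: cvg_cst|exact: cvL2_nrm2].
split; first by apply: spinor_mfun_hardy_quot; exact: L2_spinor_mfun.
rewrite normsq_hardy_quot; apply: le_lt_trans (ltry B); apply: hardy_fatou; first exact: L2_spinor_mfun.
(* The square root of [hardy_weight]: a bounded multiplier, through which convergence in L^2 passes
   to the limit, and one dominated by 1 / |x|. *)
move=> eta eta0; pose a x := enorm x * ((edot x x) / regsq eta x * (regsq eta x)^-1).
have wE x : hardy_weight eta x = a x ^+ 2.
  rewrite /hardy_weight /a -enorm_sqr; move: (regsq_neq0 eta0 x).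
  by move: (enorm x) (regsq eta x) => p q q0; field.
have sa : smooth (fun x : R3 R => edot x x / regsq eta x * (regsq eta x)^-1).
  apply: smoothM; first exact: smooth_cutoff.
  by apply: smoothV; [exact: smooth_regsq|exact: regsq_neq0].
have ma : measurable_fun setT a.
  by apply: measurable_funM; [exact: measurable_enorm|exact: smooth_measurable].
have aC x : `|a x| <= 1 + eta^-1.
  have -> : a x = (enorm x)^-1 * cutoff eta x * cutoff eta x.
    rewrite /a /cutoff -enorm_sqr; have q0 := regsq_neq0 eta0 x.
    have [->|e0] := eqVneq (enorm x) 0; first by rewrite invr0 !mul0r.
    by move: (enorm x) (regsq eta x) e0 q0 => p q p0 q0; field; rewrite p0 q0.
  by rewrite normrM -[leRHS]mulr1 ler_pM// ?hardy_quot_cutoff_le// cutoff_le1.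
have aE x : a x <= (enorm x)^-1.
  have -> : a x = (enorm x)^-1 * (cutoff eta x * cutoff eta x).
    rewrite /a /cutoff -enorm_sqr; have q0 := regsq_neq0 eta0 x.
    have [->|e0] := eqVneq (enorm x) 0; first by rewrite invr0 !mul0r.
    by move: (enorm x) (regsq eta x) e0 q0 => p q p0 q0; field; rewrite p0 q0.
  rewrite -[leRHS]mulr1 ler_wpM2l ?invr_ge0 ?enorm_ge0//.
  by have /andP[? ?] := cutoff_itv eta0 x; rewrite mulr_ile1.
have a0 x : 0 <= a x.
  have q0 := regsq_gt0 eta0 x.
  by rewrite mulr_ge0 ?enorm_ge0// mulr_ge0 ?divr_ge0 ?edot_ge0 ?invr_ge0// ltW.
have Laf := L2Z ma aC Lf.
have -> : (\int[mu]_x (hardy_weight eta x * sqn (f x))%:E)%E =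
    L2_normsq (fun x => rscal (a x) (f x)).
  by apply: eq_integral => x _; rewrite wE sqnZ.
rewrite L2_normsqE// lee_fin.
have h1 := cvL2_nrm2 (fun n => L2Z ma aC (LF n)) Laf (cvL2Z ma aC LF Lf Ff).
apply: (ler_cvg_to h1 hB); apply: nearW => n; apply: le_trans (hF n).
have [Lh _] := hardy_Cc lA (cF n).
have [||_ h] := @le_nrm2 _ (fun x => rscal (a x) (F n x)) (hardy_quot (F n)) 1 _ Lh.
- by apply: spinor_mfunZ => //; exact: L2_spinor_mfun.
- move=> x; rewrite mul1r !sqnZ ler_wpM2r ?sqn_ge0// lerXn2r ?nnegrE ?invr_ge0 ?enorm_ge0//.
- by rewrite mul1r in h.
Qed.

Section Cutoff.
Variable eta : R.
Hypothesis eta0 : 0 < eta.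

Definition cut (g : R3 R -> spinor R) x := rscal (cutoff eta x) (g x).

Let mcut := smooth_measurable (smooth_cutoff (R := R) eta0).

Lemma L2_cut g : L2 g -> L2 (cut g).
Proof. exact: (L2Z mcut (cutoff_le1 eta0)). Qed.

Definition cutgrad (g : R3 R -> spinor R) x := clifford (fun k => partial k (cutoff eta) x) (g x).

Lemma L2_cutgrad g : L2 g -> L2 (cutgrad g).
Proof.
move=> Lg; have := le_nrm2 (spinor_mfun_clifford_cutoff eta0 (L2_spinor_mfun Lg)) Lg
  (fun x => sqn_clifford_cutoff_le (g x) x eta0).
by case.
Qed.

Lemma Cc_cut g : Cc_infty_spinor g -> Cc_infty_spinor (cut g).
Proof. by apply: Cc_spinor_scal; exact: smooth_cutoff. Qed.

Lemma cvL2_cut : cvL2 (fun n => cut (F n)) (cut f).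
Proof. exact: (cvL2Z mcut (cutoff_le1 eta0) LF Lf Ff). Qed.

Lemma dirac_cutE n : H (cut (F n)) = fun x => cut (H (F n)) x + cutgrad (F n) x.
Proof. by apply/funext => x; rewrite dirac_scal//; exact: smooth_cutoff. Qed.

Lemma cvL2_dirac_cut : cvL2 (fun n => H (cut (F n))) (fun x => cut Hf x + cutgrad f x).
Proof.
have -> : (fun n => H (cut (F n))) = fun n x => cut (H (F n)) x + cutgrad (F n) x.
  by apply/funext => n; exact: dirac_cutE.
have Lg n := L2_cutgrad (LF n).
have LcH n := L2_cut (LHF n).
apply: (cvL2D LcH Lg (L2_cut LHf) (L2_cutgrad Lf)).
  exact: (cvL2Z mcut (cutoff_le1 eta0) LHF LHf HFf).
apply: (@cvL2_squeeze _ _ _ (fun n => 3 * (2 * (1 + eta^-1)) ^+ 2 * nrm2 (fun x => F n x - f x))).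
  move=> n; have LB := L2B (LF n) Lf.
  have -> : (fun x => cutgrad (F n) x - cutgrad f x) = cutgrad (fun x => F n x - f x).
    by apply/funext => x; rewrite /cutgrad cliffordB.
  by have [_] := le_nrm2 (spinor_mfun_clifford_cutoff eta0 (L2_spinor_mfun LB)) LB
    (fun x => sqn_clifford_cutoff_le _ x eta0).
by rewrite -(mulr0 (3 * (2 * (1 + eta^-1)) ^+ 2)); apply: cvgM => //; exact: cvg_cst.
Qed.

Let mhcut : measurable_fun setT (fun x : R3 R => (enorm x)^-1 * cutoff eta x).
Proof. by apply: measurable_funM => //; exact: measurable_enormV. Qed.

Let hardy_quot_cutE g : hardy_quot (cut g) = fun x => rscal ((enorm x)^-1 * cutoff eta x) (g x).
Proof. by apply/funext => x; exact: hardy_quot_scal. Qed.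

Lemma L2_hardy_quot_cut g : L2 g -> L2 (hardy_quot (cut g)).
Proof.
by move=> Lg; rewrite hardy_quot_cutE; apply: (L2Z mhcut (fun x => hardy_quot_cutoff_le x eta0) Lg).
Qed.

Lemma cvL2_hardy_quot_cut : cvL2 (fun n => hardy_quot (cut (F n))) (hardy_quot (cut f)).
Proof.
rewrite hardy_quot_cutE (_ : (fun n => _) =
  fun n x => rscal ((enorm x)^-1 * cutoff eta x) (F n x)).
  exact: (cvL2Z mhcut (fun x => hardy_quot_cutoff_le x eta0) LF Lf Ff).
by apply/funext => n; exact: hardy_quot_cutE.
Qed.

(** In the energy inequality for the cut-off F_n every term on the right converges for fixed eta,
    whatever C0 is. The product rule then exchanges the gradient of the cut-off spinor for the
    cut-off gradient. *)
Lemma cut_cdv_bounded k : exists C,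
  forall n, nrm2 (fun x => rscal (cutoff eta x) (cdv A k (F n) x)) <= C.
Proof.
pose c := 2 * (1 + eta^-1).
have mp : measurable_fun setT (partial k (cutoff eta)).
  by apply: smooth_measurable; apply: smooth_partial; exact: smooth_cutoff.
apply: (@cvg_le_bound _ _ (fun n => 2 * (nrm2 (H (cut (F n))) +
    (C0 * nrm2 (hardy_quot (cut (F n))) + N * nrm2 (cut (F n)))) + 2 * (c ^+ 2 * nrm2 (F n)))
   (2 * (nrm2 (fun x => cut Hf x + cutgrad f x) + (C0 * nrm2 (hardy_quot (cut f)) + N * nrm2 (cut f)))
    + 2 * (c ^+ 2 * nrm2 f))).
  move=> n; have cn := Cc_cut (cF n); have Lc := L2_cdv k lA cn.
  have pc := partial_cutoff_le eta0 k.
  have Lp := L2Z mp pc (LF n).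
  have -> : (fun x => rscal (cutoff eta x) (cdv A k (F n) x)) = fun x =>
      cdv A k (cut (F n)) x - rscal (partial k (cutoff eta) x) (F n x).
    by apply/funext => x; rewrite cdv_scal//; [rewrite [RHS]addrAC subrr add0r|exact: smooth_cutoff].
  apply: le_trans (nrm2_le2 Lc (L2N Lp)) _.
  have -> : nrm2 (fun x => - rscal (partial k (cutoff eta) x) (F n x)) =
      nrm2 (fun x => rscal (partial k (cutoff eta) x) (F n x)).
    by apply: eq_Rintegral => x _; rewrite sqnN.
  apply: lerD; rewrite ler_pM2l//; last exact: nrm2Z_le.
  apply: le_trans (energy_le cn); rewrite (bigD1 k)//= addrCA lerDl.
  rewrite addr_ge0//; first by rewrite mulr_ge0 ?sqr_ge0 ?nrm2_ge0.
  by apply: sumr_ge0 => i _; exact: nrm2_ge0.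
have lim (p q r s : nat -> R) (p' q' r' s' : R) : p n @[n --> \oo] --> p' ->
    q n @[n --> \oo] --> q' -> r n @[n --> \oo] --> r' -> s n @[n --> \oo] --> s' ->
    2 * (p n + (C0 * q n + N * r n)) + 2 * (c ^+ 2 * s n) @[n --> \oo] -->
    2 * (p' + (C0 * q' + N * r')) + 2 * (c ^+ 2 * s').
  move=> hp hq hr hs; exact: (cvgD (cvgM (cvg_cst _) (cvgD hp (cvgD (cvgM (cvg_cst _) hq)
    (cvgM (cvg_cst _) hr)))) (cvgM (cvg_cst _) (cvgM (cvg_cst _) hs))).
have h1 := cvL2_nrm2 (fun n => LH (Cc_cut (cF n))) (L2D (L2_cut LHf) (L2_cutgrad Lf))
  cvL2_dirac_cut.
have h2 := cvL2_nrm2 (fun n => L2_hardy_quot_cut (LF n)) (L2_hardy_quot_cut Lf) cvL2_hardy_quot_cut.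
have h3 := cvL2_nrm2 (fun n => L2_cut (LF n)) (L2_cut Lf) cvL2_cut.
exact: lim h1 h2 h3 (cvL2_nrm2 LF Lf Ff).
Qed.

End Cutoff.

Theorem dirac_dom_hardy (g : 'I_3 -> R3 R -> spinor R) : (forall k, weak_cdv A k f (g k)) ->
  (\int[mu]_x (sqn (f x) / enorm x ^+ 2)%:E <= (4 * \sum_k nrm2 (g k))%:E)%E.
Proof. by move=> wg; apply: (hardy lA Lf wg cF Ff) => eta eta0 k; exact: cut_cdv_bounded. Qed.

Let eta j : R := j.+1%:R^-1.
Let eta_gt0 j : 0 < eta j. Proof. by rewrite invr_gt0. Qed.

Let cut_tends g : L2 g -> cvL2 (fun j => cut (eta j) g) g.
Proof.
move=> Lg; have sub j x : cut (eta j) g x - g x = rscal (cutoff (eta j) x - 1) (g x).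
  by apply: spinorP => i; rewrite !cptE mulrBl mul1r.
rewrite /cvL2; under eq_fun => j do under [nrm2 _]eq_Rintegral do rewrite sub.
apply: (@dominated_nrm2 _ (fun j x => cutoff (eta j) x - 1) 1) => //.
- move=> j; apply: smooth_measurable; apply: smoothB; last exact: smooth_cst.
  exact: smooth_cutoff.
- by move=> j x; exact: cutoff_sub1_le.
- by move=> x; exact: cvg_cutoff.
Qed.

Let cutgrad_tends : L2 (hardy_quot f) -> cvL2 (fun j => cutgrad (eta j) f) (fun=> 0).
Proof.
move=> Lh; rewrite /cvL2.
under eq_fun => j do under [nrm2 _]eq_Rintegral do rewrite subr0 sqn_clifford_cutoff//.
apply: (@dominated_nrm2 _ (fun j x => grad_weight (eta j) x) 2) => //.
- by move=> j; apply: smooth_measurable; exact: smooth_grad_weight.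
- by move=> j x; exact: grad_weight_le.
- by move=> x; exact: cvg_grad_weight.
Qed.

Let L2_0 : L2 (fun=> 0 : spinor R).
Proof. by have := L2B Lf Lf; under eq_fun do rewrite subrr. Qed.

(** For each [eta j] the cut-off sequence converges in all three norms, and its index [s j] is
    chosen after [eta j]. The limits f, Hf and f / |x| are then recovered as [eta j] tends to 0. *)
Lemma dirac_dom_approx : L2 (hardy_quot f) ->
  exists G : nat -> R3 R -> spinor R, [/\ forall j, Cc_infty_spinor (G j), cvL2 G f,
    cvL2 (fun j => H (G j)) Hf & cvL2 (fun j => hardy_quot (G j)) (hardy_quot f)].
Proof.
move=> Lh.
have [s hs] := diagonal3 (fun j => cvL2_cut (eta_gt0 j)) (fun j => cvL2_dirac_cut (eta_gt0 j))
  (fun j => cvL2_hardy_quot_cut (eta_gt0 j)).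
pose G j := cut (eta j) (F (s j)).
have cG j : Cc_infty_spinor (G j) by exact: (Cc_cut (eta_gt0 j)).
have LG j := Cc_L2 (cG j); have LHG j := LH (cG j).
have [LhG _] := all_and2 (fun j => hardy_Cc lA (cG j)).
have Lc j := L2_cut (eta_gt0 j) Lf; have LcH j := L2_cut (eta_gt0 j) LHf.
have Lg j := L2_cutgrad (eta_gt0 j) Lf.
exists G; split; first exact: cG.
- apply: (cvL2_diag LG Lc Lf) (cut_tends Lf) => j.
  by have [h _ _] := hs j; exact: h.
- apply: (cvL2_diag LHG (fun j => L2D (LcH j) (Lg j)) LHf) => [j|].
    by have [_ h _] := hs j; exact: h.
  have := cvL2D LcH Lg LHf L2_0 (cut_tends LHf) (cutgrad_tends Lh).
  by under [X in cvL2 _ X]eq_fun do rewrite addr0.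
- apply: (cvL2_diag LhG (fun j => L2_hardy_quot_cut (eta_gt0 j) Lf) Lh) => [j|].
    by have [_ _ h] := hs j; exact: h.
  (* The cutoff commutes with division by |x|, so [cut_tends] applies to f / |x|. *)
  have E : (fun j => hardy_quot (cut (eta j) f)) = fun j => cut (eta j) (hardy_quot f).
    apply/funext => j; apply/funext => x; rewrite /hardy_quot /cut /rscal !scalerA.
    by rewrite mulrC.
  by rewrite E; exact: cut_tends.
Qed.

Theorem dirac_dom_energy : L2 (hardy_quot f) ->
  exists h : 'I_3 -> R3 R -> spinor R, [/\ forall k, weak_cdv A k f (h k),
    m ^+ 2 * nrm2 f + \sum_k nrm2 (h k) <= nrm2 Hf + (C0 * nrm2 (hardy_quot f) + N * nrm2 f) &
    nrm2 (hardy_quot f) <= 4 * \sum_k nrm2 (h k)].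
Proof.
move=> Lh; have [G [cG Gf HGf hGf]] := dirac_dom_approx Lh.
have LG j := Cc_L2 (cG j); have LHG j := LH (cG j).
have [LhG hardyG] := all_and2 (fun j => hardy_Cc lA (cG j)).
have LcG k j := L2_cdv k lA (cG j).
have cauchy k : exists h, L2 h /\ cvL2 (fun j => cdv A k (G j)) h.
  suff [h Lh' hh] : exists2 h, L2 h & cvL2 (fun j => cdv A k (G j)) h by exists h.
  apply: (L2_complete (LcG k)) => e e0.
  (* The sum of the coefficients of the three norms on the right of the energy inequality. *)
  pose c := 1 + C0 + N; have c0 : 0 < c.
    by have := C00; have := N0; rewrite /c; lra.
  have d0 : 0 < e / c by rewrite divr_gt0.
  have [N1 hN1] := cvL2_cauchy LG Lf Gf d0.
  have [N2 hN2] := cvL2_cauchy LHG LHf HGf d0.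
  have [N3 hN3] := cvL2_cauchy LhG Lh hGf d0.
  exists (N1 + N2 + N3)%N => i j Ni Nj.
  have leN n : (N1 + N2 + N3 <= n)%N -> [/\ (N1 <= n)%N, (N2 <= n)%N & (N3 <= n)%N].
    by move=> Nn; split; apply: leq_trans Nn; rewrite ?leq_addl// -addnA ?leq_addr// addnCA leq_addr.
  have [i1 i2 i3] := leN i Ni; have [j1 j2 j3] := leN j Nj.
  have cB := Cc_spinorB (cG i) (cG j).
  have -> : (fun x => cdv A k (G i) x - cdv A k (G j) x) = cdv A k (fun x => G i x - G j x).
    by apply/funext => x; rewrite cdvB.
  have := energy_le cB.
  have -> : H (fun x => G i x - G j x) = fun x => H (G i) x - H (G j) x.
    by apply/funext => x; rewrite diracB.
  have -> : hardy_quot (fun x => G i x - G j x) = fun x => hardy_quot (G i) x - hardy_quot (G j) x.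
    by apply/funext => x; rewrite /hardy_quot rscalB.
  rewrite (bigD1 k)//=.
  have := hN1 i j i1 j1; have := hN2 i j i2 j2; have := hN3 i j i3 j3.
  have := nrm2_ge0 (fun x => G i x - G j x).
  have : 0 <= \sum_(l | l != k) nrm2 (cdv A l (fun x => G i x - G j x)).
    by apply: sumr_ge0 => l _; exact: nrm2_ge0.
  move: (nrm2 (cdv A k _)) (\sum_(l | _) _) (nrm2 (fun x => G i x - G j x)) (nrm2 (fun x => H _ x - _))
    (nrm2 (fun x => hardy_quot _ x - _)) => p q r s t q0 r0 ht hs hr h.
  have m0 : 0 <= m ^+ 2 * r by rewrite mulr_ge0 ?sqr_ge0.
  have h1 : C0 * t <= C0 * (e / c) by rewrite ler_wpM2l.
  have h2 : N * r <= N * (e / c) by rewrite ler_wpM2l.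
  have -> : e = e / c + C0 * (e / c) + N * (e / c).
    by rewrite /c; field; rewrite gt_eqF.
  lra.
have [h hP] := choice cauchy.
have Lhh k : L2 (h k) by have [] := hP k.
have ch k : cvL2 (fun j => cdv A k (G j)) (h k) by have [] := hP k.
have nG := cvL2_nrm2 LG Lf Gf; have nHG := cvL2_nrm2 LHG LHf HGf.
have nhG := cvL2_nrm2 LhG Lh hGf; have nc k := cvL2_nrm2 (LcG k) (Lhh k) (ch k).
have nS : \sum_k nrm2 (cdv A k (G j)) @[j --> \oo] --> \sum_k nrm2 (h k).
  rewrite sum3; under eq_fun do rewrite sum3.
  exact: (cvgD (cvgD (nc k0) (nc k1)) (nc k2)).
exists h; split.
- move=> k; split=> // psi cpsi; have Lp := Cc_L2 cpsi; have Lcp := L2_cdv k lA cpsi.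
  have l1 := cvL2_rdot (LcG k) (Lhh k) Lp (ch k).
  have l2 : rdot (cdv A k (G j)) psi @[j --> \oo] --> - rdot f (cdv A k psi).
    have E j : rdot (cdv A k (G j)) psi = - rdot (G j) (cdv A k psi).
      by have [_] := weak_cdv_cdv k lA (cG j); apply.
    under eq_fun do rewrite E.
    by apply: cvgN; exact: cvL2_rdot.
  exact: (cvg_unique _ l1 l2).
- have lim1 : m ^+ 2 * nrm2 (G j) + \sum_k nrm2 (cdv A k (G j)) @[j --> \oo] -->
      m ^+ 2 * nrm2 f + \sum_k nrm2 (h k) by exact: (cvgD (cvgM (cvg_cst _) nG) nS).
  have lim2 : nrm2 (H (G j)) + (C0 * nrm2 (hardy_quot (G j)) + N * nrm2 (G j)) @[j --> \oo] -->
      nrm2 Hf + (C0 * nrm2 (hardy_quot f) + N * nrm2 f).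
    exact: (cvgD nHG (cvgD (cvgM (cvg_cst _) nhG) (cvgM (cvg_cst _) nG))).
  by apply: (ler_cvg_to lim1 lim2); apply: nearW => j; exact: energy_le.
- have lim2 : 4 * \sum_k nrm2 (cdv A k (G j)) @[j --> \oo] --> 4 * \sum_k nrm2 (h k).
    exact: (cvgM (cvg_cst _) nS).
  by apply: (ler_cvg_to nhG lim2); apply: nearW => j; exact: hardyG.
Qed.

End DiracDomain.

(** * The inequality in the extended reals *)

Lemma cov_energy_le (R : realType) (A : R3 R -> R3 R) f (h : 'I_3 -> R3 R -> spinor R) :
  locL2 A -> L2 f -> (forall k, weak_cdv A k f (h k)) ->
  (cov_energy A f <= (\sum_k nrm2 (h k))%:E)%E.
Proof.
move=> lA Lf wh; apply: ereal_inf_lbound; exists h; first by move=> k; apply/weak_cdvP.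
by rewrite -sumEFin; apply: eq_bigr => k _; rewrite L2_normsqE//; case: (wh k).
Qed.

(** A lower bound for every weak gradient takes the place of the uniqueness of the weak gradient. *)
Lemma le_cov_energy (R : realType) (A : R3 R -> R3 R) f (y : \bar R) :
  locL2 A -> L2 f ->
  (forall h, (forall k, weak_cdv A k f (h k)) -> y <= (\sum_k nrm2 (h k))%:E)%E ->
  (y <= cov_energy A f)%E.
Proof.
move=> lA Lf hy; apply: le_ereal_inf_tmp => _ [h hh <-].
have wh k : weak_cdv A k f (h k) by apply/weak_cdvP.
rewrite (eq_bigr (fun k => (nrm2 (h k))%:E)) ?sumEFin; first exact: hy.
by move=> k _; rewrite L2_normsqE//; case: (wh k).
Qed.

Theorem proposition1p5 (R : realType) (m : R) (A B1 B2 : R3 R -> R3 R)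
    (C0 N2 : R)
    (hA : selfadjointness_assumption m A)
    (hcurl : weak_curl A (fun x => B1 x + B2 x))
    (mB1 : measurable_fun setT B1) (mB2 : measurable_fun setT B2)
    (hC0 : Lnorm (leb3 R) +oo%E (fun x => (enorm x ^+ 2 * enorm (B1 x))%:E) = C0%:E)
    (hN2 : Lnorm (leb3 R) +oo%E (fun x => (enorm (B2 x))%:E) = N2%:E)
    (hB20 : m = 0 -> {ae leb3 R, forall x, B2 x = 0})
    (f Hf : R3 R -> spinor R) (hf : dirac_dom m A f Hf)
    (eps : R) (heps : eps < 1) :
  ((m ^+ 2)%:E * \int[leb3 R]_x (sqn (f x))%:E
   + ((1 - eps) / 4 - C0)%:E * \int[leb3 R]_x (sqn (f x) / enorm x ^+ 2)%:E
   + eps%:E * cov_energy A f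
   <= (if m == 0 then 1 else 1 + N2 / m ^+ 2)%:E
      * \int[leb3 R]_x (sqn (Hf x))%:E)%E.
Proof.
have [LH _ _] := hA.
have lA := locL2_of_dirac LH.
have [Lf LHf [q [Gq fq Hq]]] := hf.
pose F n := (q n).1.
have cF n : Cc_infty_spinor (F n) by have [] := Gq n.
have qE n : (q n).2 = Defs.dirac m A (F n) by have [] := Gq n.
have LF n := Cc_L2 (cF n); have LHF n := LH _ (cF n).
have Ff : cvL2 F f by exact: cvL2_normsq.
have HFf : cvL2 (fun n => Defs.dirac m A (F n)) Hf.
  by apply: cvL2_normsq => //; under eq_fun => n do rewrite -qE.
have C00 : 0 <= C0 by rewrite -lee_fin -hC0 Lnorm_ge0.
have N20 : 0 <= N2 by rewrite -lee_fin -hN2 Lnorm_ge0.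
have hB1 : {ae leb3 R, forall x, enorm x ^+ 2 * enorm (B1 x) <= C0}.
  by apply: Lnormy_ae => // x; rewrite mulr_ge0 ?sqr_ge0 ?enorm_ge0.
(* For m = 0 the field B2 vanishes almost everywhere, so 0 bounds it and the term that a mass would
   absorb disappears. *)
pose N := if m == 0 then 0 else N2.
have N0 : 0 <= N by rewrite /N; case: ifP.
have hB2 : {ae leb3 R, forall x, enorm (B2 x) <= N}.
  rewrite /N; have [m0|_] := eqVneq m 0; last by apply: Lnormy_ae => // x; exact: enorm_ge0.
  have FF : Filter (almost_everywhere (leb3 R)) by exact: ae_filter_ringOfSetsType.
  apply: filterS (hB20 m0) => x ->; rewrite -sqrtr0 ler_wsqrtr//.
  by rewrite /edot big1// => k _; rewrite (_ : crd 0 k = 0) ?mulr0// /crd; case: (val k) => [|[]].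
have mass := dirac_dom_mass_le lA LH Lf LHf cF Ff HFf.
pose K := if m == 0 then 1 else 1 + N2 / m ^+ 2.
have KH : nrm2 Hf + N * nrm2 f <= K * nrm2 Hf.
  rewrite /K /N; have [_|m0] := eqVneq m 0; first by rewrite mul0r addr0 mul1r.
  rewrite mulrDl mul1r lerD2l -mulrA ler_wpM2l// -(ler_pM2l (x := m ^+ 2)) ?exprn_even_gt0//.
  by rewrite mulrA divff ?mul1r// expf_neq0.
have -> : (\int[leb3 R]_x (sqn (f x))%:E)%E = (nrm2 f)%:E by exact: L2_normsqE.
have -> : (\int[leb3 R]_x (sqn (Hf x))%:E)%E = (nrm2 Hf)%:E by exact: L2_normsqE.
rewrite -/K -!EFinM.
have Y0 := nrm2_ge0 Hf; have X0 := nrm2_ge0 f.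
have [Lh|nLh] := pselect (L2 (hardy_quot f)).
  rewrite -normsq_hardy_quot L2_normsqE//.
  have [h [wh hS hJ]] :=
    dirac_dom_energy lA LH hcurl mB1 mB2 hB1 hB2 C00 N0 Lf LHf cF Ff HFf Lh.
  have leE := cov_energy_le lA Lf wh.
  have geE : ((nrm2 (hardy_quot f) / 4)%:E <= cov_energy A f)%E.
    apply: le_cov_energy => // g wg; rewrite lee_fin ler_pdivrMr// mulrC -lee_fin.
    rewrite -L2_normsqE// normsq_hardy_quot.
    exact: (dirac_dom_hardy lA LH hcurl mB1 mB2 hB1 hB2 C00 N0 Lf LHf cF Ff HFf wg).
  have finE : cov_energy A f \is a fin_num.
    by rewrite fin_numElt (lt_le_trans (ltNyr _) geE) (le_lt_trans leE (ltry _)).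
  move: leE geE; rewrite -(fineK finE); move: (fine _) => e.
  rewrite -!EFinM -!EFinD !lee_fin => leE geE.
  apply: le_trans KH.
  move: (nrm2 (hardy_quot f)) (\sum_k _) (nrm2 f) (nrm2 Hf) hS hJ leE geE => J S X Y hS hJ leE geE.
  (* With e the covariant energy, J that of f / |x| and S the energy of the gradient h: if eps >= 0,
     then e <= S and J <= 4 S bound the terms with coefficients eps and (1 - eps) / 4 by S in
     all. *)
  have [e0|e0] := leP 0 eps.
    have h1 : eps * e <= eps * S by rewrite ler_wpM2l.
    have h2 : (1 - eps) * J <= (1 - eps) * (4 * S) by rewrite ler_wpM2l// subr_ge0 ltW.
    by lra.
  (* A negative eps reverses the inequality, so the lower bound J / 4 <= e is needed; the terms in
     eps then cancel and J / 4 <= S remains. *)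
  have h1 : eps * e <= eps * (J / 4) by rewrite ler_wnM2l// ltW.
  by lra.
have Ioo : (\int[leb3 R]_x (sqn (f x) / enorm x ^+ 2)%:E = +oo)%E.
  apply/eqP; rewrite eq_le leey/= leNgt; apply/negP => Ifin; apply: nLh.
  by split; [exact/spinor_mfun_hardy_quot/L2_spinor_mfun|rewrite normsq_hardy_quot].
rewrite Ioo; set a := (1 - eps) / 4 - C0.
(* The Hardy term is -oo and absorbs the rest of the sum, since oo - oo is -oo. *)
have [a0|a0] := ltP a 0; first by rewrite lt0_muley ?lte_fin// addeNy addNye leNye.
have C04 : 4^-1 <= C0.
  rewrite leNgt; apply/negP => C04; apply: nLh.
  exact: (dirac_dom_hardy_quot lA LH hcurl mB1 mB2 hB1 hB2 C00 N0 Lf LHf cF Ff HFf C04).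
(* From a >= 0 and C0 >= 1/4 it follows that eps <= 0, with a = 0 if eps = 0. *)
have [e0|e0|e0] := ltgtP eps 0.
(* By the Hardy inequality no weak gradient of f is square integrable, so the infimum is over the
   empty set. *)
- have -> : cov_energy A f = +oo%E.
    apply/eqP; rewrite eq_le leey/=; apply: le_cov_energy => // g wg.
    have := dirac_dom_hardy lA LH hcurl mB1 mB2 hB1 hB2 C00 N0 Lf LHf cF Ff HFf wg.
    by rewrite Ioo.
  by rewrite (lt0_muley (x := eps%:E)) ?lte_fin// addeNy leNye.
- by exfalso; move: a0; rewrite /a; lra.
(* Here 0 times +oo is 0, and the mass estimate alone is left. *)
- have -> : a = 0 by apply/eqP; rewrite eq_le a0 andbT /a e0; lra.
  rewrite e0 !mul0e !adde0 lee_fin; apply: le_trans mass _; apply: le_trans KH.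
  by rewrite lerDl mulr_ge0.
Qed.
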